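(* Let $n\ge 1$. Given functions $f_0,f_1\in C^\infty(\mathbb R^n)$, there exist infinitely many waves $u(x,t)$ on $\mathbb R^n$ such that $u_0=f_0$ and $u_1=f_1$.
   Context: A wave on $\mathbb R^n$ is a function $u\in C^\infty(\mathbb R^n\times\mathbb R)$ satisfying the wave equation $\Delta u=\partial^2u/\partial t^2$, where $\Delta=\sum_{j=1}^n\partial^2/\partial x_j^2$. For $t\in\mathbb R$, the snapshot of $u$ at time $t$ is the function $u_t(x)=u(x,t)$ on $\mathbb R^n$. Functions are complex-valued. *)

(* Defs.v *)
From HB Require Import structures.
From mathcomp Require Import all_boot all_order all_algebra.
From mathcomp Require Import complex.
From mathcomp Require Import boolp classical_sets functions cardinality reals.
From mathcomp Require Import topology normedtype derive.

Set Implicit Arguments.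
Unset Strict Implicit.
Unset Printing Implicit Defensive.

Import Order.TTheory GRing.Theory Num.Theory.
Import numFieldNormedType.Exports.

Local Open Scope classical_set_scope.
Local Open Scope ring_scope.

(* [Rcomplex R] is the library's alias of [R[i]] regarded as a real algebra,
   normed by the modulus; it comes without a topology. *)
Section Rcomplex_normedModType.
Variable R : realType.

HB.instance Definition _ := isPointed.Build (Rcomplex R) 0.

HB.instance Definition _ :=
  PseudoMetric.copy (Rcomplex R) (pseudoMetric_normed (Rcomplex R)).

HB.instance Definition _ :=
  NormedZmod_PseudoMetric_eq.Build R (Rcomplex R) erefl.

Lemma Rcomplex_normrZ (l : R) (z : Rcomplex R) : `|l *: z| = `|l| * `|z|.
Proof.
case: z => a b; have -> : `|l *: (Complex a b : Rcomplex R)| =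
    Num.sqrt ((l * a) ^+ 2 + (l * b) ^+ 2) by [].
have -> : `|(Complex a b : Rcomplex R)| = Num.sqrt (a ^+ 2 + b ^+ 2) by [].
by rewrite !exprMn -mulrDr sqrtrM ?sqr_ge0// sqrtr_sqr.
Qed.

HB.instance Definition _ :=
  PseudoMetricNormedZmod_Lmodule_isNormedModule.Build R (Rcomplex R)
    Rcomplex_normrZ.

End Rcomplex_normedModType.

Section Smooth.
Context {R : realType} {V W : normedModType R} {I : Type}.

(* [f] is C^k with respect to the family of directions [e]: the iterated
   derivatives of [f] along members of [e], up to order [k], exist everywhere
   and are continuous on V.  When [e] is a basis of a finite-dimensional [V]
   this is the usual class C^k(V). *)
Fixpoint Ck (e : I -> V) (k : nat) (f : V -> W) : Prop :=
  continuous f /\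
  if k is k'.+1 then
    forall i : I, (forall x, derivable f x (e i)) /\ Ck e k' ('D_(e i) f)
  else True.

Definition smooth (e : I -> V) (f : V -> W) : Prop := forall k, Ck e k f.

End Smooth.

Section Waves.
Context {R : realType} {n : nat}.

Definition space_dir (j : 'I_n) : 'rV[R]_n := delta_mx ord0 j.

(* [None] is the time direction. *)
Definition spacetime_dir (j : option 'I_n) : 'rV[R]_n * R :=
  if j is Some i then (space_dir i, 0) else (0, 1).

Definition laplacian (u : 'rV[R]_n * R -> Rcomplex R) :
    'rV[R]_n * R -> Rcomplex R :=
  fun p => \sum_(j < n)
    'D_(spacetime_dir (Some j)) ('D_(spacetime_dir (Some j)) u) p.

Definition is_wave (u : 'rV[R]_n * R -> Rcomplex R) : Prop :=
  smooth spacetime_dir u /\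
  forall p,
    laplacian u p = 'D_(spacetime_dir None) ('D_(spacetime_dir None) u) p.

Definition snapshot (u : 'rV[R]_n * R -> Rcomplex R) (t : R) :
    'rV[R]_n -> Rcomplex R :=
  fun x => u (x, t).

End Waves.

(* Main.v *)
(** A real wave u with u_0 = 0 and u_1 = f is obtained by exhausting the space.
    Suppose that f vanishes for |x| < j (sup norm); on the shell |x| < j + 1 write f
    as a sum of pieces p supported in half-spaces {σ x_i >= j - 1}, σ = ±1, and in a
    box.  Expand p(x) exp(-σ s x_i) in a sine series on the box and multiply back by
    exp(σ s x_i): p becomes a superposition of exponentials exp(ζ.x) with
    Re ζ = σ s e_i.  Each of them is the time 1 value of the wave
    exp(ζ.x) sinh(ρ t) / sinh ρ, ρ² = ζ.ζ, which vanishes at time 0.  As Im ζ_i <> 0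
    (a sine series has no zero frequency), Re ρ <> 0 and sinh ρ is bounded below by a
    negative power of s and of the frequencies, while the coefficients are
    O(exp(- s (j - 1))) up to powers of s and decay fast in the frequencies.  Since
    |Re ρ| <= s, for s large the resulting wave is as small as desired, with its
    derivatives, where σ x_i + |t| <= j - 2.  Subtracting it and passing to the next
    shell gives a series of waves which converges with all derivatives on bounded sets.

    The reflection t -> 1 - t treats the datum at time 0, real and imaginary parts
    are solved separately, and infinitely many solutions arise from adding multiples
    of sin(π t) sin(π x_1), a wave vanishing at times 0 and 1. *)

Require Import Defs.
From mathcomp Require Import all_boot all_order all_algebra.
From mathcomp Require Import complex ring lra.
From mathcomp Require Import boolp classical_sets functions cardinality reals
  interval_inference prodnormedzmodule.
From mathcomp Require Import topology normedtype derive sequences realfun exp trigo.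
From mathcomp Require Import measure lebesgue_measure lebesgue_integral ftc.

Set Implicit Arguments.
Unset Strict Implicit.
Unset Printing Implicit Defensive.

Import Order.TTheory GRing.Theory Num.Theory.
Import numFieldNormedType.Exports.

Local Open Scope classical_set_scope.
Local Open Scope ring_scope.

(** * Smooth functions and iterated derivatives *)

(** The tilt by exp(- σ s x_i) answers a small-divisor problem. Expanding a piece p itself would
    give purely imaginary ζ and ρ, and then |sinh ρ| = |sin |ρ|| may vanish or come close to 0 along
    the frequencies, so that the value at time 1 could not be prescribed exponential by exponential.
    With the tilt the losses are only polynomial in s and in the frequencies, and integrating by
    parts more often repays any such loss. The sine coefficients do not depend on the number of
    integrations by parts; so s can be fixed from the finitely many derivatives that must be small,
    and all other derivatives still converge for that same s. On the j-th shell only orders up to j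
    are made small, which suffices because a given derivative has order at most j for all large j.
    The sine series is summed by recovering a function from its second derivatives: they are
    integrated against partial sums of the Green kernel, whose uniform convergence reduces to one
    explicit cosine series. *)

Section Dirderiv.
Context {R : realType} {V W : normedModType R}.
Implicit Types (f g : V -> W) (x v : V).

Lemma is_derive_le f x v d :
  (forall eps : R, 0 < eps -> exists2 r : R, 0 < r &
    forall h, h != 0 -> `|h| < r -> `|h^-1 *: (f (h *: v + x) - f x) - d| <= eps) ->
  is_derive x v f d.
Proof.
move=> H.
have cv : (fun h => h^-1 *: ((f \o shift x) (h *: v) - f x)) @ 0^' --> d.
  apply/cvgrPdist_le => eps e0; have [r r0 Hr] := H eps e0.
  near=> h; rewrite distrC; apply: Hr.
    by near: h; exact: nbhs_dnbhs_neq.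
  by near: h; apply: dnbhs0_lt.
by split; [exact: cvgP cv|exact: cvg_lim cv].
Unshelve. all: by end_near. Qed.

Lemma is_derive_ex_le f x v d (e : R) : is_derive x v f d -> 0 < e ->
  exists2 r : R, 0 < r &
    forall h, h != 0 -> `|h| < r -> `|h^-1 *: (f (h *: v + x) - f x) - d| <= e.
Proof.
move=> [df <-] e0.
have /cvgrPdist_le/(_ e e0) : (fun h => h^-1 *: ((f \o shift x) (h *: v) - f x)) @ 0^' -->
  'D_v f x by [].
move=> /nbhs_ballP[r /= r0 Hr]; exists r => // h h0 hr.
by rewrite distrC; apply: Hr => //; rewrite /ball /= sub0r normrN.
Qed.

End Dirderiv.

Section Words.
Context {R : realType} {V W : normedModType R} {I : Type} (e : I -> V).
Implicit Types (f g : V -> W) (w : seq I).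

(* Iterated derivative along the word [w], whose first letter is differentiated first. *)
Definition Dw w f : V -> W := foldl (fun g i => 'D_(e i) g) f w.

Lemma Dw_rcons w i f : Dw (rcons w i) f = 'D_(e i) (Dw w f).
Proof. by rewrite /Dw -cats1 foldl_cat. Qed.

Lemma Dw_rconsE w i f x : Dw (rcons w i) f x = 'D_(e i) (Dw w f) x.
Proof. by rewrite Dw_rcons. Qed.

Lemma Dw_cat w1 w2 f : Dw (w1 ++ w2) f = Dw w2 (Dw w1 f).
Proof. exact: foldl_cat. Qed.

Lemma smooth_continuous f : smooth e f -> continuous f.
Proof. by move=> /(_ 0%N) []. Qed.

Lemma smooth_derivable f i x : smooth e f -> derivable f x (e i).
Proof. by move=> /(_ 1%N) [_ /(_ i)[+ _]]. Qed.

Lemma smooth_D f i : smooth e f -> smooth e ('D_(e i) f).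
Proof. by move=> sf k; have /= [_ /(_ i)[]] := sf k.+1. Qed.

Lemma smooth_Dw w f : smooth e f -> smooth e (Dw w f).
Proof. by elim: w f => //= i w IH f sf; apply: IH; exact: smooth_D. Qed.

Lemma smooth_is_derive f i x : smooth e f -> is_derive x (e i) f ('D_(e i) f x).
Proof. by move=> sf; apply/derivableP; exact: smooth_derivable. Qed.

Lemma smooth_is_derive_Dw f w i x : smooth e f ->
  is_derive x (e i) (Dw w f) (Dw (rcons w i) f x).
Proof. by move=> sf; rewrite Dw_rcons; apply: smooth_is_derive; exact: smooth_Dw. Qed.

(** Once candidates for all iterated derivatives are listed by words, one differentiation step
    identifies each with the next, and induction on the order gives smoothness. The values of the
    derivatives come with it, which is what later estimates need. *)
Lemma smooth_family (G : seq I -> V -> W) :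
  (forall w, continuous (G w)) ->
  (forall w i x, is_derive x (e i) (G w) (G (rcons w i) x)) ->
  smooth e (G [::]) /\ forall w, Dw w (G [::]) = G w.
Proof.
move=> cG dG.
have DG w i : 'D_(e i) (G w) = G (rcons w i).
  by apply/funext => x; have := dG w i x => d; rewrite derive_val.
split; last by elim/last_ind => // w i IH; rewrite Dw_rcons IH DG.
move=> k; elim: k [::] => [w|k IH w] /=; first by split.
split => // i; split; last by rewrite DG; exact: IH.
by move=> x; have := dG w i x => d; exact: ex_derive.
Qed.

Lemma smoothD f g : smooth e f -> smooth e g ->
  smooth e (fun x => f x + g x) /\
  forall w, Dw w (fun x => f x + g x) = (fun x => Dw w f x + Dw w g x).
Proof.
move=> sf sg.
apply: (@smooth_family (fun w x => Dw w f x + Dw w g x)) => [w|w i x].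
  by move=> x; apply: continuousD; apply: smooth_continuous; exact: smooth_Dw.
have := smooth_is_derive_Dw w i x sf; have := smooth_is_derive_Dw w i x sg => dg df.
exact: is_deriveD.
Qed.

Lemma smoothZ (c : R) f : smooth e f ->
  smooth e (fun x => c *: f x) /\
  forall w, Dw w (fun x => c *: f x) = (fun x => c *: Dw w f x).
Proof.
move=> sf.
apply: (@smooth_family (fun w x => c *: Dw w f x)) => [w|w i x].
  by move=> x; apply: continuousZr; apply: smooth_continuous; exact: smooth_Dw.
have df := smooth_is_derive_Dw w i x sf.
exact: is_deriveZ.
Qed.

Lemma smooth_cst (c : W) : smooth e (fun=> c) /\
  forall w, Dw w (fun=> c) = (fun=> if w is [::] then c else 0).
Proof.
apply: (@smooth_family (fun w _ => if w is [::] then c else 0)) => [w x|w i x].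
  exact: cst_continuous.
by case: w => [|j w]; exact: is_derive_cst.
Qed.

Lemma smooth_sum J (r : seq J) (P : pred J) (F : J -> V -> W) :
  (forall j, smooth e (F j)) ->
  smooth e (fun x => \sum_(j <- r | P j) F j x) /\
  forall w, Dw w (fun x => \sum_(j <- r | P j) F j x) =
    (fun x => \sum_(j <- r | P j) Dw w (F j) x).
Proof.
move=> sF; elim: r => [|j r [IH1 IH2]].
  have -> : (fun x => \sum_(j <- [::] | P j) F j x) = fun=> 0.
    by apply/funext => x; rewrite big_nil.
  split=> [|w]; first by have [] := smooth_cst 0.
  by rewrite (smooth_cst 0).2; apply/funext => x; rewrite big_nil; case: w.
have -> : (fun x => \sum_(j <- j :: r | P j) F j x) =
   fun x => (if P j then F j x else 0) + \sum_(j <- r | P j) F j x.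
  by apply/funext => x; rewrite big_cons; case: ifP => //; rewrite add0r.
case: (boolP (P j)) => Pj.
  have [s1 s2] := smoothD (sF j) IH1; split=> // w; rewrite s2; apply/funext => x.
  by rewrite IH2 big_cons Pj.
have -> : (fun x => 0 + \sum_(j <- r | P j) F j x) = fun x => \sum_(j <- r | P j) F j x.
  by apply/funext => x; rewrite add0r.
by split=> // w; rewrite IH2; apply/funext => x; rewrite big_cons (negbTE Pj).
Qed.

End Words.

Section RealSmooth.
Context {R : realType} {V : normedModType R} {I : Type} (e : I -> V).
Implicit Types (f g : V -> R) (w : seq I).

Lemma CkD k f g : Ck e k (f : V -> R^o) -> Ck e k (g : V -> R^o) ->
  Ck e k (f + g : V -> R^o).
Proof.
elim: k f g => [|k IH] f g /= [cf df] [cg dg].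
  by split=> // x; apply: continuousD; [exact: cf|exact: cg].
split=> [x|i]; first by apply: continuousD; [exact: cf|exact: cg].
have [df1 df2] := df i; have [dg1 dg2] := dg i; split=> [x|].
  exact: derivableD.
have -> : 'D_(e i) (f + g : V -> R^o) = 'D_(e i) (f : V -> R^o) + 'D_(e i) (g : V -> R^o).
  by apply/funext => x; rewrite deriveD.
exact: IH.
Qed.

Lemma CkW k f : Ck e k.+1 (f : V -> R^o) -> Ck e k (f : V -> R^o).
Proof.
elim: k f => [|k IH] f [cf df]; first by split.
by split => // i; have [d1 d2] := df i; split => //; exact: IH.
Qed.

(** The Leibniz rule over words has no short closed form, so products are handled by induction on
    the order; this keeps smoothness but not the values of the derivatives. *)
Lemma CkM k f g : Ck e k (f : V -> R^o) -> Ck e k (g : V -> R^o) ->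
  Ck e k (f * g : V -> R^o).
Proof.
elim: k f g => [|k IH] f g fk gk.
  by split=> // x; apply: continuousM; [have [+ _] := fk|have [+ _] := gk]; exact.
have [[cf df] [cg dg]] := (fk, gk).
split=> [x|i]; first by apply: continuousM; [exact: cf|exact: cg].
have [df1 df2] := df i; have [dg1 dg2] := dg i; split=> [x|].
  exact: derivableM.
have -> : 'D_(e i) (f * g : V -> R^o) =
    f * 'D_(e i) (g : V -> R^o) + g * 'D_(e i) (f : V -> R^o).
  by apply/funext => x; rewrite deriveM.
by apply: CkD; apply: IH => //; exact: CkW.
Qed.

Lemma smoothM f g : smooth e (f : V -> R^o) -> smooth e (g : V -> R^o) ->
  smooth e (fun x => f x * g x : R^o).
Proof. by move=> sf sg k; exact: CkM. Qed.

Lemma smoothV f : smooth e (f : V -> R^o) -> (forall x, f x != 0) ->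
  smooth e (fun x => (f x)^-1 : R^o).
Proof.
move=> sf f0; elim=> [|k IH].
  by split=> // x; apply: continuousV => //; exact: smooth_continuous sf x.
split=> [x|i]; first by apply: continuousV => //; exact: smooth_continuous sf x.
split=> [x|]; first by apply: derivableV => //; exact: smooth_derivable.
(* The derivative contains [1/f] only undifferentiated, so order [k] of [1/f] yields order
   [k.+1]. *)
have -> : 'D_(e i) ((fun x => (f x)^-1) : V -> R^o) =
    (fun=> -1) * ((fun x => (f x)^-1) * (fun x => (f x)^-1)) * ('D_(e i) (f : V -> R^o)).
  apply/funext => x; rewrite deriveV //; last exact: smooth_derivable.
  rewrite /GRing.scale/= !fctE; field; exact: f0.
apply: CkM; last exact: smooth_D.
apply: CkM; first by have [+ _] := smooth_cst e (-1 : R^o); exact.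
exact: CkM.
Qed.

(** The one-variable mean value theorem along a line. Keeping only [|c| <= |t|] spares the users a
    discussion of the sign of [t]. *)
Lemma MVT_dir f (v : V) (x : V) (t : R) :
  (forall y, derivable (f : V -> R^o) y v) ->
  exists2 c, `|c| <= `|t| & f (t *: v + x) - f x = t * 'D_v (f : V -> R^o) (c *: v + x).
Proof.
move=> df.
pose phi (s : R) := f (s *: v + x).
have phi0 : phi 0 = f x by rewrite /phi scale0r add0r.
have dphi (s : R) : is_derive s 1 phi ('D_v (f : V -> R^o) (s *: v + x)).
  apply: is_derive_le => eps e0.
  have [r r0 Hr] := is_derive_ex_le (derivableP (df (s *: v + x))) e0.
  exists r => // h h0 hr; have := Hr h h0 hr.
  by rewrite /phi [h *: 1]mulr1 scalerDl addrA.
have cphi : continuous phi.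
  by move=> s; apply/differentiable_continuous/derivable1_diffP; have := dphi s => d;
    exact: ex_derive.
have [t0|t0] := leP 0 t.
  have [c] := @MVT_segment _ phi (fun s => 'D_v (f : V -> R^o) (s *: v + x)) 0 t t0
    (fun s _ => dphi s) (continuous_subspaceT cphi).
  rewrite in_itv /= => /andP[c0 ct] E; exists c; first by rewrite !ger0_norm.
  by rewrite -phi0 E subr0 mulrC.
have [c] := @MVT_segment _ phi (fun s => 'D_v (f : V -> R^o) (s *: v + x)) t 0 (ltW t0)
    (fun s _ => dphi s) (continuous_subspaceT cphi).
rewrite in_itv /= => /andP[ct c0] E; exists c; first by rewrite (ler0_norm c0) (ltr0_norm t0) lerN2.
by rewrite -phi0 -opprB E sub0r mulrN opprK mulrC.
Qed.

End RealSmooth.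

Lemma cvg_norm_le {R : realType} (u : nat -> R) (l a : R) N :
  u K @[K --> \oo] --> l -> (forall K, (N <= K)%N -> `|u K| <= a) -> `|l| <= a.
Proof.
move=> ul ua; apply/ler_addgt0Pr => d d0.
have /cvgrPdist_le/(_ d d0)[N' _ HN'] := ul.
have H1 := HN' (maxn N N') (leq_maxr _ _); have H2 := ua (maxn N N') (leq_maxl _ _).
rewrite -[l](subrK (u (maxn N N'))) addrC.
by apply: le_trans (ler_normD _ _) _; exact: lerD.
Qed.

Section Limit.
Context {R : realType} {V : normedModType R} {I : Type} (e : I -> V).

(** Limits and derivatives are exchanged through the mean value theorem: for each large [K] the
    difference quotient of [Dw e w (F K)] is a value of the next derivative at a nearby point, hence
    close to [G (rcons w i) x]. The bound holds with [h] fixed, so it passes to the limit in [K]. *)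
Lemma smooth_limit (F : nat -> V -> R) :
  (forall K, smooth e (F K : V -> R^o)) ->
  (forall w (rho eps : R), 0 < eps -> exists N, forall K K', (N <= K)%N -> (N <= K')%N ->
     forall x, `|x| <= rho ->
       `|Dw e w (F K : V -> R^o) x - Dw e w (F K' : V -> R^o) x| <= eps) ->
  exists f : V -> R, smooth e (f : V -> R^o) /\
    forall w x, Dw e w (F K : V -> R^o) x @[K --> \oo] --> Dw e w (f : V -> R^o) x.
Proof.
move=> sF cF.
pose G w x : R := lim (Dw e w (F K : V -> R^o) x @[K --> \oo]).
have cG w x : Dw e w (F K : V -> R^o) x @[K --> \oo] --> G w x.
  suff : cvg (Dw e w (F K : V -> R^o) x @[K --> \oo]) by [].
  apply/cauchy_cvgP/cauchy_exP => eps e0.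
  have e2 : 0 < eps / 2 by rewrite divr_gt0.
  have [N HN] := cF w `|x| (eps / 2) e2.
  exists (Dw e w (F N : V -> R^o) x); exists N => // K /= NK.
  apply: le_lt_trans (HN N K (leqnn _) NK x (lexx _)) _.
  by rewrite ltr_pdivrMr // ltr_pMr // ltr1n.
have uG w (rho eps : R) : 0 < eps -> exists N, forall K, (N <= K)%N ->
   forall x, `|x| <= rho -> `|Dw e w (F K : V -> R^o) x - G w x| <= eps.
  move=> e0; have [N HN] := cF w rho eps e0; exists N => K NK x xr.
  apply/ler_addgt0Pr => d d0.
  have /cvgrPdist_le/(_ d d0)[N' _ HN'] := cG w x.
  have := HN' (maxn N N') (leq_maxr _ _); rewrite /= distrC => H2.
  have H1 := HN K (maxn N N') NK (leq_maxl _ _) x xr.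
  have -> : Dw e w (F K : V -> R^o) x - G w x =
    (Dw e w (F K : V -> R^o) x - Dw e w (F (maxn N N') : V -> R^o) x)
     + (Dw e w (F (maxn N N') : V -> R^o) x - G w x) by ring.
  by apply: le_trans (ler_normD _ _) _; exact: lerD.
have [G1 G2] : smooth e (G [::] : V -> R^o) /\ forall w, Dw e w (G [::] : V -> R^o) = G w;
  last first.
  by exists (G [::]); split => // w x; rewrite G2.
have ctG w : continuous (G w : V -> R^o).
  move=> x; apply/cvgrPdist_le => eps e0.
  have e3 : 0 < eps / 3 by rewrite divr_gt0.
  have [N HN] := uG w (`|x| + 1) (eps / 3) e3.
  have cN : continuous (Dw e w (F N : V -> R^o)).
    by apply: (smooth_continuous (e := e)); exact: smooth_Dw.
  have /cvgrPdist_le/(_ _ e3) := cN x => H.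
  near=> y.
  have xy : `|x - y| <= 1 by near: y; apply: cvgr_dist_le => //; exact: cvg_id.
  have y1 : `|y| <= `|x| + 1.
    rewrite -[y](subKr x); apply: le_trans (ler_normB _ _) _; exact: lerD.
  have x1 : `|x| <= `|x| + 1 by rewrite lerDl.
  have A := HN N (leqnn _) x x1; have B := HN N (leqnn _) y y1.
  have C : `|Dw e w (F N : V -> R^o) x - Dw e w (F N : V -> R^o) y| <= eps / 3 by near: y.
  have -> : G w x - G w y = - (Dw e w (F N : V -> R^o) x - G w x)
    + (Dw e w (F N : V -> R^o) x - Dw e w (F N : V -> R^o) y)
    + (Dw e w (F N : V -> R^o) y - G w y) by ring.
  apply: le_trans (ler_normD _ _) _.
  have -> : eps = eps / 3 + eps / 3 + eps / 3 by field.
  apply: lerD => //; apply: le_trans (ler_normD _ _) _; apply: lerD => //.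
  by rewrite normrN.
apply: smooth_family => // w i x.
apply: is_derive_le => eps e0.
have e2 : 0 < eps / 2 by rewrite divr_gt0.
have /cvgrPdist_le/(_ _ e2) := ctG (rcons w i) x => /nbhs_ballP[r /= r0 Hr].
(* This keeps the displacement [h *: e i] below [r]; the [+ 1] covers a zero direction. *)
exists (r / (`|e i| + 1)); first by rewrite divr_gt0 // ltr_wpDl.
move=> h h0; rewrite ltr_pdivlMr ?ltr_wpDl // => hr.
have near_x (c : R) : `|c| <= `|h| -> `|(c *: e i + x) - x| < r.
  move=> ch; rewrite addrK normrZ; apply: le_lt_trans hr.
  by apply: ler_pM => //; rewrite lerDl.
have [N HN] := uG (rcons w i) (`|x| + r) (eps / 2) e2.
have bnd K : (N <= K)%N ->
  `|h^-1 * (Dw e w (F K : V -> R^o) (h *: e i + x) - Dw e w (F K : V -> R^o) x)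
    - G (rcons w i) x| <= eps.
  move=> NK.
  have sD := smooth_Dw w (sF K).
  have [c ch ->] := MVT_dir x h (fun y => @smooth_derivable _ _ _ _ e _ i y sD).
  rewrite mulKf // -Dw_rconsE.
  set y := c *: e i + x.
  have yr := near_x c ch; rewrite -/y in yr.
  have y1 : `|y| <= `|x| + r.
    rewrite -[y](subrK x); apply: le_trans (ler_normD _ _) _.
    by rewrite addrC lerD2l ltW.
  have A := HN K NK y y1.
  have B : `|G (rcons w i) x - G (rcons w i) y| <= eps / 2.
    by apply: Hr; rewrite -ball_normE /= distrC.
  have -> : Dw e (rcons w i) (F K : V -> R^o) y - G (rcons w i) x =
     (Dw e (rcons w i) (F K : V -> R^o) y - G (rcons w i) y) - (G (rcons w i) x - G (rcons w i) y).
    by ring.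
  apply: le_trans (ler_normB _ _) _.
  have -> : eps = eps / 2 + eps / 2 by field.
  exact: lerD.
have cvq : h^-1 * (Dw e w (F K : V -> R^o) (h *: e i + x) - Dw e w (F K : V -> R^o) x)
  - G (rcons w i) x @[K --> \oo]
   --> h^-1 * (G w (h *: e i + x) - G w x) - G (rcons w i) x.
  apply: cvgB; last exact: cvg_cst.
  by apply: cvgMr; apply: cvgB; exact: cG.
exact: cvg_norm_le cvq bnd.
Unshelve. all: by end_near. Qed.

End Limit.

(** * The sine series of the Green kernel of an interval *)

Section OneVar.
Context {R : realType}.
Implicit Types (f g : R -> R) (x y z a b : R).

(** These rules concern pointwise expressions, so that a derivative can be assembled as a term that
    mirrors the expression; [is_derive_eq] then leaves an algebraic identity. *)
Lemma dv_add f g x a b : is_derive x 1 f a -> is_derive x 1 g b ->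
  is_derive x 1 (fun y => f y + g y) (a + b).
Proof. by move=> ? ?; exact: is_deriveD. Qed.

Lemma dv_sub f g x a b : is_derive x 1 f a -> is_derive x 1 g b ->
  is_derive x 1 (fun y => f y - g y) (a - b).
Proof. by move=> ? ?; exact: is_deriveB. Qed.

Lemma dv_opp f x a : is_derive x 1 f a -> is_derive x 1 (fun y => - f y) (- a).
Proof. by move=> ?; exact: is_deriveN. Qed.

Lemma dv_mul f g x a b : is_derive x 1 f a -> is_derive x 1 g b ->
  is_derive x 1 (fun y => f y * g y) (f x * b + a * g x).
Proof. by move=> ? ?; rewrite [a * _]mulrC; exact: is_deriveM. Qed.

Lemma dv_scale (k : R) f x a : is_derive x 1 f a -> is_derive x 1 (fun y => k * f y) (k * a).
Proof. by move=> d; exact: (@is_deriveZ _ _ _ f k x 1 a d). Qed.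

Lemma dv_divr (k : R) f x a : is_derive x 1 f a -> is_derive x 1 (fun y => f y / k) (a / k).
Proof.
move=> /(dv_scale k^-1); rewrite mulrC; congr is_derive.
by apply/funext => y; rewrite mulrC.
Qed.

Lemma dv_inv f x a : f x != 0 -> is_derive x 1 f a ->
  is_derive x 1 (fun y => (f y)^-1) (- a / f x ^+ 2).
Proof.
move=> f0 [df <-]; have d := @derivableV _ _ f x 1 f0 df.
split => //; rewrite (@deriveV _ _ f x 1 f0 df) [LHS]mulrC mulrN mulNr //.
Qed.

Lemma dv_id x : is_derive x 1 (fun y : R => y) 1.
Proof. exact: is_derive_id. Qed.

Lemma dv_cst (k x : R) : is_derive x 1 (fun=> k) 0.
Proof. exact: is_derive_cst. Qed.

Lemma dv_comp f g x a b : is_derive x 1 g b -> is_derive (g x) 1 f a ->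
  is_derive x 1 (fun y => f (g y)) (a * b).
Proof. by move=> ? ?; exact: is_derive1_comp. Qed.

Lemma dv_sum (n : nat) (h : 'I_n -> R -> R) x (dh : 'I_n -> R) :
  (forall i, is_derive x 1 (h i) (dh i)) ->
  is_derive x 1 (fun y => \sum_(i < n) h i y) (\sum_(i < n) dh i).
Proof.
move=> H; have := is_derive_sum H; congr is_derive.
by apply/funext => y; rewrite fct_sumE.
Qed.

Lemma is_derive_continuous f (df : R -> R) : (forall x, is_derive x 1 f (df x)) ->
  continuous f.
Proof.
move=> d x; apply/differentiable_continuous/derivable1_diffP.
by have := d x => dx; exact: ex_derive.
Qed.

Lemma is_derive_lip f (df : R -> R) a b (M : R) :
  (forall x, a <= x <= b -> is_derive x 1 f (df x)) ->
  (forall x, a <= x <= b -> `|df x| <= M) ->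
  forall x y, a <= x <= b -> a <= y <= b -> `|f x - f y| <= M * `|x - y|.
Proof.
move=> d dM.
have H x y : a <= x -> y <= b -> x <= y -> `|f y - f x| <= M * `|y - x|.
  move=> ax yb xy.
  have cf : {within `[x, y], continuous f}.
    apply: derivable_within_continuous => z; rewrite in_itv/= => /andP[z1 z2].
    by have dz := d z; apply: ex_derive; apply: dz; rewrite (le_trans ax)//= (le_trans z2).
  have dd z : z \in `]x, y[ -> is_derive z 1 f (df z).
    rewrite in_itv/= => /andP[/ltW z1 /ltW z2]; apply: d.
    by rewrite (le_trans ax)//= (le_trans z2).
  have [c] := MVT_segment xy dd cf.
  rewrite in_itv/= => /andP[z1 z2] ->; rewrite normrM ler_wpM2r// dM//.
  by rewrite (le_trans ax)//= (le_trans z2).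
move=> x y /andP[x1 x2] /andP[y1 y2].
by have [xy|/ltW xy] := leP x y; [rewrite distrC (distrC x)|]; exact: H.
Qed.

Lemma invsq_le (k : nat) : (k.+2%:R : R) ^- 2 <= k.+1%:R^-1 - k.+2%:R^-1.
Proof.
have a : (k.+2%:R : R) = k.+1%:R + 1 by rewrite -natr1.
have p : (0 : R) < k.+1%:R by [].
rewrite a; set t := (k.+1%:R : R) in p *.
rewrite -subr_ge0.
have -> : t^-1 - (t + 1)^-1 - (t + 1) ^- 2 = (t * (t + 1) ^+ 2)^-1.
  by field; rewrite !gt_eqF// addr_gt0.
by rewrite invr_ge0 mulr_ge0 ?ltW// exprn_gt0// addr_gt0.
Qed.

Lemma sum_invsq_tail (K K' : nat) : (K <= K')%N ->
  \sum_(K <= k < K') (k.+2%:R : R) ^- 2 <= K.+1%:R^-1 - K'.+1%:R^-1.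
Proof.
move=> KK; rewrite -(subnKC KK); elim: (K' - K)%N => [|m IH].
  by rewrite addn0 big_geq// subrr.
rewrite addnS big_nat_recr ?leq_addr//=.
apply: (le_trans (lerD IH (invsq_le _))).
by rewrite addrA subrK.
Qed.

Lemma sum_invsq_le2 (K : nat) : \sum_(k < K) (k.+1%:R : R) ^- 2 <= 2.
Proof.
case: K => [|K]; first by rewrite big_ord0.
rewrite big_ord_recl /= expr1n invr1 -[2]natr1 addrC lerD2r.
under eq_bigr do rewrite /bump /= add1n.
rewrite -(big_mkord xpredT (fun k => (k.+2%:R : R) ^- 2)).
apply: le_trans (sum_invsq_tail (leq0n K)) _.
by rewrite invr1 gerBl.
Qed.

Definition cosq (K : nat) z : R := \sum_(k < K) cos (k.+1%:R * z) / k.+1%:R ^+ 2.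
(* [parab z] is the sum of the series [cosq] on [0, 2 pi] up to the constant
   [pi ^+ 2 / 6]; only differences are compared, so this constant is never needed. *)
Definition parab z : R := z * z / 4 - pi * z / 2.
(** The remainder of the Fourier series of the sawtooth [(pi - z) / 2], which is also the derivative
    of [cosq K - parab]. *)
Definition saw (K : nat) z : R := \sum_(k < K) - sin (k.+1%:R * z) / k.+1%:R - z / 2 + pi / 2.

Lemma is_derive_cosq K z : is_derive z 1 (fun y => cosq K y - parab y) (saw K z).
Proof.
apply: (is_derive_eq (dv_sub
  (dv_sum (fun k : 'I_K => dv_divr (k.+1%:R ^+ 2)
     (dv_comp (dv_scale k.+1%:R (dv_id z)) (is_derive_cos (k.+1%:R * z)))))
  (dv_sub (dv_divr 4 (dv_mul (dv_id z) (dv_id z)))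
    (dv_divr 2 (dv_scale pi (dv_id z)))))).
rewrite /saw /= -addrA; congr (_ + _).
  apply: eq_bigr => k _; have : k.+1%:R != 0 :> R by rewrite pnatr_eq0.
  move: (k.+1%:R : R) => t t0; field; exact: t0.
by field.
Qed.

(** Half the Dirichlet kernel: multiplied by [2 sin (z / 2)], the sum telescopes into sines of
    half-integer multiples of [z]. *)
Lemma sum_cos_sin K z :
  (\sum_(k < K) cos (k.+1%:R * z) + 2^-1) * (2 * sin (z / 2)) = sin ((K%:R + 2^-1) * z).
Proof.
elim: K => [|K IH].
  by rewrite big_ord0 add0r mulrA mulVf ?pnatr_eq0// mul1r; congr sin; exact: mulrC.
rewrite big_ord_recr /= addrAC mulrDl IH.
have -> : (K%:R + 2^-1) * z = K.+1%:R * z - z / 2 by rewrite -natr1; field.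
have -> : (K.+1%:R + 2^-1) * z = K.+1%:R * z + z / 2 by field.
by rewrite sinB sinD; ring.
Qed.

Lemma is_derive_saw K z : is_derive z 1 (saw K) (- (\sum_(k < K) cos (k.+1%:R * z) + 2^-1)).
Proof.
apply: (is_derive_eq (dv_add (dv_sub
  (dv_sum (fun k : 'I_K => dv_divr k.+1%:R (dv_opp
     (dv_comp (dv_scale k.+1%:R (dv_id z)) (is_derive_sin (k.+1%:R * z))))))
  (dv_divr 2 (dv_id z))) (dv_cst (pi / 2) z))).
rewrite addr0 mul1r opprD; congr (_ - _).
rewrite -sumrN; apply: eq_bigr => k _; have : k.+1%:R != 0 :> R by rewrite pnatr_eq0.
  move: (k.+1%:R : R) => t t0; field; exact: t0.
Qed.

Lemma sinkpi (k : nat) : sin (k%:R * pi) = 0 :> R.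
Proof.
elim: k => [|k IH]; first by rewrite mul0r sin0.
by rewrite -natr1 mulrDl mul1r sinD IH sinpi mul0r mulr0 addr0.
Qed.

Lemma saw_pi K : saw K pi = 0.
Proof.
rewrite /saw big1 => [|k _]; first by rewrite add0r addNr.
by rewrite sinkpi oppr0 mul0r.
Qed.

(** Integration by parts without an integral. The derivative of [saw K] is
    [- sin (N z) / (2 sin (z / 2))]; removing [cos (N z) / (2 N sin (z / 2))] leaves a function [U]
    with derivative of size [1 / N]. As [N] is a half-integer, [U] vanishes at [pi], and the mean
    value bound from [pi] concludes. The interval keeps [sin (z / 2)] away from 0. *)
Lemma saw_bound (d : R) : 0 < d -> d < pi -> exists B, forall K z, d <= z <= pi *+ 2 - d ->
  `|saw K z| <= B / (K%:R + 2^-1).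
Proof.
move=> d0 dpi.
have d2 : d <= pi *+ 2 - d by rewrite mulr2n; lra.
have csin : {within `[d, pi *+ 2 - d], continuous (fun z : R => sin (z / 2))}.
  apply: continuous_subspaceT.
  apply: (is_derive_continuous (df := fun z => cos (z / 2) * (1 / 2))) => z.
  exact: dv_comp (dv_divr 2 (dv_id z)) (is_derive_sin (z / 2)).
have [c] := EVT_min d2 csin; rewrite in_itv/= => /andP[c1 c2] cmin.
set s := sin (c / 2) in cmin.
have s0 : 0 < s.
  by apply: sin_gt0_pi; move: c1 c2; rewrite mulr2n => c1 c2; apply/andP; split; lra.
have smin z : d <= z <= pi *+ 2 - d -> s <= sin (z / 2) by move=> zd; apply: cmin; rewrite in_itv.
(* The Lipschitz bound for [U] costs [pi / (4 s^2)] and the removed term [1 / (2 s)], both divided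
   by [N]; [B] leaves some room. *)
pose B := pi / (2 * s ^+ 2) + 2^-1 / s + 2^-1.
exists B => K z zd.
set N := K%:R + 2^-1.
have N0 : 0 < N by rewrite ltr_wpDl.
pose U y := saw K y - cos (N * y) / (2 * N) * (sin (y / 2))^-1.
have dU y : d <= y <= pi *+ 2 - d ->
    is_derive y 1 U (cos (N * y) * cos (y / 2) / (4 * N * sin (y / 2) ^+ 2)).
  move=> yd; have s1 : sin (y / 2) != 0 by rewrite gt_eqF// (lt_le_trans s0)// smin.
  apply: (is_derive_eq (dv_sub (is_derive_saw K y) (dv_mul
    (dv_divr (2 * N) (dv_comp (dv_scale N (dv_id y)) (is_derive_cos (N * y))))
    (dv_inv (f := fun y => sin (y / 2)) s1
      (dv_comp (dv_divr 2 (dv_id y)) (is_derive_sin (y / 2))))))).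
  have -> : \sum_(k < K) cos (k.+1%:R * y) + 2^-1 = sin (N * y) / (2 * sin (y / 2)).
    by rewrite /N -sum_cos_sin mulfK// mulf_neq0.
  by field; rewrite s1 gt_eqF.
have bU y : d <= y <= pi *+ 2 - d ->
    `|cos (N * y) * cos (y / 2) / (4 * N * sin (y / 2) ^+ 2)| <= (4 * N * s ^+ 2)^-1.
  move=> yd; have sy := smin y yd.
  have sy2 : s ^+ 2 <= sin (y / 2) ^+ 2 by rewrite !expr2 ler_pM ?(ltW s0).
  rewrite normrM -[leRHS]mul1r ler_pM//.
    by rewrite normrM -[leRHS]mulr1 ler_pM// cos_max.
  have q0 : 0 < sin (y / 2) ^+ 2 by apply: lt_le_trans sy2; rewrite exprn_gt0.
  rewrite ger0_norm; last by rewrite invr_ge0 mulr_ge0 ?(ltW q0)// mulr_ge0 ?ltW.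
  have N4 : 0 < 4 * N by rewrite mulr_gt0.
  have s2 : 0 < s ^+ 2 by rewrite exprn_gt0.
  by rewrite lef_pV2 ?posrE ?(mulr_gt0 N4)// ler_pM2l.
have pid : d <= pi <= pi *+ 2 - d by rewrite mulr2n; apply/andP; split; lra.
have L := is_derive_lip dU bU zd pid.
have cNpi : cos (N * pi) = 0.
  by rewrite /N mulrDl cosD sinkpi mul0r subr0 mulrC -[2^-1 * pi]mulrC cos_pihalf mul0r.
have Upi : U pi = 0 by rewrite /U saw_pi cNpi !mul0r subr0.
rewrite Upi subr0 in L.
have zpi : `|z - pi| <= pi.
  by move/andP: zd; rewrite mulr2n => -[z1 z2]; rewrite ler_norml; apply/andP; split; lra.
have -> : saw K z = U z + cos (N * z) / (2 * N) * (sin (z / 2))^-1 by rewrite /U subrK.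
apply: le_trans (ler_normD _ _) _.
have L2 : `|cos (N * z) / (2 * N) * (sin (z / 2))^-1| <= (2 * N)^-1 / s.
  rewrite normrM ler_pM//.
    rewrite normrM -[leRHS]mul1r ler_pM// ?cos_max// ger0_norm// invr_ge0 mulr_ge0// ltW//.
  by rewrite ger0_norm ?invr_ge0 ?lef_pV2 ?posrE ?smin// ?(le_trans (ltW s0))//
    ?(lt_le_trans s0)// smin.
have L3 : (4 * N * s ^+ 2)^-1 * `|z - pi| <= (4 * N * s ^+ 2)^-1 * pi.
  by rewrite ler_wpM2l// invr_ge0 mulr_ge0 ?mulr_ge0 ?exprn_ge0// ltW.
apply: (@le_trans _ _ ((4 * N * s ^+ 2)^-1 * pi + (2 * N)^-1 / s)).
  by apply: lerD => //; exact: le_trans L L3.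
rewrite -subr_ge0.
have -> : B / N - ((4 * N * s ^+ 2)^-1 * pi + (2 * N)^-1 / s) = (pi / (4 * s ^+ 2) + 2^-1) / N.
  by rewrite /B; field; rewrite !gt_eqF.
by rewrite divr_ge0 ?(ltW N0)// addr_ge0// divr_ge0 ?pi_ge0// mulr_ge0// exprn_ge0// ltW.
Qed.

Lemma cos_lip x y : `|cos x - cos y| <= `|x - y|.
Proof.
rewrite -[leRHS]mul1r.
apply: (is_derive_lip (a := Num.min x y) (b := Num.max x y) (fun z _ => is_derive_cos z)).
- by move=> z _; rewrite normrN sin_max.
- by rewrite ge_min lexx le_max lexx.
- by rewrite ge_min lexx le_max lexx !orbT.
Qed.

(* Bounds the first terms by the Lipschitz property of [cos], the others by the
   telescoping majorant of [1 / k^2]. *)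
Lemma cosq_equicont (K0 K : nat) z z' :
  `|cosq K z - cosq K z'| <= K0.+1%:R * `|z - z'| + 2 / K0.+1%:R.
Proof.
pose F (k : nat) := if (k <= K0)%N then `|z - z'| else 2 / k.+1%:R ^+ 2.
have FB (k : nat) : `|cos (k.+1%:R * z) / k.+1%:R ^+ 2 - cos (k.+1%:R * z') / k.+1%:R ^+ 2| <= F k.
  have k0 : (0 : R) < k.+1%:R by [].
  have k2 : (0 : R) < k.+1%:R ^+ 2 by rewrite exprn_gt0.
  rewrite -mulrBl normrM [X in _ * X]ger0_norm ?invr_ge0 ?(ltW k2)//.
  rewrite ler_pdivrMr // /F; case: ifP => _.
    apply: le_trans (cos_lip _ _) _; rewrite -mulrBr normrM [leRHS]mulrC gtr0_norm// ler_wpM2r//.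
    by rewrite expr2 ler_peMr ?ler1n// (ltW k0).
  rewrite divfK ?gt_eqF//; apply: le_trans (ler_normB _ _) _.
  by rewrite -[2]/(1 + 1) lerD// cos_max.
rewrite /cosq -sumrB; apply: le_trans (ler_norm_sum _ _ _) _.
apply: (@le_trans _ _ (\sum_(k < K) F k)); first by apply: ler_sum => k _; exact: FB.
rewrite -(big_mkord xpredT F).
have S1 m : (m <= K0.+1)%N -> \sum_(0 <= k < m) F k <= K0.+1%:R * `|z - z'|.
  move=> mK; rewrite big_mkord (eq_bigr (fun=> `|z - z'|)); last first.
    by move=> k _; rewrite /F -ltnS (leq_trans (ltn_ord k)).
  by rewrite sumr_const card_ord -[leLHS]mulr_natl ler_wpM2r// ler_nat.
have [KK|KK] := leqP K K0.+1.
  by apply: le_trans (S1 _ KK) _; rewrite lerDl.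
rewrite (@big_cat_nat _ _ _ K0.+1)//=; last exact: ltnW.
apply: lerD; first exact: S1.
case: K KK => // K KK.
rewrite big_add1 /=.
have -> : \sum_(K0 <= i < K) F i.+1 = \sum_(K0 <= i < K) 2 * i.+2%:R ^- 2.
  by rewrite !big_nat; apply: eq_bigr => i /andP[Ki _]; rewrite /F leqNgt ltnS Ki.
rewrite -mulr_sumr ler_wpM2l//.
apply: le_trans (sum_invsq_tail _) _; first by rewrite -ltnS ltnW.
by rewrite gerBl.
Qed.

Lemma parab_lip z z' : 0 <= z <= pi *+ 2 -> 0 <= z' <= pi *+ 2 ->
  `|parab z - parab z'| <= pi * `|z - z'|.
Proof.
rewrite mulr2n => /andP[z1 z2] /andP[y1 y2].
have -> : parab z - parab z' = ((z + z') / 4 - pi / 2) * (z - z') by rewrite /parab; field.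
rewrite normrM ler_wpM2r// ler_norml; have := pi_gt0 R.
by move=> p0; apply/andP; split; lra.
Qed.

(** Away from 0 and [2 pi] the derivative [saw K] tends to 0 uniformly. Near these endpoints, where
    this fails, the equicontinuity of [cosq K], uniform in [K], carries the estimate over from a
    point at distance at most [d]. *)
Lemma cosq_parab_pi (eps : R) : 0 < eps -> exists N : nat, forall K, (N <= K)%N ->
  forall z, 0 <= z <= pi *+ 2 ->
  `|(cosq K z - parab z) - (cosq K pi - parab pi)| <= eps.
Proof.
move=> e0.
have p0 := pi_gt0 R.
have e4 : 0 < eps / 4 by rewrite divr_gt0.
(* [K0] makes the tail [2 / K0.+1] in [cosq_equicont] at most [eps / 4]; then [d] makes the
   Lipschitz parts of [cosq] and [parab] together at most [eps / 4]. *)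
pose K0 := Num.truncn (2 / (eps / 4)).
have K0P : 2 / K0.+1%:R <= eps / 4.
  rewrite ler_pdivrMr// mulrC -ler_pdivrMr//; apply: ltW.
  exact: truncnS_gt.
have Kp : 0 < K0.+1%:R + pi :> R by apply: addr_gt0.
pose d := Num.min (pi / 2) (eps / 4 / (K0.+1%:R + pi)).
have d0 : 0 < d by rewrite lt_min !divr_gt0.
have dpi : d < pi by rewrite gt_min; apply/orP; left; lra.
have dE : (K0.+1%:R + pi) * d <= eps / 4.
  by rewrite mulrC -ler_pdivlMr// /d ge_min lexx orbT.
have [B HB] := saw_bound d0 dpi.
exists (Num.truncn (pi * `|B| / (eps / 2))).+1 => K NK z zI.
have KN : pi * `|B| / (K%:R + 2^-1) <= eps / 2.
  rewrite ler_pdivrMr ?ltr_wpDl// [leRHS]mulrC -ler_pdivrMr ?divr_gt0//; apply: ltW.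
  apply: lt_le_trans (truncnS_gt _) _.
  apply: (@le_trans _ _ K%:R); first by rewrite ler_nat.
  by rewrite lerDl invr_ge0.
(* The projection of [z] onto the interval where [saw_bound] applies. *)
pose z1 := Num.max d (Num.min z (pi *+ 2 - d)).
have dd : d <= pi *+ 2 - d by rewrite mulr2n; lra.
have z1I : d <= z1 <= pi *+ 2 - d.
  apply/andP; split; first by rewrite /z1 le_max lexx.
  by rewrite /z1 ge_max dd ge_min lexx orbT.
have zz1 : `|z - z1| <= d.
  move: zI => /andP[za zb]; rewrite /z1 mulr2n in zb *.
  clear -za zb d0 dpi; move: (pi : R) zb dpi => p zb dpi.
  by case: (leP z (p + p - d)) => h1; case: (leP d _) => h2; rewrite ler_norml; apply/andP;
    split; lra.
have z10 : 0 <= z1 <= pi *+ 2 by move/andP: z1I => [a b]; apply/andP; split; lra.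
have piI : d <= pi <= pi *+ 2 - d by rewrite mulr2n; apply/andP; split; lra.
have B1 : `|(cosq K z1 - parab z1) - (cosq K pi - parab pi)| <= eps / 2.
  have := is_derive_lip (fun y _ => is_derive_cosq K y) (HB K) z1I piI.
  move/le_trans; apply.
  apply: (@le_trans _ _ (`|B| / (K%:R + 2^-1) * pi)); last by apply: le_trans KN;
    rewrite mulrC mulrA.
  have N0 : 0 < K%:R + 2^-1 :> R by rewrite ltr_wpDl.
  apply: (@le_trans _ _ (`|B| / (K%:R + 2^-1) * `|z1 - pi|)).
    by rewrite ler_wpM2r// ler_wpM2r ?ler_norm// invr_ge0 ltW.
  rewrite ler_wpM2l ?divr_ge0 ?(ltW N0)// ler_norml.
  by move/andP: z10; rewrite mulr2n => -[a b]; apply/andP; split; lra.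
have B2 := cosq_equicont K0 K z z1.
have B3 := parab_lip zI z10.
have -> : cosq K z - parab z - (cosq K pi - parab pi) =
  (cosq K z - cosq K z1) - (parab z - parab z1)
    + ((cosq K z1 - parab z1) - (cosq K pi - parab pi)) by ring.
apply: le_trans (ler_normD _ _) _.
have -> : eps = eps / 2 + eps / 2 by field.
apply: lerD => //.
apply: le_trans (ler_normB _ _) _.
apply: (le_trans (lerD B2 B3)).
have -> : eps / 2 = eps / 4 + eps / 4 by field.
rewrite addrAC -mulrDl; apply: lerD => //.
by apply: le_trans dE; rewrite ler_wpM2l// ltW.
Qed.

Lemma cosq_parab (eps : R) : 0 < eps -> exists N : nat, forall K, (N <= K)%N ->
  forall z z', 0 <= z <= pi *+ 2 -> 0 <= z' <= pi *+ 2 ->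
  `|(cosq K z - cosq K z') - (parab z - parab z')| <= eps.
Proof.
move=> e0; have e2 : 0 < eps / 2 by rewrite divr_gt0.
have [N HN] := cosq_parab_pi e2; exists N => K NK z z' zI zI'.
have := lerD (HN K NK z zI) (HN K NK z' zI').
have -> : eps / 2 + eps / 2 = eps by field.
move/(le_trans _); apply.
have -> : cosq K z - cosq K z' - (parab z - parab z') =
 (cosq K z - parab z - (cosq K pi - parab pi)) - (cosq K z' - parab z' - (cosq K pi - parab pi))
   by ring.
exact: ler_normB.
Qed.

Section Green.
Context (L : R) (L0 : 0 < L).
(** The shift in the index excludes the frequency zero, so every frequency is at least [pi / L]; the
    lower bound on [Re rho] rests on this. *)
Definition freq (k : nat) : R := k.+1%:R * (pi / L).

(* Partial sums of the eigenfunction expansion of the kernel [min x y - x y / L]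
   inverting [- d^2/dx^2] with Dirichlet conditions on [0, L]. *)
Definition green (K : nat) x y : R :=
  2 / L * \sum_(k < K) sin (freq k * x) * sin (freq k * y) / freq k ^+ 2.

Lemma freq_gt0 k : 0 < freq k.
Proof. by rewrite mulr_gt0// divr_gt0 ?pi_gt0. Qed.

(** The product-to-sum formula. Since cosine is even, [|x - y|] may replace [x - y], which brings
    both arguments into [[0, 2 pi]], where [parab] describes the limit. *)
Lemma greenE K x y :
  green K x y = L / pi ^+ 2 * (cosq K (`|x - y| * (pi / L)) - cosq K ((x + y) * (pi / L))).
Proof.
rewrite /green /cosq -sumrB !mulr_sumr; apply: eq_bigr => k _.
have -> : cos (k.+1%:R * (`|x - y| * (pi / L))) = cos (freq k * x - freq k * y).
  rewrite /freq; have [h|h] := leP 0 (x - y).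
    by rewrite ger0_norm//; congr cos; ring.
  by rewrite ltr0_norm// -[RHS]cosN; congr cos; ring.
have -> : cos (k.+1%:R * ((x + y) * (pi / L))) = cos (freq k * x + freq k * y).
  by congr cos; rewrite /freq; ring.
rewrite cosB cosD /freq.
have k0 : k.+1%:R != 0 :> R by rewrite pnatr_eq0.
have pn : pi != 0 :> R by rewrite gt_eqF// pi_gt0.
have Ln : L != 0 by rewrite gt_eqF.
move: (k.+1%:R : R) k0 (cos _) (cos _) (sin _) (sin _) => t t0 a b c d.
by move: (pi : R) pn => p pn; field; rewrite t0 pn Ln.
Qed.

(** The two values of [parab] differ exactly by a multiple of the kernel, the absolute value in
    [|x - y|] producing the minimum; uniformity in [x] and [y] is inherited from [cosq_parab]. *)
Lemma green_lim (eps : R) : 0 < eps -> exists N : nat, forall K, (N <= K)%N ->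
  forall x y, 0 <= x <= L -> 0 <= y <= L ->
  `|green K x y - (Num.min x y - x * y / L)| <= eps.
Proof.
move=> e0.
have p0 := pi_gt0 R.
have c0 : 0 < L / pi ^+ 2 by rewrite divr_gt0// exprn_gt0.
have [N HN] := cosq_parab (divr_gt0 e0 c0); exists N => K NK x y /andP[x1 x2] /andP[y1 y2].
have pL : 0 < pi / L by rewrite divr_gt0.
have LE : pi *+ 2 = (L + L) * (pi / L) by rewrite mulrDl -mulr2n mulrC divfK// gt_eqF.
have xy : `|x - y| <= L by rewrite ler_norml; apply/andP; split; lra.
have a1 : 0 <= `|x - y| * (pi / L) <= pi *+ 2.
  rewrite LE mulr_ge0 ?(ltW pL)//= ler_wpM2r ?(ltW pL)//.
  by apply: le_trans xy _; lra.
have a2 : 0 <= (x + y) * (pi / L) <= pi *+ 2.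
  rewrite LE mulr_ge0 ?(ltW pL) ?addr_ge0//= ler_wpM2r ?(ltW pL)//.
  exact: lerD.
have := HN K NK _ _ a1 a2; rewrite ler_pdivlMr// => H.
rewrite greenE.
have -> : Num.min x y - x * y / L =
   L / pi ^+ 2 * (parab (`|x - y| * (pi / L)) - parab ((x + y) * (pi / L))).
  rewrite /parab.
  have pn : pi != 0 :> R by rewrite gt_eqF.
  have Ln : L != 0 by rewrite gt_eqF.
  have [h|h] := leP x y.
    have -> : `|x - y| = y - x by rewrite distrC ger0_norm// subr_ge0.
    by move: (pi : R) pn => p pn; field; rewrite pn Ln.
  have -> : `|x - y| = x - y by rewrite gtr0_norm// subr_gt0.
  by move: (pi : R) pn => p pn; field; rewrite pn Ln.
by rewrite -mulrBr normrM gtr0_norm// mulrC.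
Qed.

End Green.
End OneVar.

(** * Integrals as increments of primitives *)

Section Primitive.
Context {R : realType}.
Implicit Types (f g F : R -> R) (a b M : R).
Local Notation mu := (@lebesgue_measure R).

(* The half-line leaves room on the left of 0 for two-sided derivatives; integrals are
   only taken over subintervals of [0, +oo[. *)
Definition primitive f F := forall x : R, -1 < x -> is_derive x 1 F (f x).

Lemma primitive_ex f : continuous f -> exists F, primitive f F.
Proof.
move=> cf; exists (fun x => \int[mu]_(t in `[-1, x]) f t)%R => x x1.
have xx : x < x + 1 by rewrite ltrDl.
have [|d1 d2] := continuous_FTC1_closed (f := f) xx _ x1 (cf x).
  apply: continuous_compact_integrable; first exact: segment_compact.
  exact: continuous_subspaceT.
by split; [exact: d1|rewrite -derive1E; exact: d2].
Qed.

(** An arbitrary primitive is chosen, so that rules for integrals follow from rules for derivatives;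
    the value is 0 when there is no primitive. *)
Definition integ f a b := let F := xget (fun=> 0) [set F | primitive f F] in F b - F a.

Lemma integE f F a b : primitive f F -> 0 <= a -> 0 <= b -> integ f a b = F b - F a.
Proof.
move=> pF a0 b0; rewrite /integ; set G := xget _ _.
have pG : primitive f G by apply: (@xgetPex _ _ [set F | primitive f F]); exists F.
pose m := Num.max a b.
have dd x : 0 <= x <= m -> is_derive x 1 (fun x => G x - F x) (f x - f x).
  by move=> /andP[x0 _]; refine (dv_sub (pG x _) (pF x _)); apply: lt_le_trans x0.
have dM x : 0 <= x <= m -> `|f x - f x| <= 0 by rewrite subrr normr0.
have bm : 0 <= b <= m by rewrite b0 le_max lexx orbT.
have am : 0 <= a <= m by rewrite a0 le_max lexx.
have H := is_derive_lip dd dM bm am.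
move: H; rewrite mul0r normr_le0 subr_eq0 => /eqP /= H.
by apply/eqP; rewrite -subr_eq0; apply/eqP; rewrite -[G b](subrK (F b)) H; ring.
Qed.

Lemma integ_bound f M a b : continuous f -> 0 <= a -> a <= b ->
  (forall x, a <= x <= b -> `|f x| <= M) -> `|integ f a b| <= M * (b - a).
Proof.
move=> cf a0 ab fM; have [F pF] := primitive_ex cf.
rewrite (integE pF)// ?(le_trans a0)//.
have dd x : a <= x <= b -> is_derive x 1 F (f x).
  by move=> /andP[ax _]; refine (pF x _); apply: lt_le_trans (le_trans a0 ax).
have bb : a <= b <= b by rewrite ab lexx.
have aa : a <= a <= b by rewrite ab lexx.
have := is_derive_lip dd fM bb aa.
by rewrite (ger0_norm (_ : 0 <= b - a)) ?subr_ge0.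
Qed.

Lemma integD f g a b : continuous f -> continuous g -> 0 <= a -> 0 <= b ->
  integ (fun x => f x + g x) a b = integ f a b + integ g a b.
Proof.
move=> cf cg a0 b0; have [F pF] := primitive_ex cf; have [G pG] := primitive_ex cg.
rewrite (integE pF)// (integE pG)// (@integE _ (fun x => F x + G x))//; first by ring.
by move=> x x1; exact: dv_add (pF x x1) (pG x x1).
Qed.

Lemma integZ f k a b : continuous f -> 0 <= a -> 0 <= b ->
  integ (fun x => k * f x) a b = k * integ f a b.
Proof.
move=> cf a0 b0; have [F pF] := primitive_ex cf.
rewrite (integE pF)// (@integE _ (fun x => k * F x))//; first by rewrite mulrBr.
by move=> x x1; exact: dv_scale (pF x x1).
Qed.

Lemma integ_cat f a b c : continuous f -> 0 <= a -> 0 <= b -> 0 <= c ->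
  integ f a c = integ f a b + integ f b c.
Proof.
move=> cf a0 b0 c0; have [F pF] := primitive_ex cf.
by rewrite !(integE pF)//; ring.
Qed.

Lemma eq_integ f g a b : continuous f -> continuous g -> 0 <= a -> a <= b ->
  (forall x, a <= x <= b -> f x = g x) -> integ f a b = integ g a b.
Proof.
move=> cf cg a0 ab fg; have b0 := le_trans a0 ab.
have cNg : continuous (fun x => -1 * g x).
  by move=> x; apply: cvgM; [exact: cvg_cst|exact: cg].
have cd : continuous (fun x => f x + -1 * g x).
  by move=> x; apply: cvgD; [exact: cf|exact: cNg].
have /(_ 0) := integ_bound cd a0 ab.
rewrite integD// integZ// mulN1r mul0r normr_le0 subr_eq0 => H; apply/eqP; apply: H.
by move=> x xab; rewrite fg// mulN1r subrr normr0.
Qed.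

Lemma integ0 a b : 0 <= a -> 0 <= b -> integ (fun=> 0) a b = 0.
Proof.
move=> a0 b0; rewrite (@integE _ (fun=> 0)) ?subrr//.
by move=> x _; exact: dv_cst.
Qed.

Lemma integ_sum (n : nat) (f : nat -> R -> R) a b : (forall k, continuous (f k)) ->
  0 <= a -> 0 <= b ->
  integ (fun x => \sum_(k < n) f k x) a b = \sum_(k < n) integ (f k) a b.
Proof.
move=> cf a0 b0; elim: n => [|n IH].
  rewrite big_ord0 -[RHS](integ0 a0 b0); congr integ; apply/funext => x.
  by rewrite big_ord0.
rewrite big_ord_recr /= -IH -integD//.
  by congr integ; apply/funext => x; rewrite big_ord_recr.
elim: n {IH} => [|n IH] x.
  under eq_fun do rewrite big_ord0; exact: cvg_cst.
under eq_fun do rewrite big_ord_recr /=.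
by apply: cvgD; [exact: IH|exact: cf].
Qed.

(** On [[0, x]] and on [[x, L]] the kernel is affine in [y], and two integrations by parts give the
    explicit primitive in [P]. The terms in [h1] cancel at [x] because the kernel is continuous
    there, and the jump of its slope produces [- h x]. *)
Lemma green_inverse (L x : R) (h h1 h2 : R -> R) : 0 < L -> 0 <= x <= L ->
  (forall y : R, is_derive y 1 h (h1 y)) -> (forall y : R, is_derive y 1 h1 (h2 y)) ->
  continuous h2 -> h 0 = 0 -> h L = 0 ->
  integ (fun y => h2 y * (Num.min x y - x * y / L)) 0 L = - h x.
Proof.
move=> L0 /andP[x0 xL] dh dh1 ch2 h00 hL0.
have cid : continuous (fun y : R => y) by move=> y; exact: cvg_id.
have caff c d : continuous (fun y : R => h2 y * (c + d * y)).
  move=> y; apply: cvgM; first exact: ch2.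
  apply: cvgD; first exact: cvg_cst.
  by apply: cvgM; [exact: cvg_cst|exact: cid].
have cG : continuous (fun y : R => h2 y * (Num.min x y - x * y / L)).
  move=> y; apply: cvgM; first exact: ch2.
  apply: cvgB.
    by apply: continuous_min; [exact: cvg_cst|exact: cid].
  by apply: cvgM; [apply: cvgM; [exact: cvg_cst|exact: cid]|exact: cvg_cst].
have Ln : L != 0 by rewrite gt_eqF.
rewrite (@integ_cat _ _ x)// ?(ltW L0)//.
have -> : integ (fun y => h2 y * (Num.min x y - x * y / L)) 0 x =
   integ (fun y => h2 y * (0 + (1 - x / L) * y)) 0 x.
  apply: eq_integ => // y /andP[y0 yx]; rewrite min_r//; congr (_ * _); field; exact: Ln.
have -> : integ (fun y => h2 y * (Num.min x y - x * y / L)) x L =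
   integ (fun y => h2 y * (x + (- x / L) * y)) x L.
  apply: eq_integ => // y /andP[y0 yx]; rewrite min_l//; congr (_ * _); field; exact: Ln.
have P c d : primitive (fun y => h2 y * (c + d * y)) (fun y => h1 y * (c + d * y) - d * h y).
  move=> y _.
  apply: (is_derive_eq (dv_sub (dv_mul (dh1 y) (dv_add (dv_cst c y) (dv_scale d (dv_id y))))
    (dv_scale d (dh y)))).
  by ring.
rewrite !(integE (P _ _))// ?(ltW L0)// h00 hL0; field; exact: Ln.
Qed.

End Primitive.

(** * Coordinates in R^n *)

Section Coord.
Context {R : realType} {n : nat}.
Implicit Types (x y : 'rV[R]_n) (i j : 'I_n) (s t : R).

Lemma norm_coord_le x i : `|x ord0 i| <= `|x|.
Proof.
rewrite -[leRHS]/(mx_norm x) mx_normrE.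
exact: (@le_bigmax _ _ _ 0 (fun p : 'I_1 * 'I_n => `|x p.1 p.2|) (ord0, i)).
Qed.

Lemma norm_rV_le x (c : R) : 0 <= c -> (forall i, `|x ord0 i| <= c) -> `|x| <= c.
Proof.
by move=> c0 H; rewrite -[leLHS]/(mx_norm x) mx_normrE; apply: bigmax_le => //= -[a i] _;
  rewrite ord1.
Qed.

Lemma space_dirE i j : @space_dir R n i ord0 j = (j == i)%:R.
Proof. by rewrite /space_dir mxE eqxx. Qed.

Lemma norm_space_dir i : `|@space_dir R n i| <= 1.
Proof.
by apply: norm_rV_le => // j; rewrite space_dirE; case: eqP; rewrite ?normr1 ?normr0.
Qed.

Lemma rV_eq x y : (forall j, x ord0 j = y ord0 j) -> x = y.
Proof. by move=> H; apply/rowP => j; exact: H. Qed.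

Lemma rVD x y j : (x + y) ord0 j = x ord0 j + y ord0 j.
Proof. by rewrite mxE. Qed.

Lemma rVB x y j : (x - y) ord0 j = x ord0 j - y ord0 j.
Proof. by rewrite !mxE. Qed.

Lemma rVZ s x j : (s *: x) ord0 j = s * x ord0 j.
Proof. by rewrite mxE. Qed.

(** Overwriting a coordinate is written as a displacement along the basis vector, so that [s] runs
    along a line and directional derivatives apply. *)
Definition upd i s x := x + (s - x ord0 i) *: space_dir i.

Lemma updE i s x j : upd i s x ord0 j = if j == i then s else x ord0 j.
Proof.
rewrite /upd rVD rVZ space_dirE; case: eqP => [->|_]; rewrite ?mulr1 ?mulr0 ?addr0//.
by rewrite addrC subrK.
Qed.

Lemma upd_id i x : upd i (x ord0 i) x = x.
Proof. by rewrite /upd subrr scale0r addr0. Qed.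

Lemma updD i s t x : upd i (s + t) x = t *: space_dir i + upd i s x.
Proof.
apply: rV_eq => j; rewrite updE rVD rVZ updE space_dirE.
by case: eqP => _; rewrite ?mulr1 ?mulr0 ?add0r// addrC.
Qed.

Lemma upd_dir i j s t x : i != j -> upd i s (t *: space_dir j + x) = t *: space_dir j + upd i s x.
Proof.
move=> ij; apply: rV_eq => k; rewrite updE [RHS]rVD updE !rVD !rVZ !space_dirE.
by case: (eqVneq k i) => [->|//]; rewrite (negbTE ij) mulr0 add0r.
Qed.

Lemma norm_updB i s x y : `|upd i s x - upd i s y| <= `|x - y|.
Proof.
apply: norm_rV_le => // j; rewrite rVB !updE; case: eqP => _.
  by rewrite subrr normr0.
by have := norm_coord_le (x - y) j; rewrite !mxE.
Qed.

Lemma norm_upd_lineB i s t x : `|upd i s x - upd i t x| <= `|s - t|.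
Proof.
apply: norm_rV_le => // j; rewrite rVB !updE; case: eqP => // _.
by rewrite subrr normr0.
Qed.

End Coord.

(** * Sums over boxes of multi-indices *)

Section BoxSum.

(** Multi-indices are sequences whose entries run below [K]; peeling off the first entry matches the
    recursion over the variables in [msum] and [mcoef]. *)
Fixpoint boxsum {V : zmodType} (K m : nat) (F : seq nat -> V) : V :=
  if m is m'.+1 then \sum_(k < K) boxsum K m' (fun s => F (nat_of_ord k :: s))
  else F [::].

Lemma eq_boxsum {V : zmodType} K m (F G : seq nat -> V) : (forall s, size s = m -> F s = G s) ->
  boxsum K m F = boxsum K m G.
Proof.
elim: m F G => [|m IH] F G H /=; first exact: H.
by apply: eq_bigr => k _; apply: IH => s ss; apply: H; rewrite /= ss.
Qed.

Lemma boxsumM {V : pzRingType} K m (c : V) (F : seq nat -> V) :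
  c * boxsum K m F = boxsum K m (fun s => c * F s).
Proof.
elim: m F => [|m IH] F //=; rewrite mulr_sumr; apply: eq_bigr => k _; exact: IH.
Qed.

Context {R : realType}.

Lemma boxsum_le (K m : nat) (F : seq nat -> R) (b : nat -> R) (c : R) : 0 <= c ->
  (forall k, 0 <= b k) ->
  (forall s, size s = m -> `|F s| <= c * \prod_(k <- s) b k) ->
  `|boxsum K m F| <= c * (\sum_(k < K) b k) ^+ m.
Proof.
move=> c0 b0; elim: m F c c0 => [|m IH] F c c0 H /=.
  by rewrite expr0; have := H [::] erefl; rewrite big_nil.
apply: le_trans (ler_norm_sum _ _ _) _.
rewrite exprS mulrCA mulr_suml; apply: ler_sum => k _.
have bc : 0 <= c * b k by rewrite mulr_ge0.
rewrite mulrCA mulrA; apply: (IH (fun s => F (nat_of_ord k :: s)) _ bc) => s ss.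
by have := H (nat_of_ord k :: s); rewrite /= ss big_cons mulrA; apply.
Qed.

(** The terms of the larger box outside the smaller one are dominated by the same terms of the
    expanded power of the sum of [b], so the Cauchy property is inherited from the majorant. *)
Lemma boxsum_dist (K K' m : nat) (F : seq nat -> R) (b : nat -> R) (c : R) :
  (K <= K')%N -> 0 <= c ->
  (forall k, 0 <= b k) ->
  (forall s, size s = m -> `|F s| <= c * \prod_(k <- s) b k) ->
  `|boxsum K' m F - boxsum K m F| <= c * ((\sum_(k < K') b k) ^+ m - (\sum_(k < K) b k) ^+ m).
Proof.
move=> KK c0 b0; elim: m F c c0 => [|m IH] F c c0 H /=.
  by rewrite !expr0 !subrr mulr0 normr0.
have Hk (k : nat) s : size s = m -> `|F (k :: s)| <= (c * b k) * \prod_(j <- s) b j.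
  by move=> ss; have := H (k :: s); rewrite /= ss big_cons mulrA; apply.
rewrite -(big_mkord xpredT (fun k => boxsum K' m (fun s => F (k :: s)))).
rewrite -(big_mkord xpredT (fun k => boxsum K m (fun s => F (k :: s)))).
set B' := \sum_(k < K') b k; set B := \sum_(k < K) b k.
have EB' : B' = \sum_(0 <= k < K) b k + \sum_(K <= k < K') b k.
  by rewrite -(@big_cat_nat _ _ _ K)// /B' -(big_mkord xpredT b).
have EB : B = \sum_(0 <= k < K) b k by rewrite /B -(big_mkord xpredT b).
rewrite (@big_cat_nat _ _ _ K)//= addrAC -sumrB.
apply: le_trans (ler_normD _ _) _.
have -> : c * (B' ^+ m.+1 - B ^+ m.+1) =
   \sum_(0 <= k < K) c * b k * (B' ^+ m - B ^+ m) + \sum_(K <= k < K') c * b k * B' ^+ m.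
  by rewrite -!mulr_suml -!mulr_sumr -EB !exprS {1}EB' -EB; ring.
apply: lerD; apply: le_trans (ler_norm_sum _ _ _) _; apply: ler_sum => k _.
  by apply: IH; [rewrite mulr_ge0|exact: Hk].
by apply: boxsum_le => //; [rewrite mulr_ge0|exact: Hk].
Qed.

End BoxSum.

(** * Multiple sine series *)

Section SineCoef.
Context {R : realType} {n : nat} (L : R) (L0 : 0 < L).
Implicit Types (x y : 'rV[R]_n) (i j : 'I_n) (h g : 'rV[R]_n -> R) (ls : seq 'I_n) (ks : seq nat).

(* Bounded Lipschitz functions: a regularity inherited by sine coefficients in some of
   the variables. *)
Definition blip h := exists C : R, (forall x, `|h x| <= C) /\
  (forall x y, `|h x - h y| <= C * `|x - y|).

Lemma lip_continuous (f : R -> R) (C : R) : (forall s t, `|f s - f t| <= C * `|s - t|) ->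
  continuous f.
Proof.
move=> H s; apply/cvgrPdist_le => e e0.
have C1 : 0 < `|C| + 1 by rewrite ltr_wpDl.
near=> t.
apply: le_trans (H s t) _; apply: (@le_trans _ _ ((`|C| + 1) * `|s - t|)).
  by rewrite ler_wpM2r// (le_trans (ler_norm C))// lerDl.
rewrite mulrC -ler_pdivlMr//; near: t; apply: cvgr_dist_le; last exact: divr_gt0.
exact: cvg_id.
Unshelve. all: by end_near. Qed.

Lemma blip_line h i x : blip h -> continuous (fun s => h (upd i s x)).
Proof.
move=> [C [hC hL]]; have C0 : 0 <= C by apply: le_trans (hC 0).
apply: (@lip_continuous _ C) => s t; apply: le_trans (hL _ _) _.
by rewrite ler_wpM2l// norm_upd_lineB.
Qed.

Lemma blipD h g : blip h -> blip g -> blip (fun x => h x + g x).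
Proof.
move=> [C [hC hL]] [D [gC gL]]; exists (C + D); split=> [x|x y].
  by apply: le_trans (ler_normD _ _) _; exact: lerD.
have -> : h x + g x - (h y + g y) = (h x - h y) + (g x - g y) by ring.
by apply: le_trans (ler_normD _ _) _; rewrite mulrDl lerD.
Qed.

Lemma blipZ (c : R) h : blip h -> blip (fun x => c * h x).
Proof.
move=> [C [hC hL]]; exists (`|c| * C); split=> [x|x y].
  by rewrite normrM ler_wpM2l.
by rewrite -mulrBr normrM -mulrA ler_wpM2l.
Qed.

Lemma blipM h g : blip h -> blip g -> blip (fun x => h x * g x).
Proof.
move=> [C [hC hL]] [D [gC gL]]; have C0 : 0 <= C by apply: le_trans (hC 0).
have D0 : 0 <= D by apply: le_trans (gC 0).
exists (C * D *+ 2); split=> [x|x y].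
  by rewrite normrM (@le_trans _ _ (C * D)) ?ler_pM// mulr2n lerDl mulr_ge0.
have -> : h x * g x - h y * g y = h x * (g x - g y) + (h x - h y) * g y by ring.
apply: le_trans (ler_normD _ _) _; rewrite !normrM mulr2n mulrDl; apply: lerD.
  by rewrite -mulrA ler_pM.
by rewrite mulrAC ler_pM.
Qed.

Lemma blip0 : blip (fun=> 0).
Proof. by exists 0; split=> [x|x y]; rewrite ?subrr normr0// mul0r. Qed.

Lemma blip_sum K (F : nat -> 'rV[R]_n -> R) : (forall k, blip (F k)) ->
  blip (fun x => \sum_(k < K) F k x).
Proof.
move=> FB; elim: K => [|K IH].
  by under eq_fun do rewrite big_ord0; exact: blip0.
by under eq_fun do rewrite big_ord_recr /=; exact: blipD.
Qed.

Lemma blip_boxsum K m (F : seq nat -> 'rV[R]_n -> R) : (forall s, blip (F s)) ->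
  blip (fun x => boxsum K m (F^~ x)).
Proof.
elim: m F => [|m IH] F FB /=; first exact: FB.
by apply: (@blip_sum K (fun k x => boxsum K m (fun s => F (k :: s) x))) => k; apply: IH.
Qed.

Lemma sin_lip (s t : R) : `|sin s - sin t| <= `|s - t|.
Proof. by rewrite -2!cosBpihalf; apply: le_trans (cos_lip _ _) _; rewrite opprB addrA subrK. Qed.

Lemma blip_sin (c : R) i : blip (fun x => sin (c * x ord0 i)).
Proof.
exists (`|c| + 1); split=> [x|x y].
  by apply: le_trans (sin_max _) _; rewrite lerDr.
apply: le_trans (sin_lip _ _) _; rewrite -mulrBr normrM ler_pM// ?lerDl//.
by have := norm_coord_le (x - y) i; rewrite rVB.
Qed.

(** The sine coefficient in one variable is kept as a function on the whole space, constant in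
    [x_i]; coefficients in several variables arise by iteration. *)
Definition scoef i k h x := 2 / L * integ (fun s => h (upd i s x) * sin (freq L k * s)) 0 L.

Let cid : continuous (fun s : R => s). Proof. by move=> s; exact: cvg_id. Qed.

Lemma sin_freq_continuous k : continuous (fun s => sin (freq L k * s)).
Proof.
apply: (is_derive_continuous (df := fun s => cos (freq L k * s) * (freq L k * 1))) => s;
  exact: is_derive1_comp.
Qed.

Lemma scoef_cont i k h x : blip h -> continuous (fun s => h (upd i s x) * sin (freq L k * s)).
Proof. by move=> hB s; apply: cvgM; [exact: blip_line|exact: sin_freq_continuous]. Qed.

Lemma scoef_bound i k h x M : blip h -> (forall s, 0 <= s <= L -> `|h (upd i s x)| <= M) ->
  `|scoef i k h x| <= 2 * M.
Proof.
move=> hB hM; rewrite /scoef normrM.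
have -> : 2 * M = 2 / L * (M * (L - 0)) by rewrite subr0; field; rewrite gt_eqF.
rewrite ger0_norm ?divr_ge0 ?(ltW L0)// ler_wpM2l ?divr_ge0 ?(ltW L0)//.
apply: integ_bound; [exact: scoef_cont|by []|exact: ltW|] => s sL.
by rewrite normrM -[M]mulr1 ler_pM// ?hM// sin_max.
Qed.

Lemma scoefD i k h g x : blip h -> blip g ->
  scoef i k (fun x => h x + g x) x = scoef i k h x + scoef i k g x.
Proof.
move=> hB gB; rewrite /scoef -mulrDr -integD ?(ltW L0)//; [|exact: scoef_cont..].
by under eq_fun do rewrite mulrDl.
Qed.

Lemma scoefZ i k (c : R) h x : blip h -> scoef i k (fun x => c * h x) x = c * scoef i k h x.
Proof.
move=> hB; rewrite /scoef [RHS]mulrCA; congr (_ * _).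
rewrite -integZ ?(ltW L0)//; last exact: scoef_cont.
by under eq_fun do rewrite -mulrA.
Qed.

Lemma scoefB i k h g x : blip h -> blip g ->
  scoef i k (fun x => h x - g x) x = scoef i k h x - scoef i k g x.
Proof.
move=> hB gB; rewrite -mulN1r -scoefZ// -scoefD//; last exact: blipZ.
by congr scoef; apply/funext => y; rewrite mulN1r.
Qed.

Lemma scoef_sum i k K (F : nat -> 'rV[R]_n -> R) x : (forall k', blip (F k')) ->
  scoef i k (fun x => \sum_(k' < K) F k' x) x = \sum_(k' < K) scoef i k (F k') x.
Proof.
move=> FB; elim: K => [|K IH].
  rewrite big_ord0 /scoef; under eq_fun do rewrite big_ord0 mul0r.
  by rewrite integ0 ?mulr0// ltW.
rewrite big_ord_recr /= -IH -scoefD//; last exact: blip_sum.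
by congr scoef; apply/funext => y; rewrite big_ord_recr.
Qed.

Lemma scoef_boxsum i k K m (F : seq nat -> 'rV[R]_n -> R) x : (forall s, blip (F s)) ->
  scoef i k (fun x => boxsum K m (F^~ x)) x = boxsum K m (fun s => scoef i k (F s) x).
Proof.
elim: m F => [|m IH] F FB //=.
rewrite (@scoef_sum _ _ K (fun k x => boxsum K m (fun s => F (k :: s) x))).
  by apply: eq_bigr => k' _; rewrite (IH (fun s => F (nat_of_ord k' :: s))).
by move=> k'; apply: (@blip_boxsum K m (fun s => F (k' :: s))).
Qed.

Lemma blip_scoef i k h : blip h -> blip (scoef i k h).
Proof.
move=> hB; have [C [hC hL]] := hB.
have C0 : 0 <= C by apply: le_trans (hC 0).
exists (2 * C); split=> [x|x y]; first exact: scoef_bound.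
rewrite /scoef -mulrBr normrM ger0_norm ?divr_ge0 ?(ltW L0)//.
have E : integ (fun s => h (upd i s x) * sin (freq L k * s)) 0 L
  - integ (fun s => h (upd i s y) * sin (freq L k * s)) 0 L
  = integ (fun s => h (upd i s x) * sin (freq L k * s)
    + -1 * (h (upd i s y) * sin (freq L k * s))) 0 L.
  have cx := @scoef_cont i k h x hB; have cy := @scoef_cont i k h y hB.
  have cNy : continuous (fun s => -1 * (h (upd i s y) * sin (freq L k * s))).
    by move=> s; apply: cvgM; [exact: cvg_cst|exact: cy].
  by rewrite (integD cx cNy (lexx 0) (ltW L0)) (integZ (-1) cy (lexx 0) (ltW L0)) mulN1r.
rewrite E.
have -> : 2 * C * `|x - y| = 2 / L * (C * `|x - y| * (L - 0)) by rewrite subr0; field;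
  rewrite gt_eqF.
rewrite ler_wpM2l ?divr_ge0 ?(ltW L0)//.
apply: integ_bound; [|by []|exact: ltW|] => [s|s sL].
  apply: cvgD; first exact: scoef_cont.
  by apply: cvgM; [exact: cvg_cst|exact: scoef_cont].
rewrite mulN1r -mulrBl normrM -[leRHS]mulr1 ler_pM ?sin_max//.
by apply: le_trans (hL _ _) _; rewrite ler_wpM2l// norm_updB.
Qed.

(* A second-order Taylor bound, uniform in [x], so that it survives integration in the
   other variables; [h'] is the partial derivative of [h]. *)
Definition brel j h h' := [/\ blip h, blip h' & exists C : R, forall x (t : R),
  `|h (t *: space_dir j + x) - h x - t * h' x| <= C * t ^+ 2].

Lemma brel_line i h h' x (t : R) : brel i h h' ->
  is_derive t 1 (fun s : R => h (upd i s x)) (h' (upd i t x)).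
Proof.
move=> [_ _ [C HC]].
apply: is_derive_le => eps e0.
exists (eps / (`|C| + 1)); first by rewrite divr_gt0// ltr_wpDl.
move=> s s0; rewrite ltr_pdivlMr ?ltr_wpDl// => sC.
have H := HC (upd i t x) s; rewrite -updD (addrC t s) in H.
rewrite [s *: 1]mulr1 /GRing.scale /=.
have -> : s^-1 * (h (upd i (s + t) x) - h (upd i t x)) - h' (upd i t x) =
  s^-1 * (h (upd i (s + t) x) - h (upd i t x) - s * h' (upd i t x)).
  by rewrite [in RHS]mulrBr mulKf.
rewrite normrM normfV ler_pdivrMl ?normr_gt0//.
apply: le_trans H _; apply: le_trans (ler_norm _) _; rewrite normrM normrX expr2.
have -> : `|C| * (`|s| * `|s|) = `|s| * (`|s| * `|C|) by ring.
rewrite ler_wpM2l//; apply: ltW; apply: le_lt_trans sC.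
by rewrite ler_wpM2l// lerDl.
Qed.

(** Differentiation under the integral sign: the Taylor remainder of the coefficient is the
    coefficient of the Taylor remainder [u], which is bounded uniformly by [C t^2]. Moving along
    [e_j] commutes with overwriting [x_i] because [i != j]. *)
Lemma brel_scoef i j k h h' : i != j -> brel j h h' -> brel j (scoef i k h) (scoef i k h').
Proof.
move=> ij [hB hB' [C HC]]; split; [exact: blip_scoef..|].
exists (2 * C) => x t.
pose u s := h (t *: space_dir j + s) + (-1 * h s + (- t) * h' s).
have shB : blip (fun s => h (t *: space_dir j + s)).
  have [D [hC hL]] := hB; exists D; split=> // y z.
  by apply: le_trans (hL _ _) _; rewrite opprD addrACA subrr add0r.
have uB : blip u by apply: blipD => //; apply: blipD; exact: blipZ.
have -> : scoef i k h (t *: space_dir j + x) - scoef i k h x - t * scoef i k h' x = scoef i k u x.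
  rewrite /u scoefD ?scoefD ?scoefZ//; try exact: blipZ; last by apply: blipD; exact: blipZ.
  have -> : scoef i k h (t *: space_dir j + x) = scoef i k (fun s => h (t *: space_dir j + s)) x.
    by rewrite /scoef; congr (_ * integ _ _ _); apply/funext => s; rewrite upd_dir.
  ring.
rewrite -mulrA; apply: scoef_bound => // s _.
by rewrite /u mulN1r mulNr addrA; exact: HC.
Qed.

End SineCoef.

(** * Smooth functions with support in a box *)

Section Support.
Context {R : realType} {n : nat}.
Implicit Types (Z : set 'rV[R]_n) (f h : 'rV[R]_n -> R).
Local Notation e := (@space_dir R n).

Definition csupp Z h := forall x, ~ Z x -> h x = 0.

Lemma csupp_D Z h i : closed Z -> csupp Z h -> csupp Z ('D_(e i) (h : _ -> R^o)).
Proof.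
move=> cZ hZ x nZx.
have : nbhs x (~` Z) by apply: open_nbhs_nbhs; split => //; exact: closed_openC.
move=> /nbhs_ballP[r /= r0 Hr].
suff [] : is_derive x (e i) (h : _ -> R^o) 0 by [].
apply: is_derive_le => eps e0; exists r => // t t0 tr.
rewrite (hZ x)// (hZ (t *: e i + x)) ?subrr ?scaler0 ?subr0 ?normr0 ?(ltW e0)//.
apply: Hr; rewrite -ball_normE /= opprD addrCA subrr addr0 normrN normrZ.
apply: le_lt_trans tr; rewrite -[leRHS]mulr1 ler_wpM2l//; exact: norm_space_dir.
Qed.

Lemma csupp_bounded Z f (a b : R) : (forall x, Z x -> forall i, a <= x ord0 i <= b) ->
  csupp Z f -> continuous (f : _ -> R^o) -> exists C, forall x, `|f x| <= C.
Proof.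
move=> Zab fZ cf.
pose A : set 'rV[R]_n := [set x | forall i, `[a, b]%classic (x ord0 i)].
have cA : compact A by apply: (@rV_compact _ _ (fun=> `[a, b]%classic)) => i;
  exact: segment_compact.
have [[x0 Ax0]|A0] := pselect (A !=set0); last first.
  exists 0 => x; rewrite fZ ?normr0// => Zx; apply: A0; exists x => i.
  by rewrite /= in_itv /= Zab.
have cnf : {within A, continuous (fun x => `|f x|)}.
  apply: continuous_subspaceT => x; apply: continuous_comp; [exact: cf|exact: norm_continuous].
have [|c _ Hc] := EVT_max_rV _ cA cnf; first by exists x0.
exists `|f c| => x; have [Zx|nZx] := pselect (Z x); last by rewrite fZ// normr0.
by apply: Hc; rewrite inE => i; rewrite /= in_itv /= Zab.
Qed.

(** The path from [y] to [x] changes one coordinate at a time; each move costs at most [M |x - y|]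
    by the mean value theorem, whence the factor [n]. *)
Lemma lip_partials f (M : R) : (forall x i, derivable (f : _ -> R^o) x (e i)) ->
  (forall x i, `|'D_(e i) (f : _ -> R^o) x| <= M) ->
  forall x y, `|f x - f y| <= n%:R * M * `|x - y|.
Proof.
move=> df fM x y.
have H (s : seq 'I_n) z : `|f (\sum_(i <- s) (x - y) ord0 i *: e i + z) - f z| <=
  (size s)%:R * (M * `|x - y|).
  elim: s => [|i s IH]; first by rewrite big_nil add0r subrr normr0 mul0r.
  rewrite big_cons /= -addrA.
  set z' := \sum_(i <- s) _ + z in IH *.
  have [c _ E] := MVT_dir z' ((x - y) ord0 i) (fun u => df u i).
  have -> : f ((x - y) ord0 i *: e i + z') - f z = (f ((x - y) ord0 i *: e i + z') - f z')
    + (f z' - f z) by ring.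
  apply: le_trans (ler_normD _ _) _; rewrite E -natr1 mulrDl mul1r addrC.
  apply: lerD => //; rewrite normrM mulrC; apply: ler_pM => //; exact: norm_coord_le.
have := H (enum 'I_n) y.
rewrite size_enum_ord -mulrA big_enum /=.
suff -> : \sum_(i in 'I_n) (x - y) ord0 i *: e i = x - y by rewrite subrK.
rewrite [RHS]row_sum_delta; apply: eq_bigr => i _.
by congr (_ *: _); apply/rowP => j; rewrite !mxE.
Qed.

Lemma smooth_blip Z h (a b : R) : closed Z -> (forall x, Z x -> forall i, a <= x ord0 i <= b) ->
  csupp Z h -> smooth e (h : _ -> R^o) -> blip h.
Proof.
move=> cZ Zab hZ sh.
have [C HC] := csupp_bounded Zab hZ (smooth_continuous sh).
have C0 : 0 <= C by apply: le_trans (HC 0).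
have HD i : exists D, forall x, `|'D_(e i) (h : _ -> R^o) x| <= D.
  exact: csupp_bounded Zab (csupp_D i cZ hZ) (smooth_continuous (smooth_D i sh)).
have [D HD'] := choice HD.
pose M := \sum_(i < n) `|D i|.
exists (C + n%:R * M); split=> [x|x y].
  by apply: le_trans (HC x) _; rewrite lerDl mulr_ge0// sumr_ge0.
apply: le_trans (lip_partials (M := M) _ _ x y) _.
- by move=> z i; exact: smooth_derivable.
- move=> z i; apply: le_trans (HD' i z) _; apply: le_trans (ler_norm _) _.
  by rewrite /M (bigD1 i)//= lerDl sumr_ge0.
- by rewrite ler_wpM2r// lerDr.
Qed.

Lemma smooth_brel Z h (a b : R) i : closed Z -> (forall x, Z x -> forall i, a <= x ord0 i <= b) ->
  csupp Z h -> smooth e (h : _ -> R^o) -> brel i h ('D_(e i) (h : _ -> R^o)).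
Proof.
move=> cZ Zab hZ sh; have B1 := smooth_blip cZ Zab hZ sh.
have B2 := smooth_blip cZ Zab (csupp_D i cZ hZ) (smooth_D i sh).
split => //; have [C [DC DL]] := B2; have C0 : 0 <= C by apply: le_trans (DC 0).
exists C => x t.
have [c ct ->] := MVT_dir x t (fun u => @smooth_derivable _ _ _ _ e _ i u sh).
rewrite -mulrBr normrM; apply: le_trans (ler_wpM2l (normr_ge0 t) (DL _ _)) _.
have -> : t ^+ 2 = `|t| * `|t| by rewrite -normrM -expr2 ger0_norm ?sqr_ge0.
rewrite addrK normrZ [leRHS]mulrCA ler_wpM2l// ler_wpM2l//.
by apply: le_trans ct; rewrite -[leRHS]mulr1 ler_wpM2l//; exact: norm_space_dir.
Qed.

End Support.

(** * Uniform sine expansion in several variables *)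

Section Expansion.
Context {R : realType} {n : nat} (L : R) (L0 : 0 < L).
Implicit Types (x y : 'rV[R]_n) (i j l : 'I_n) (h g : 'rV[R]_n -> R) (ls : seq 'I_n) (ks : seq nat).
Local Notation e := (@space_dir R n).

Definition inbox x := forall i, 0 <= x ord0 i <= L.

Fixpoint mcoef ls ks h :=
  if ls is l :: ls' then if ks is k :: ks' then scoef L l k (mcoef ls' ks' h) else h else h.

Fixpoint msin ls ks x :=
  if ls is l :: ls' then if ks is k :: ks' then sin (freq L k * x ord0 l)
    * msin ls' ks' x else 1 else 1.

(** The multiplier that turns sine coefficients of [D2 ls h] into those of [h]: each factor inverts
    one second derivative. *)
Definition wt ks : R := \prod_(k <- ks) - (freq L k) ^- 2.

(** For [g] the second derivative in [x_l] of a function [h] vanishing on the two faces, this is the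
    partial sine series of [h], written with the coefficients of [g]. *)
Definition ssum K l g x := \sum_(k < K) - (freq L k) ^- 2 * sin (freq L k * x ord0 l)
  * scoef L l k g x.

Definition msum K ls g := foldr (ssum K) g ls.

Definition D2 ls h := foldl (fun g l => 'D_(e l) ('D_(e l) (g : _ -> R^o))) h ls.

Lemma ssum_green K l g x : blip g ->
  ssum K l g x = - integ (fun s => g (upd l s x) * green L K (x ord0 l) s) 0 L.
Proof.
move=> gB; rewrite /ssum.
have -> : (fun s => g (upd l s x) * green L K (x ord0 l) s) =
   (fun s => \sum_(k < K) (2 / L * sin (freq L k * x ord0 l) / freq L k ^+ 2)
     * (g (upd l s x) * sin (freq L k * s))).
  by apply/funext => s; rewrite /green mulrA mulr_sumr; apply: eq_bigr => k _; ring.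
rewrite (@integ_sum _ _ (fun k s => (2 / L * sin (freq L k * x ord0 l) / freq L k ^+ 2)
  * (g (upd l s x) * sin (freq L k * s)))) ?(ltW L0)//; last first.
  by move=> k s; apply: cvgM; [exact: cvg_cst|exact: scoef_cont].
rewrite -sumrN; apply: eq_bigr => k _; rewrite integZ ?(ltW L0)//; last exact: scoef_cont.
by rewrite /scoef; ring.
Qed.

(** The partial sum is minus the integral of [h2] against the truncated Green kernel. The full
    kernel would return [h] by [green_inverse], and the two kernels are uniformly close. *)
Lemma ssum_lim l h h1 h2 : brel l h h1 -> brel l h1 h2 ->
  (forall x, h (upd l 0 x) = 0) -> (forall x, h (upd l L x) = 0) ->
  forall eps : R, 0 < eps -> exists N : nat, forall K, (N <= K)%N -> forall x, inbox x ->
    `|ssum K l h2 x - h x| <= eps.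
Proof.
move=> r1 r2 h0 hL eps e0.
have [_ B2 _] := r2; have [C [hC hLip]] := B2; have C0 : 0 <= C by apply: le_trans (hC 0).
have CL : 0 < C * L + 1 by rewrite ltr_wpDl// mulr_ge0// ltW.
have [N HN] := green_lim L0 (divr_gt0 e0 CL); exists N => K NK x xb.
pose G s := Num.min (x ord0 l) s - x ord0 l * s / L.
have cid : continuous (fun s : R => s) by move=> s; exact: cvg_id.
have cG : continuous G.
  move=> s; apply: cvgB; first by apply: continuous_min; [exact: cvg_cst|exact: cid].
  by apply: cvgM; [apply: cvgM; [exact: cvg_cst|exact: cid]|exact: cvg_cst].
have cg : continuous (green L K (x ord0 l)).
  have -> : green L K (x ord0 l) =
    (fun s => \sum_(k < K) (2 / L * sin (freq L k * x ord0 l) / freq L k ^+ 2)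
      * sin (freq L k * s)).
    by apply/funext => s; rewrite /green mulr_sumr; apply: eq_bigr => k _; ring.
  elim: K {NK} => [|K IH] s; first by under eq_fun do rewrite big_ord0; exact: cvg_cst.
  under eq_fun do rewrite big_ord_recr /=.
  by apply: cvgD; [exact: IH|apply: cvgM; [exact: cvg_cst|exact: sin_freq_continuous]].
have ch2 := @blip_line _ _ _ l x B2.
have GI := @green_inverse R L (x ord0 l) (fun s => h (upd l s x)) (fun s => h1 (upd l s x))
  (fun s => h2 (upd l s x)) L0 (xb l) (fun s => brel_line x s r1) (fun s => brel_line x s r2) ch2
    (h0 x) (hL x).
rewrite upd_id in GI.
rewrite ssum_green// -[h x]opprK -GI -opprB normrN opprK addrC.
have -> : integ (fun s => h2 (upd l s x) * green L K (x ord0 l) s) 0 L -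
    integ (fun s => h2 (upd l s x) * (Num.min (x ord0 l) s - x ord0 l * s / L)) 0 L =
  integ (fun s => h2 (upd l s x) * green L K (x ord0 l) s + -1 * (h2 (upd l s x) * G s)) 0 L.
  rewrite integD ?integZ ?mulN1r ?(ltW L0)//.
  - by move=> s; apply: cvgM; [exact: ch2|exact: cG].
  - by move=> s; apply: cvgM; [exact: ch2|exact: cg].
  - by move=> s; apply: cvgM; [exact: cvg_cst|apply: cvgM; [exact: ch2|exact: cG]].
apply: le_trans (integ_bound (M := C * (eps / (C * L + 1))) _ _ _ _) _ => //; last 2 first.
- move=> s sL; rewrite mulN1r -mulrBr normrM ler_pM//.
  exact: HN.
- rewrite subr0 mulrAC mulrA ler_pdivrMr// mulrC ler_wpM2l ?(ltW e0)//.
  by rewrite lerDl.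
- move=> s; apply: cvgD; first by apply: cvgM; [exact: ch2|exact: cg].
  by apply: cvgM; [exact: cvg_cst|apply: cvgM; [exact: ch2|exact: cG]].
- exact: ltW.
Qed.

(** The bound is uniform in [K] because the inverse squares of the frequencies are summable. This
    stability allows the one-variable approximations to be composed. *)
Lemma ssum_bound K l g x M : blip g -> (forall s, 0 <= s <= L -> `|g (upd l s x)| <= M) ->
  `|ssum K l g x| <= 4 * (L / pi) ^+ 2 * M.
Proof.
move=> gB gM; apply: le_trans (ler_norm_sum _ _ _) _.
have M0 : 0 <= M by apply: le_trans (gM 0 _); rewrite // lexx ltW.
have -> : 4 * (L / pi) ^+ 2 * M = (L / pi) ^+ 2 * (2 * M) * 2 by ring.
apply: (@le_trans _ _ ((L / pi) ^+ 2 * (2 * M) * \sum_(k < K) (k.+1%:R : R) ^- 2)).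
  rewrite mulr_sumr; apply: ler_sum => k _.
  rewrite normrM [X in X * _]normrM normrN.
  have -> : `|freq L k ^- 2| = (L / pi) ^+ 2 * k.+1%:R ^- 2.
    rewrite ger0_norm ?invr_ge0 ?sqr_ge0// /freq exprMn invfM mulrC; congr (_ * _).
    by rewrite -exprVn invf_div.
  have -> : (L / pi) ^+ 2 * (2 * M) * k.+1%:R ^- 2 = (L / pi) ^+ 2 * k.+1%:R ^- 2 * (1 * (2 * M)).
    by rewrite mul1r mulrAC.
  have q0 : 0 <= (L / pi) ^+ 2 * (k.+1%:R : R) ^- 2 by apply: mulr_ge0;
    [exact: sqr_ge0|rewrite invr_ge0; exact: sqr_ge0].
  rewrite -mulrA; apply: (ler_wpM2l q0); apply: ler_pM => //; first exact: sin_max.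
  exact: scoef_bound.
by rewrite ler_wpM2l ?sum_invsq_le2// mulr_ge0 ?sqr_ge0// mulr_ge0.
Qed.

Lemma ssumB K l g h x : blip g -> blip h ->
  ssum K l (fun x => g x - h x) x = ssum K l g x - ssum K l h x.
Proof.
by move=> gB hB; rewrite /ssum -sumrB; apply: eq_bigr => k _; rewrite scoefB// mulrBr.
Qed.

Lemma blip_ssum K l g : blip g -> blip (ssum K l g).
Proof.
move=> gB.
apply: (@blip_sum R n K (fun k x => - (freq L k) ^- 2 * sin (freq L k * x ord0 l)
  * scoef L l k g x)) => k.
by apply: blipM; [apply: blipZ; exact: blip_sin|exact: blip_scoef].
Qed.

Lemma blip_msum K ls g : blip g -> blip (msum K ls g).
Proof. by move=> gB; elim: ls => //= l ls IH; exact: blip_ssum. Qed.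

Context (Z : set 'rV[R]_n) (cZ : closed Z) (ZL : forall x, Z x -> forall i, 0 < x ord0 i < L).

Let ZL' x : Z x -> forall i, 0 <= x ord0 i <= L.
Proof. by move=> Zx i; have /andP[/ltW-> /ltW->] := ZL Zx i. Qed.

Definition good h := csupp Z h /\ smooth e (h : _ -> R^o).

Lemma goodD h i : good h -> good ('D_(e i) (h : _ -> R^o)).
Proof. by move=> [h1 h2]; split; [exact: csupp_D|exact: smooth_D]. Qed.

Lemma good_blip h : good h -> blip h.
Proof. by move=> [h1 h2]; exact: smooth_blip ZL' _ _. Qed.

Lemma good_brel h i : good h -> brel i h ('D_(e i) (h : _ -> R^o)).
Proof. by move=> [h1 h2]; exact: smooth_brel ZL' _ _. Qed.

Lemma good_D2 ls h : good h -> good (D2 ls h).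
Proof. by elim: ls h => //= l ls IH h gh; apply: IH; do 2!apply: goodD. Qed.

Lemma good_face h l x s : good h -> ~~ (0 < s < L) -> h (upd l s x) = 0.
Proof.
by move=> [hZ _] sL; apply: hZ => /ZL/(_ l); rewrite updE eqxx => H; move: sL; rewrite H.
Qed.

(** By induction on the variables: the inner sum approximates [g], the second derivative of [h] in
    [x_l]; [ssum_bound] carries this error through the outer sum, and [ssum_lim] compares the outer
    sum of [g] with [h]. *)
Lemma msum_lim ls h : good h -> forall eps : R, 0 < eps -> exists N : nat, forall K, (N <= K)%N ->
  forall x, inbox x -> `|msum K ls (D2 ls h) x - h x| <= eps.
Proof.
elim: ls h => [|l ls IH] h gh eps e0 /=.
  by exists 0%N => K _ x _; rewrite subrr normr0 ltW.
pose g := 'D_(e l) ('D_(e l) (h : _ -> R^o)).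
have gg : good g by do 2!apply: goodD.
have e2 : 0 < eps / 2 by rewrite divr_gt0.
have c0 : 0 < 4 * (L / pi) ^+ 2 by rewrite mulr_gt0// exprn_gt0// divr_gt0// pi_gt0.
have [N1 H1] := IH g gg _ (divr_gt0 e2 c0).
have F0 x : h (upd l 0 x) = 0 by apply: good_face => //; rewrite ltxx.
have FL x : h (upd l L x) = 0 by apply: good_face => //; rewrite ltxx andbF.
have [N2 H2] := ssum_lim (good_brel l gh) (good_brel l (goodD l gh)) F0 FL e2.
exists (maxn N1 N2) => K; rewrite geq_max => /andP[K1 K2] x xb.
have gB := good_blip gg.
have mB : blip (msum K ls (D2 ls g)) by apply/blip_msum/good_blip/good_D2.
have -> : ssum K l (msum K ls (D2 ls g)) x - h x =
   ssum K l (fun x => msum K ls (D2 ls g) x - g x) x + (ssum K l g x - h x).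
  by rewrite ssumB//; ring.
apply: le_trans (ler_normD _ _) _.
have -> : eps = eps / 2 + eps / 2 by field.
apply: lerD; last exact: H2.
have -> : eps / 2 = 4 * (L / pi) ^+ 2 * (eps / 2 / (4 * (L / pi) ^+ 2)).
  by rewrite [RHS]mulrC divfK// gt_eqF.
apply: ssum_bound => [|s sL].
  by apply: blipD => //; under eq_fun do rewrite -mulN1r; exact: blipZ.
by apply: H1 => // i; rewrite updE; case: eqP.
Qed.

Lemma blip_mcoef ls ks h : blip h -> blip (mcoef ls ks h).
Proof. by move=> hB; elim: ls ks => [|l ls IH] [|k ks] //=; exact: blip_scoef. Qed.

Lemma blip_msin ls ks : blip (msin ls ks).
Proof.
have b1 : blip (fun _ : 'rV[R]_n => 1 : R).
  by exists 1; split=> [x|x y]; rewrite ?normr1// subrr normr0 mul1r.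
elim: ls ks => [|l ls IH] [|k ks] //=; apply: blipM; [exact: blip_sin|exact: IH].
Qed.

Lemma msin_upd ls ks l s x : l \notin ls -> msin ls ks (upd l s x) = msin ls ks x.
Proof.
elim: ls ks => [|l' ls IH] [|k ks] //=; rewrite inE negb_or => /andP[ll' lls].
by rewrite IH// updE eq_sym (negbTE ll').
Qed.

Lemma scoef_mull l k (c g : 'rV[R]_n -> R) x : blip g -> (forall s, c (upd l s x) = c x) ->
  scoef L l k (fun x => c x * g x) x = c x * scoef L l k g x.
Proof.
move=> gB cl; rewrite -scoefZ//; congr (_ * integ _ _ _); apply/funext => s.
by rewrite cl.
Qed.

Lemma msumE K ls g x : uniq ls -> blip g ->
  msum K ls g x = boxsum K (size ls) (fun ks => wt ks * msin ls ks x * mcoef ls ks g x).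
Proof.
move=> + gB; elim: ls x => [|l ls IH] x /=; first by rewrite /wt big_nil !mul1r.
move=> /andP[lls uls]; apply: eq_bigr => k _.
have B ks : blip (fun y => wt ks * msin ls ks y * mcoef ls ks g y).
  by apply: blipM; [apply: blipZ; exact: blip_msin|exact: blip_mcoef].
have -> : scoef L l k (msum K ls g) x =
  scoef L l k (fun y => boxsum K (size ls) ((fun ks y => wt ks * msin ls ks y * mcoef ls ks g y)^~
    y)) x.
  by congr (scoef _ _ _ _ _); apply/funext => y; rewrite IH.
rewrite (scoef_boxsum L0 l k K (size ls) x B) boxsumM.
apply: eq_boxsum => ks _.
(* No variable is repeated, so the inner sines do not depend on [x_l] and leave the coefficient in
   that variable. *)
rewrite (@scoef_mull _ _ (fun y => wt ks * msin ls ks y)); first last.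
- by move=> s; rewrite msin_upd.
- exact: blip_mcoef.
by rewrite /wt big_cons; ring.
Qed.

Lemma mcoef_brel ls ks j h h' : j \notin ls -> brel j h h' ->
  brel j (mcoef ls ks h) (mcoef ls ks h').
Proof.
move=> + r; elim: ls ks => [|l ls IH] [|k ks] //=; rewrite inE negb_or => /andP[jl jls].
by apply: brel_scoef => //; [rewrite eq_sym|exact: IH].
Qed.

Lemma mcoef_face ls ks h l s x : good h -> l \notin ls -> ~~ (0 < s < L) ->
  mcoef ls ks h (upd l s x) = 0.
Proof.
move=> gh + sL; elim: ls ks x => [|l' ls IH] [|k ks] x /=; try by move=> _; exact: good_face.
rewrite inE negb_or => /andP[ll' lls].
rewrite /scoef.
have -> : (fun s0 => mcoef ls ks h (upd l' s0 (upd l s x)) * sin (freq L k * s0)) = fun=> 0.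
  apply/funext => t.
  have -> : upd l' t (upd l s x) = upd l s (upd l' t x).
    apply: rV_eq => j; rewrite !updE; case: (eqVneq j l') => [->|//].
    by rewrite eq_sym (negbTE ll').
  by rewrite IH// mul0r.
by rewrite integ0 ?mulr0// ltW.
Qed.

Lemma sin_freqL k : sin (freq L k * L) = 0.
Proof. by rewrite /freq -mulrA divfK ?gt_eqF// sinkpi. Qed.

(** Two integrations by parts, done through the explicit primitive in [P]. The boundary terms vanish
    because both [h] and the sine are zero at the two ends. *)
Lemma scoef_parts l k h h1 h2 x : brel l h h1 -> brel l h1 h2 ->
  h (upd l 0 x) = 0 -> h (upd l L x) = 0 ->
  - (freq L k) ^- 2 * scoef L l k h2 x = scoef L l k h x.
Proof.
move=> r1 r2 h0 hL; rewrite /scoef.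
have [hB _ _] := r1; have [_ h2B _] := r2.
set t := freq L k; have t0 : t != 0 by rewrite gt_eqF// freq_gt0.
have P : primitive (fun s => h2 (upd l s x) * sin (t * s) + t ^+ 2 * (h (upd l s x) * sin (t * s)))
   (fun s => h1 (upd l s x) * sin (t * s) - t * (h (upd l s x) * cos (t * s))).
  move=> s _.
  have ds := dv_comp (dv_scale t (dv_id s)) (is_derive_sin (t * s)).
  have dc := dv_comp (dv_scale t (dv_id s)) (is_derive_cos (t * s)).
  apply: (is_derive_eq (dv_sub (dv_mul (brel_line x s r2) ds)
    (dv_scale t (dv_mul (brel_line x s r1) dc)))).
  ring.
have := integE P (lexx 0) (ltW L0).
rewrite integD ?(ltW L0)//; [|exact: scoef_cont|]; last first.
  by move=> s; apply: cvgM; [exact: cvg_cst|exact: scoef_cont].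
rewrite integZ ?(ltW L0)//; last exact: scoef_cont.
rewrite h0 hL mulr0 sin0 sin_freqL !mulr0 !mul0r !mulr0 !subr0 => E.
have -> : integ (fun s => h2 (upd l s x) * sin (t * s)) 0 L =
  - (t ^+ 2 * integ (fun s => h (upd l s x) * sin (t * s)) 0 L).
  by apply/eqP; rewrite -addr_eq0 E.
by field; rewrite t0 gt_eqF.
Qed.

Lemma mcoef_parts ls ks h x : uniq ls -> size ks = size ls -> good h ->
  wt ks * mcoef ls ks (D2 ls h) x = mcoef ls ks h x.
Proof.
elim: ls ks h x => [|l ls IH] [|k ks] h x //=; first by rewrite /wt big_nil mul1r.
move=> /andP[lls uls] [sk] gh.
pose g := 'D_(e l) ('D_(e l) (h : _ -> R^o)).
have gg : good g by do 2!apply: goodD.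
rewrite /wt big_cons -mulrA -scoefZ//; last by apply/blip_mcoef/good_blip/good_D2.
have -> : (fun y => (\prod_(j <- ks) - freq L j ^- 2) * mcoef ls ks (D2 ls g) y) = mcoef ls ks g.
  by apply/funext => y; rewrite -[X in X * _]/(wt ks) IH.
apply: (@scoef_parts _ _ _ (mcoef ls ks ('D_(e l) (h : _ -> R^o)))).
- exact/mcoef_brel/good_brel.
- exact/mcoef_brel/good_brel/goodD.
- by apply: mcoef_face => //; rewrite ltxx.
- by apply: mcoef_face => //; rewrite ltxx andbF.
Qed.

(** Each round gains a factor [wt ks]; since [M] is arbitrary, coefficients of smooth functions
    supported inside the box decay rapidly. *)
Lemma mcoef_parts_iter M ls ks h x : uniq ls -> size ks = size ls -> good h ->
  wt ks ^+ M * mcoef ls ks (iter M (D2 ls) h) x = mcoef ls ks h x.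
Proof.
move=> uls sk; elim: M h => [|M IH] h gh; first by rewrite expr0 mul1r.
by rewrite exprSr -mulrA mcoef_parts ?IH//; elim: M {IH} => //= M IHM; exact: good_D2.
Qed.

Lemma mcoef_bound ls ks h M x : blip h -> (forall x, `|h x| <= M) -> size ks = size ls ->
  `|mcoef ls ks h x| <= 2 ^+ size ls * M.
Proof.
move=> hB hM; elim: ls ks x => [|l ls IH] [|k ks] x //=; first by rewrite expr0 mul1r.
move=> [sk]; rewrite exprS -mulrA; apply: scoef_bound => //; first exact: blip_mcoef.
by move=> s _; exact: IH.
Qed.

Lemma mcoef_cst ls ks h x y : size ks = size ls -> (forall i, i \notin ls -> x ord0 i = y ord0 i) ->
  mcoef ls ks h x = mcoef ls ks h y.
Proof.
elim: ls ks x y => [|l ls IH] [|k ks] x y //=.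
  by move=> _ H; congr h; apply: rV_eq => i; exact: H.
move=> [sk] H; congr (_ * integ _ _ _); apply/funext => s; congr (_ * _).
apply: IH => // i ils; rewrite !updE; case: eqP => // il; apply: H.
by rewrite inE negb_or ils andbT; apply/eqP.
Qed.

Lemma sine_expansion h : good h -> forall x, inbox x ->
  boxsum K n (fun ks => mcoef (enum 'I_n) ks h 0 * msin (enum 'I_n) ks x) @[K --> \oo] --> h x.
Proof.
move=> gh x xb; apply/cvgrPdist_le => eps e0.
have [N HN] := msum_lim (enum 'I_n) gh e0.
exists N => // K /= NK; rewrite distrC.
have := HN K NK x xb; rewrite msumE ?enum_uniq ?size_enum_ord//; last first.
  exact/good_blip/good_D2.
congr (`|_ - _| <= _); apply: eq_boxsum => ks sk.
(* The weights are absorbed into the coefficients of [h]. All variables have been integrated, so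
   these coefficients are constant and can be taken at 0. *)
rewrite mulrAC mcoef_parts ?enum_uniq ?size_enum_ord//; congr (_ * _).
by apply: mcoef_cst => [|i]; rewrite ?size_enum_ord ?mem_enum.
Qed.

End Expansion.

(** * Exponential weights in one coordinate *)

Section CoordFun.
Context {R : realType} {n : nat}.
Local Notation e := (@space_dir R n).

Lemma is_derive_coord (i d : 'I_n) (phi : R -> R) (x : 'rV[R]_n) (a : R) :
  is_derive (x ord0 i) 1 phi a ->
  is_derive x (e d) (fun x => phi (x ord0 i) : R^o) (if d == i then a else 0).
Proof.
move=> dphi; apply: is_derive_le => eps e0; case: eqP => [->|/eqP di].
  have [r r0 Hr] := is_derive_ex_le dphi e0; exists r => // h h0 hr.
  by have := Hr h h0 hr; rewrite rVD rVZ space_dirE eqxx [h *: 1]mulr1 mulr1.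
exists 1 => // h _ _; rewrite rVD rVZ space_dirE eq_sym (negbTE di) mulr0 add0r.
by rewrite subrr scaler0 subr0 normr0 ltW.
Qed.

Lemma smooth_coord (i : 'I_n) (phi : nat -> R -> R) :
  (forall (m : nat) (s : R), is_derive s 1 (phi m) (phi m.+1 s)) ->
  smooth e (fun x => phi 0%N (x ord0 i) : R^o).
Proof.
move=> dphi.
pose G (w : seq 'I_n) (x : 'rV[R]_n) : R^o :=
  if all (pred1 i) w then phi (size w) (x ord0 i) else 0.
suff [] : smooth e (G [::]) /\ forall w, Dw e w (G [::]) = G w by [].
have cphi m : continuous (phi m) := is_derive_continuous (dphi m).
apply: smooth_family => [w|w d x].
  rewrite /G; case: (all _ _) => x; last exact: cst_continuous.
  by apply: (@continuous_comp _ _ _ (fun x : 'rV[R]_n => x ord0 i));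
    [exact: coord_continuous|exact: cphi].
rewrite /G all_rcons size_rcons /=; case: (all _ w); rewrite ?andbT ?andbF;
  last exact: is_derive_cst.
exact: is_derive_coord.
Qed.

Lemma smooth_expc (i : 'I_n) (c : R) : smooth e (fun x => expR (c * x ord0 i) : R^o).
Proof.
have := @smooth_coord i (fun m s => c ^+ m * expR (c * s)); under eq_fun do rewrite expr0 mul1r.
apply => m s.
apply: (is_derive_eq (dv_scale (c ^+ m) (dv_comp (dv_scale c (dv_id s)) (is_derive_expR (c * s))))).
by rewrite mulr1 exprSr; ring.
Qed.

Lemma deriveM_expc (i d : 'I_n) (c : R) (p : 'rV[R]_n -> R) : smooth e (p : _ -> R^o) ->
  'D_(e d) ((fun x => p x * expR (c * x ord0 i)) : _ -> R^o) =
  (fun x => ('D_(e d) (p : _ -> R^o) x) * expR (c * x ord0 i) +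
     (if d == i then c else 0) * (p x * expR (c * x ord0 i))).
Proof.
move=> sp; apply/funext => x.
have d1 := @smooth_derivable _ _ _ _ _ _ d x sp.
have d2 := @smooth_derivable _ _ _ _ _ _ d x (smooth_expc i c).
rewrite (@deriveM _ _ (p : _ -> R^o) (fun x => expR (c * x ord0 i) : R^o) x (e d) d1 d2).
have dd : is_derive (x ord0 i) 1 (fun s : R => expR (c * s)) (c * expR (c * x ord0 i)).
  apply: (is_derive_eq (dv_comp (dv_scale c (dv_id (x ord0 i))) (is_derive_expR (c * x ord0 i)))).
  by rewrite mulr1 mulrC.
have := is_derive_coord d dd => /@derive_val ->.
rewrite /GRing.scale /= addrC mulrC; congr (_ + _).
by case: ifP => _; rewrite ?mulr0 ?mul0r// mulrCA.
Qed.

(** A derivative falls either on [p], which keeps its support, or on the weight, which gives a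
    factor of size at most [s]. As [s >= 1], one more power of [s] pays for both; on the support the
    weight is at most [exp (- s a')]. *)
Lemma expc_bound (Z : set 'rV[R]_n) (a b a' : R) (i : 'I_n) (sg : R) : closed Z ->
  (forall x, Z x -> forall i, a <= x ord0 i <= b) ->
  (forall x, Z x -> a' <= sg * x ord0 i) -> `|sg| = 1 ->
  forall (w : seq 'I_n) (p : 'rV[R]_n -> R), csupp Z p -> smooth e (p : _ -> R^o) ->
  exists2 C : R, 0 <= C & forall s : R, 1 <= s -> forall x,
   `|Dw e w ((fun x => p x * expR (- (sg * s) * x ord0 i)) : _ -> R^o) x| <=
     C * s ^+ size w * expR (- s * a').
Proof.
move=> cZ Zab Za sg1; elim=> [|d w IH] p pZ sp.
  have [C HC] := csupp_bounded Zab pZ (smooth_continuous sp).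
  exists C => [|s s1 x]; first exact: le_trans (HC 0).
  rewrite expr0 mulr1 /=; have [Zx|nZx] := pselect (Z x); last first.
    by rewrite pZ// mul0r normr0 mulr_ge0 ?expR_ge0// (le_trans _ (HC 0)).
  rewrite normrM ler_pM// gtr0_norm ?expR_gt0// ler_expR.
  have -> : - (sg * s) * x ord0 i = - (s * (sg * x ord0 i)) by ring.
  by rewrite mulNr lerN2 ler_wpM2l ?Za// (le_trans ler01).
have [C1 C10 H1] := IH _ (csupp_D d cZ pZ) (smooth_D d sp).
have [C2 C20 H2] := IH _ pZ sp.
exists (C1 + C2) => [|s s1 x]; first exact: addr_ge0.
have s0 : 0 <= s by rewrite (le_trans ler01).
rewrite [Dw _ _ _]/= deriveM_expc//.
have S1 := smoothM (smooth_D d sp) (smooth_expc i (- (sg * s))).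
have S2 := smoothM sp (smooth_expc i (- (sg * s))).
have [S3 E3] := smoothZ (if d == i then - (sg * s) else 0) S2.
rewrite (smoothD S1 S3).2 E3.
apply: le_trans (ler_normD _ _) _.
rewrite 2!mulrDl; apply: lerD.
  apply: le_trans (H1 s s1 x) _; rewrite ler_wpM2r ?expR_ge0// ler_wpM2l//= exprS.
  by rewrite ler_peMl// exprn_ge0.
rewrite normrM [size _]/= exprS mulrCA -mulrA ler_pM//.
  by case: ifP => _; rewrite ?normr0// normrN normrM sg1 mul1r ger0_norm.
exact: H2.
Qed.

End CoordFun.

(** * Decay of the coefficients of a weighted piece *)

Section CoefDecay.
Context {R : realType} {n : nat} (L : R) (L0 : 0 < L).
Local Notation e := (@space_dir R n).
Context (Z : set 'rV[R]_n) (cZ : closed Z) (ZL : forall x, Z x -> forall i, 0 < x ord0 i < L).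
Context (i : 'I_n) (sg a : R) (sg1 : `|sg| = 1) (Za : forall x, Z x -> a <= sg * x ord0 i).

(** The word depends only on [ls] and [M], not on the function, so the power of [s] given by
    [expc_bound] is the same for all weights. *)
Lemma D2_word (ls : seq 'I_n) (M : nat) : exists w : seq 'I_n, forall h : 'rV[R]_n -> R,
  iter M (D2 ls) h = Dw e w (h : _ -> R^o).
Proof.
have [w0 H0] : exists w : seq 'I_n, forall h : 'rV[R]_n -> R, D2 ls h = Dw e w (h : _ -> R^o).
  elim: ls => [|l ls [w IH]]; first by exists [::].
  by exists [:: l, l & w] => h /=; rewrite -IH.
elim: M => [|M [w IH]]; first by exists [::].
by exists (w ++ w0) => h; rewrite iterS IH H0 Dw_cat.
Qed.

Lemma wt_normE ks : `|wt L ks| = (L / pi) ^+ (2 * size ks) * \prod_(k <- ks) ((k.+1%:R : R) ^- 2).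
Proof.
rewrite /wt; elim: ks => [|k ks IH].
  by rewrite !big_nil muln0 expr0 mulr1 normr1.
rewrite !big_cons normrM IH normrN.
have -> : `|freq L k ^- 2| = (L / pi) ^+ 2 * k.+1%:R ^- 2.
  rewrite ger0_norm ?invr_ge0 ?sqr_ge0// /freq exprMn invfM mulrC; congr (_ * _).
  by rewrite -exprVn invf_div.
by rewrite /= mulnS exprD; ring.
Qed.

(** Integrating by parts [M] times gives the product over the frequencies, the derivatives cost a
    power of [s], and the weight on the support gives [exp (- s a)]. [C] and [N] precede [s] and
    [ks], which later permits choosing [s] in terms of them. *)
Lemma mcoef_decay (p : 'rV[R]_n -> R) (M : nat) : good Z p ->
  exists2 C : R, 0 <= C & exists N, forall s : R, 1 <= s -> forall ks, size ks = n ->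
   `|mcoef L (enum 'I_n) ks (fun x => p x * expR (- (sg * s) * x ord0 i)) 0| <=
     C * s ^+ N * expR (- s * a) * (\prod_(k <- ks) ((k.+1%:R : R) ^- 2)) ^+ M.
Proof.
move=> [pZ sp].
have ZL' x : Z x -> forall i, 0 <= x ord0 i <= L.
  by move=> Zx j; have /andP[/ltW-> /ltW->] := ZL Zx j.
have [w Hw] := D2_word (enum 'I_n) M.
have [C C0 HC] := expc_bound cZ ZL' Za sg1 w pZ sp.
exists ((L / pi) ^+ (2 * n) ^+ M * (2 ^+ n * C)).
  rewrite mulr_ge0 ?exprn_ge0 ?divr_ge0 ?(ltW L0) ?pi_ge0// mulr_ge0// exprn_ge0//.
exists (size w) => s s1 ks sk.
set h := fun x : 'rV[R]_n => _.
have gh : good Z h.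
  split; first by move=> x nZ; rewrite /h pZ// mul0r.
  exact: (smoothM sp (smooth_expc i (- (sg * s)))).
have gM : good Z (iter M (D2 (enum 'I_n)) h).
  by elim: M {Hw} => //= M IHM; apply: good_D2.
rewrite -(mcoef_parts_iter L0 cZ ZL M)// ?enum_uniq ?size_enum_ord//.
rewrite normrM normrX wt_normE sk exprMn.
have B := mcoef_bound L0 (ks := ks) (ls := enum 'I_n) 0 (good_blip cZ ZL gM) (M :=
  C * s ^+ size w * expR (- s * a)).
rewrite size_enum_ord in B.
have {}B := B _ sk.
have -> : (L / pi) ^+ (2 * n) ^+ M * (2 ^+ n * C) * s ^+ size w * expR (- s * a)
  * (\prod_(k <- ks) k.+1%:R ^- 2) ^+ M =
  (L / pi) ^+ (2 * n) ^+ M * (\prod_(k <- ks) k.+1%:R ^- 2) ^+ M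
    * (2 ^+ n * (C * s ^+ size w * expR (- s * a))) by ring.
rewrite ler_wpM2l//.
  rewrite mulr_ge0 ?exprn_ge0 ?divr_ge0 ?(ltW L0) ?pi_ge0//.
  by apply: prodr_ge0 => k _; rewrite invr_ge0 sqr_ge0.
by apply: B => x; rewrite Hw; exact: HC.
Qed.

End CoefDecay.

(** * Complex plane waves *)

Section CExp.
Context {R : realType}.
Local Notation C := R[i].
Local Notation Re := (@complex.Re R).
Local Notation Im := (@complex.Im R).
Import Normc.
Implicit Types (z w B c : C).

Definition cexp z : C := Complex (expR (Re z) * cos (Im z)) (expR (Re z) * sin (Im z)).

Lemma cReD z w : Re (z + w) = Re z + Re w. Proof. by case: z w => [a b] [c d]. Qed.
Lemma cImD z w : Im (z + w) = Im z + Im w. Proof. by case: z w => [a b] [c d]. Qed.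
Lemma cReN z : Re (- z) = - Re z. Proof. by case: z. Qed.
Lemma cReM z w : Re (z * w) = Re z * Re w - Im z * Im w. Proof. by case: z w => [a b] [c d]. Qed.
Lemma cImM z w : Im (z * w) = Re z * Im w + Im z * Re w. Proof. by case: z w => [a b] [c d]. Qed.
Lemma complex_eq z w : Re z = Re w -> Im z = Im w -> z = w.
Proof. by case: z w => [a b] [c d] /= -> ->. Qed.

Lemma Re_sum (I : Type) (r : seq I) (P : pred I) (F : I -> C) :
  Re (\sum_(i <- r | P i) F i) = \sum_(i <- r | P i) Re (F i).
Proof. by apply: (big_morph (fun z : C => Re z)) => // z w; rewrite cReD. Qed.

Lemma Im_sum (I : Type) (r : seq I) (P : pred I) (F : I -> C) :
  Im (\sum_(i <- r | P i) F i) = \sum_(i <- r | P i) Im (F i).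
Proof. by apply: (big_morph (fun z : C => Im z)) => // z w; rewrite cImD. Qed.

Lemma cexpD z w : cexp (z + w) = cexp z * cexp w.
Proof.
apply: complex_eq; rewrite ?cReM ?cImM /= cReD cImD expRD ?cosD ?sinD; ring.
Qed.

Lemma cexp0 : cexp 0 = 1.
Proof. by apply: complex_eq; rewrite /= expR0 mul1r ?cos0 ?sin0. Qed.

Lemma normc_cexp z : normc (cexp z) = expR (Re z).
Proof.
by rewrite /normc /cexp !exprMn -mulrDr cos2Dsin2 mulr1 sqrtr_sqr gtr0_norm ?expR_gt0.
Qed.

Lemma normcE2 z : normc z = Num.sqrt (Re z ^+ 2 + Im z ^+ 2). Proof. by case: z. Qed.

Lemma normc_ge0 z : 0 <= normc z. Proof. by rewrite normcE2 sqrtr_ge0. Qed.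

Lemma Re_le_normc z : `|Re z| <= normc z.
Proof. by rewrite normcE2 -sqrtr_sqr ler_wsqrtr// lerDl sqr_ge0. Qed.

Lemma Im_le_normc z : `|Im z| <= normc z.
Proof. by rewrite normcE2 -sqrtr_sqr ler_wsqrtr// lerDr sqr_ge0. Qed.

Lemma normc_triangle z w : normc (z + w) <= normc z + normc w.
Proof. exact: le_normcD. Qed.

Lemma normc_real (a : R) : normc (a%:C)%C = `|a|.
Proof. by rewrite normcE2 /= expr0n addr0 sqrtr_sqr. Qed.

Lemma normc_imag (a : R) : normc (Complex 0 a) = `|a|.
Proof. by rewrite normcE2 /= expr0n add0r sqrtr_sqr. Qed.

Lemma normc_sum (I : Type) (r : seq I) (F : I -> C) :
  normc (\sum_(i <- r) F i) <= \sum_(i <- r) normc (F i).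
Proof.
elim: r => [|i r IH]; first by rewrite !big_nil normc0.
rewrite !big_cons; apply: le_trans (normc_triangle _ _) _; exact: lerD.
Qed.

End CExp.

Section PlaneWave.
Context {R : realType} {n : nat}.
Local Notation C := R[i].
Local Notation Re := (@complex.Re R).
Local Notation Im := (@complex.Im R).
Local Notation V := ('rV[R]_n * R)%type.
Local Notation e := (@spacetime_dir R n).
Import Normc.
Implicit Types (p v : V) (B rho : C) (zeta : 'I_n -> C).

Definition phase zeta rho p : C := \sum_l zeta l * (p.1 ord0 l)%:C%C + rho * (p.2)%:C%C.

(** The real part makes the wave real, while the complex amplitude [B] keeps the family stable under
    differentiation: a derivative multiplies [B] by [symb]. *)
Definition pwave B zeta rho p : R := Re (B * cexp (phase zeta rho p)).

Definition symb zeta rho (d : option 'I_n) : C := if d is Some l then zeta l else rho.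

Lemma phase_line zeta rho v p (h : R) :
  phase zeta rho (h *: v + p) = h%:C%C * phase zeta rho v + phase zeta rho p.
Proof.
rewrite /phase /= mulrDr addrACA mulr_sumr -big_split /=; congr (_ + _).
  by apply: eq_bigr => l _; rewrite rVD rVZ rmorphD rmorphM /=; ring.
by rewrite rmorphD rmorphM /=; ring.
Qed.

Lemma phase_dir zeta rho d : phase zeta rho (e d) = symb zeta rho d.
Proof.
case: d => [l|] /=; rewrite /phase /=.
  rewrite rmorph0 mulr0 addr0 (bigD1 l)//= space_dirE eqxx rmorph1 mulr1.
  by rewrite big1 ?addr0// => j jl; rewrite space_dirE (negbTE jl) rmorph0 mulr0.
by rewrite rmorph1 mulr1 big1 ?add0r// => j _; rewrite mxE rmorph0 mulr0.
Qed.

Lemma is_derive_line (W : normedModType R) (f : V -> W) p v (d : W) :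
  is_derive (0 : R) 1 (fun h : R => f (h *: v + p)) d -> is_derive p v f d.
Proof.
move=> H; apply: is_derive_le => eps e0.
have [r r0 Hr] := is_derive_ex_le H e0; exists r => // h h0 hr.
by have := Hr h h0 hr; rewrite [h *: 1]mulr1 addr0 scale0r add0r.
Qed.

Lemma Re_mul_cexp B (z : C) : Re (B * cexp z) =
  expR (Re z) * (Re B * cos (Im z) - Im B * sin (Im z)).
Proof. rewrite cReM /=; ring. Qed.

Lemma is_derive_pwave B zeta rho p d :
  is_derive p (e d) (pwave B zeta rho : V -> R^o) (pwave (B * symb zeta rho d) zeta rho p).
Proof.
apply: is_derive_line; rewrite /pwave.
set z := phase zeta rho p; set c := symb zeta rho d.
have -> : (fun h : R => Re (B * cexp (phase zeta rho (h *: e d + p)))) =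
   fun h => expR (h * Re c + Re z) * (Re B * cos (h * Im c + Im z) - Im B * sin (h * Im c + Im z)).
  apply/funext => h; rewrite phase_line phase_dir Re_mul_cexp.
  by rewrite cReD cImD cReM cImM /= !mul0r subr0 addr0.
have da (a b : R) : is_derive (0 : R) 1 (fun h : R => h * a + b) a.
  by apply: (is_derive_eq (dv_add (dv_mul (dv_id 0) (dv_cst a 0)) (dv_cst b 0))); ring.
apply: (is_derive_eq (dv_mul (dv_comp (da (Re c) (Re z)) (is_derive_expR _))
   (dv_sub (dv_scale (Re B) (dv_comp (da (Im c) (Im z)) (is_derive_cos _)))
           (dv_scale (Im B) (dv_comp (da (Im c) (Im z)) (is_derive_sin _)))))).
rewrite !mul0r !add0r Re_mul_cexp cReM cImM; ring.
Qed.

Lemma continuous_linc (a : 'I_n -> R) (b : R) :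
  continuous (fun p : V => \sum_l a l * p.1 ord0 l + b * p.2 : R).
Proof.
move=> p; apply: cvgD; last by apply: cvgM; [exact: cvg_cst|exact: cvg_snd].
elim: (index_enum _) => [|l s IH].
  by under eq_fun do rewrite big_nil; rewrite big_nil; exact: cvg_cst.
under eq_fun do rewrite big_cons; rewrite big_cons; apply: cvgD; last exact: IH.
apply: cvgM; first exact: cvg_cst.
by apply: (@continuous_comp _ _ _ fst (fun x : 'rV[R]_n => x ord0 l));
  [exact: cvg_fst|exact: coord_continuous].
Qed.

Lemma pwave_continuous B zeta rho : continuous (pwave B zeta rho : V -> R^o).
Proof.
pose re p := \sum_l Re (zeta l) * p.1 ord0 l + Re rho * p.2.
pose im p := \sum_l Im (zeta l) * p.1 ord0 l + Im rho * p.2.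
have cre : continuous re := @continuous_linc (fun l => Re (zeta l)) (Re rho).
have cim : continuous im := @continuous_linc (fun l => Im (zeta l)) (Im rho).
have -> : (pwave B zeta rho : V -> R^o) =
  (fun p => expR (re p) * (Re B * cos (im p) - Im B * sin (im p))).
  apply/funext => p; rewrite /pwave Re_mul_cexp.
  have -> : Re (phase zeta rho p) = re p.
    rewrite /phase cReD Re_sum cReM /= mulr0 subr0; congr (_ + _).
    by apply: eq_bigr => l _; rewrite cReM /= mulr0 subr0.
  have -> : Im (phase zeta rho p) = im p.
    rewrite /phase cImD Im_sum cImM /= mulr0 add0r; congr (_ + _).
    by apply: eq_bigr => l _; rewrite cImM /= mulr0 add0r.
  by [].
move=> p; apply: cvgM.
  by apply: (@continuous_comp _ _ _ re expR); [exact: cre|exact: continuous_expR].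
apply: cvgB; apply: cvgM; try exact: cvg_cst.
  by apply: (@continuous_comp _ _ _ im cos); [exact: cim|exact: continuous_cos].
by apply: (@continuous_comp _ _ _ im sin); [exact: cim|exact: continuous_sin].
Qed.

Lemma smooth_pwave B zeta rho : smooth e (pwave B zeta rho : V -> R^o) /\
  forall w, Dw e w (pwave B zeta rho : V -> R^o) =
    pwave (B * \prod_(d <- w) symb zeta rho d) zeta rho.
Proof.
pose G w : V -> R^o := pwave (B * \prod_(d <- w) symb zeta rho d) zeta rho.
have [] : smooth e (G [::]) /\ forall w, Dw e w (G [::]) = G w.
  apply: smooth_family => [w|w d p]; first exact: pwave_continuous.
  by rewrite /G -cats1 big_cat big_seq1 mulrA; exact: is_derive_pwave.
by rewrite /G big_nil mulr1.
Qed.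

Lemma pwave_bound B zeta rho p :
  `|pwave B zeta rho p| <= normc B * expR (Re (phase zeta rho p)).
Proof. by rewrite /pwave -normc_cexp -normcM; exact: Re_le_normc. Qed.

End PlaneWave.

(** * Products of sines as sums of exponentials *)

Section ExpSum.
Context {R : realType} {n : nat} (L : R).
Local Notation C := R[i].
Local Notation Re := (@complex.Re R).
Local Notation Im := (@complex.Im R).
Import Normc.
Implicit Types (ka : seq nat) (x : 'rV[R]_n) (ls : seq 'I_n).

Definition sgk (k : nat) : R := (-1) ^+ odd k.

Lemma sgk_sqr k : sgk k ^+ 2 = 1. Proof. by rewrite /sgk sqrr_sign. Qed.

Lemma normr_sgk k : `|sgk k| = 1. Proof. by rewrite /sgk normr_sign. Qed.

(** The factors are the coefficients [- i / 2] and [i / 2] of [exp (i u)] and [exp (- i u)] in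
    [sin u]. *)
Definition amp ka : C := \prod_(k <- ka) Complex 0 (- sgk k / 2).

Definition esum ls ka x : R := \sum_(q <- zip ls ka) sgk q.2 * freq L q.2./2 * x ord0 q.1.

Lemma boxsumD {V : zmodType} K m (F G : seq nat -> V) :
  boxsum K m (fun s => F s + G s) = boxsum K m F + boxsum K m G.
Proof.
elim: m F G => [|m IH] F G //=; rewrite -big_split /=; apply: eq_bigr => k _; exact: IH.
Qed.

Lemma big_double {V : zmodType} K (F : nat -> V) :
  \sum_(k < K.*2) F k = \sum_(k < K) (F k.*2 + F k.*2.+1).
Proof.
elim: K => [|K IH]; first by rewrite !big_ord0.
by rewrite doubleS !big_ord_recr /= IH addrA.
Qed.

Lemma sin_cexp (u : R) : (sin u)%:C%C =
  Complex 0 (- 2^-1) * cexp (Complex 0 u) + Complex 0 2^-1 * cexp (Complex 0 (- u)) :> C.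
Proof.
by apply: complex_eq; rewrite ?cReD ?cImD ?cReM ?cImM /= ?expR0 ?sinN ?cosN; field.
Qed.

(* Every sine is split into two exponentials: the index [k = ka./2] of the frequency
   and the sign (the parity of [ka]) are packed in one natural number. *)
Lemma msin_expand K ls (c : seq nat -> C) x :
  boxsum K (size ls) (fun ks => c ks * (msin L ls ks x)%:C%C) =
  boxsum K.*2 (size ls) (fun ka => c (map half ka) * amp ka * cexp (Complex 0 (esum ls ka x))).
Proof.
elim: ls c => [|l ls IH] c /=.
  by rewrite /amp /esum !big_nil -[Complex 0 0]/(0 : C) cexp0 mulr1.
rewrite (big_double K (fun k => boxsum K.*2 (size ls) (fun ka => c (map half (k :: ka))
  * amp (k :: ka) * cexp (Complex 0 (esum (l :: ls) (k :: ka) x))))).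
apply: eq_bigr => k _; rewrite -boxsumD.
have := IH (fun ks => c (nat_of_ord k :: ks) * (sin (freq L k * x ord0 l))%:C%C).
rewrite (@eq_boxsum _ _ _ _ (fun ks => c (nat_of_ord k :: ks)
  * (sin (freq L k * x ord0 l) * msin L ls ks x)%:C%C)); last first.
  by move=> s _; rewrite rmorphM mulrA.
move=> ->; apply: eq_boxsum => ka _.
rewrite /= doubleK uphalf_double /amp !big_cons /esum /= !big_cons /=.
rewrite /sgk oddS odd_double /= expr0 expr1 mul1r doubleK uphalf_double opprK mulN1r !mul1r.
set t := freq L k; set S := \sum_(j <- _) _; set P := \prod_(j <- _) _.
have E (u : R) : cexp (Complex 0 (u + S)) = cexp (Complex 0 u) * cexp (Complex 0 S).
  by rewrite -cexpD; congr cexp; apply: complex_eq; rewrite ?cReD ?cImD /= ?addr0.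
rewrite !E sin_cexp ?mulNr ?mul1r; ring.
Qed.

Lemma esum_enum (i0 : 'I_n) ka x : size ka = n ->
  esum (enum 'I_n) ka x = \sum_(l < n) sgk (nth 0%N ka l) * freq L (nth 0%N ka l)./2 * x ord0 l.
Proof.
move=> sk; rewrite /esum (big_nth (i0, 0%N)) size_zip size_enum_ord sk minnn big_mkord.
apply: eq_bigr => l _; rewrite nth_zip ?size_enum_ord//=.
by rewrite nth_ord_enum.
Qed.

Lemma sum_nth_seq (F : nat -> R) ka : size ka = n ->
  \sum_(l < n) F (nth 0%N ka l) = \sum_(k <- ka) F k.
Proof. by move=> sk; rewrite (big_nth 0%N) sk big_mkord. Qed.

End ExpSum.

(** * Single terms and their denominators *)

Section Term.
Context {R : realType} {n : nat} (L : R) (L0 : 0 < L).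
Local Notation C := R[i].
Local Notation Re := (@complex.Re R).
Local Notation Im := (@complex.Im R).
Local Notation V := ('rV[R]_n * R)%type.
Local Notation e := (@spacetime_dir R n).
Import Normc.
Context (i : 'I_n) (sg : R) (sg1 : `|sg| = 1).
Implicit Types (ka : seq nat) (p : V) (s : R) (w : seq (option 'I_n)).

Definition zeta s ka (l : 'I_n) : C :=
  Complex ((l == i)%:R * (sg * s)) (sgk (nth 0%N ka l) * freq L (nth 0%N ka l)./2).

Definition zeta2 s ka : C := \sum_l zeta s ka l ^+ 2.
(** Either square root serves: exchanging them changes the sign of [den] and of the difference of
    exponentials in [term]. *)
Definition rho s ka : C := sqrtc (zeta2 s ka).
(** This is [2 sinh rho]. *)
Definition den s ka : C := cexp (rho s ka) - cexp (- rho s ka).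
(** A common bound for every [zeta l] and for [rho], that is, the price of one derivative in space
    or time. *)
Definition zc s ka : R := s + \sum_(k <- ka) freq L k./2.
(** It dominates each single frequency index, so powers of [zc] can be absorbed by a decay given in
    product form. *)
Definition kprod ka : R := \prod_(k <- ka) k./2.+1%:R.

Let sg2 : sg ^+ 2 = 1. Proof. by rewrite -[LHS]ger0_norm ?sqr_ge0// normrX sg1 expr1n. Qed.

Lemma sum_freq_le ka (l : 'I_n) : size ka = n ->
  freq L (nth 0%N ka l)./2 <= \sum_(k <- ka) freq L k./2.
Proof.
move=> sk; rewrite -(@sum_nth_seq R n (fun k => freq L k./2))// (bigD1 l)//= lerDl.
by apply: sumr_ge0 => j _; rewrite ltW// freq_gt0.
Qed.

Lemma normc_zeta s ka l : 0 <= s -> normc (zeta s ka l) <= (l == i)%:R * s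
  + freq L (nth 0%N ka l)./2.
Proof.
move=> s0.
have -> : zeta s ka l = ((l == i)%:R * (sg * s))%:C%C
  + Complex 0 (sgk (nth 0%N ka l) * freq L (nth 0%N ka l)./2).
  by apply: complex_eq; rewrite ?cReD ?cImD /= ?addr0 ?add0r.
apply: le_trans (normc_triangle _ _) _; rewrite normc_real normc_imag.
by rewrite normrM normr_nat normrM sg1 mul1r (ger0_norm s0) normrM normr_sgk mul1r gtr0_norm
  ?freq_gt0.
Qed.

Lemma normc_zeta_zc s ka l : 0 <= s -> size ka = n -> normc (zeta s ka l) <= zc s ka.
Proof.
move=> s0 sk; apply: le_trans (normc_zeta _ _ s0) _; apply: lerD; last exact: sum_freq_le.
by case: eqP => _; rewrite ?mul1r ?mul0r.
Qed.

Lemma sum_normc_zeta s ka : 0 <= s -> size ka = n -> \sum_l normc (zeta s ka l) <= zc s ka.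
Proof.
move=> s0 sk; apply: (@le_trans _ _ (\sum_l ((l == i)%:R * s + freq L (nth 0%N ka l)./2))).
  by apply: ler_sum => l _; exact: normc_zeta.
rewrite big_split /= (@sum_nth_seq R n (fun k => freq L k./2))// (bigD1 i)//= eqxx mul1r big1
  ?addr0//.
by move=> j ji; rewrite (negbTE ji) mul0r.
Qed.

Lemma zc_ge0 s ka : 0 <= s -> 0 <= zc s ka.
Proof. by move=> s0; rewrite addr_ge0// sumr_ge0// => k _; rewrite ltW// freq_gt0. Qed.

Lemma rho_sqr s ka : rho s ka ^+ 2 = zeta2 s ka.
Proof. exact: sqr_sqrtc. Qed.

Lemma normc_rho s ka : 0 <= s -> size ka = n -> normc (rho s ka) <= zc s ka.
Proof.
move=> s0 sk; have z0 := zc_ge0 ka s0.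
rewrite -ler_sqr ?nnegrE ?normc_ge0//.
have -> : normc (rho s ka) ^+ 2 = normc (zeta2 s ka) by rewrite -rho_sqr !expr2 normcM.
apply: le_trans (normc_sum _ _) _.
rewrite expr2; apply: le_trans (ler_wpM2r z0 (sum_normc_zeta s0 sk)).
rewrite mulr_suml; apply: ler_sum => l _; rewrite expr2 normcM.
by rewrite ler_wpM2l ?normc_ge0// normc_zeta_zc.
Qed.

(** The real and imaginary parts of [rho ^+ 2 = zeta2]. Only the [i]-th coordinate has a real part,
    so it alone contributes to the imaginary part; squaring the second relation removes the
    signs. *)
Lemma rho_re_im s ka : size ka = n ->
  Re (rho s ka) ^+ 2 - Im (rho s ka) ^+ 2 = s ^+ 2 - \sum_(l < n) freq L (nth 0%N ka l)./2 ^+ 2 /\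
  (Re (rho s ka) * Im (rho s ka)) ^+ 2 = (s * freq L (nth 0%N ka i)./2) ^+ 2.
Proof.
move=> sk; have r2 := rho_sqr s ka.
have := congr1 Re r2; have := congr1 Im r2.
rewrite !expr2 cReM cImM /zeta2 Re_sum Im_sum.
have -> : \sum_l Re (zeta s ka l ^+ 2) = s ^+ 2 - \sum_(l < n) freq L (nth 0%N ka l)./2 ^+ 2.
  rewrite (eq_bigr (fun l => (l == i)%:R * s ^+ 2 - freq L (nth 0%N ka l)./2 ^+ 2)).
    rewrite sumrB (bigD1 i)//= eqxx mul1r big1 ?addr0// => j ji.
    by rewrite (negbTE ji) mul0r.
  move=> l _; rewrite expr2 cReM /= -!expr2 !exprMn sgk_sqr mul1r sg2 mul1r.
  by case: eqP => _; rewrite ?expr1n ?expr0n.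
have -> : \sum_l Im (zeta s ka l ^+ 2) =
  sg * s * (sgk (nth 0%N ka i) * freq L (nth 0%N ka i)./2) *+ 2.
  rewrite (bigD1 i)// big1 ?addr0.
    by rewrite expr2 cImM /= eqxx mul1r addr0 mulr2n; congr (_ + _); rewrite mulrC.
  by move=> j; rewrite andTb => ji; rewrite expr2 cImM /= (negbTE ji) mul0r mul0r mulr0 addr0.
move=> E1 E2; split; first by rewrite -!expr2 in E2.
have E3 : Re (rho s ka) * Im (rho s ka) = sg * s * (sgk (nth 0%N ka i) * freq L (nth 0%N ka i)./2).
  have : (Re (rho s ka) * Im (rho s ka)) *+ 2 =
    sg * s * (sgk (nth 0%N ka i) * freq L (nth 0%N ka i)./2) *+ 2.
    by rewrite -E1 mulr2n; congr (_ + _); rewrite mulrC.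
  by move/eqP; rewrite eqr_pMn2r// => /eqP.
by rewrite E3 -!expr2 !exprMn sg2 sgk_sqr !mul1r.
Qed.

(** If [(Re rho)^2 > s^2], the first relation of [rho_re_im] gives [(Im rho)^2 > freq^2] for the
    [i]-th frequency, and the product of the two inequalities contradicts the second. Hence growth
    in time is no faster than the tilt in space. *)
Lemma Re_rho_le s ka : 0 < s -> size ka = n -> `|Re (rho s ka)| <= s.
Proof.
move=> s0 sk; have [E1 E2] := rho_re_im s sk.
rewrite -ler_sqr ?nnegrE ?(ltW s0)// -normrX ger0_norm ?sqr_ge0//.
rewrite leNgt; apply/negP => h.
have t0 : 0 < freq L (nth 0%N ka i)./2 ^+ 2 by rewrite exprn_gt0// freq_gt0.
have tS : freq L (nth 0%N ka i)./2 ^+ 2 <= \sum_(l < n) freq L (nth 0%N ka l)./2 ^+ 2.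
  by rewrite (bigD1 i)//= lerDl sumr_ge0// => j _; rewrite sqr_ge0.
have b2 : freq L (nth 0%N ka i)./2 ^+ 2 < Im (rho s ka) ^+ 2 by lra.
have : s ^+ 2 * freq L (nth 0%N ka i)./2 ^+ 2 < Re (rho s ka) ^+ 2 * Im (rho s ka) ^+ 2.
  by apply: ltr_pM => //; rewrite ?sqr_ge0// ltW.
by rewrite -!exprMn E2 ltxx.
Qed.

Lemma freq_ge k : pi / L <= freq L k.
Proof. by rewrite /freq ler_peMl ?divr_ge0 ?pi_ge0 ?(ltW L0)// ler1n. Qed.

(* [Re rho * Im rho = Im (rho ^+ 2) / 2 = +- s * freq], while [Im rho] is at most [zc]. *)
Lemma Re_rho_ge s ka : 1 <= s -> size ka = n -> pi / L <= `|Re (rho s ka)| * zc s ka.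
Proof.
move=> s1 sk; have s0 : 0 < s by rewrite (lt_le_trans ltr01).
have [_ E2] := rho_re_im s sk.
have f0 := freq_gt0 L0 (nth 0%N ka i)./2.
have E3 : `|Re (rho s ka)| * `|Im (rho s ka)| = s * freq L (nth 0%N ka i)./2.
  have sf0 : 0 <= s * freq L (nth 0%N ka i)./2 := mulr_ge0 (ltW s0) (ltW f0).
  apply/eqP; rewrite -normrM -(@eqrXn2 _ 2)//.
  by rewrite -normrX E2 ger0_norm ?sqr_ge0.
apply: (@le_trans _ _ (s * freq L (nth 0%N ka i)./2)).
  apply: le_trans (freq_ge (nth 0%N ka i)./2) _; by rewrite ler_peMl// ltW.
rewrite -E3 ler_wpM2l//; apply: le_trans (Im_le_normc _) _; exact: normc_rho (ltW s0) sk.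
Qed.

(** The reverse triangle inequality bounds the norm below by [exp a - exp (- a)] with
    [a = |Re rho|], and this is at least [a] since [exp a >= 1 + a] and [exp (- a) <= 1]. *)
Lemma normc_den s ka : `|Re (rho s ka)| <= normc (den s ka).
Proof.
rewrite /den; set r := rho s ka.
have H : expR (Re r) <= normc (cexp r - cexp (- r)) + expR (- Re r).
  rewrite -cReN -!normc_cexp -[X in normc X <= _](subrK (cexp (- r))).
  exact: normc_triangle.
have H' : expR (- Re r) <= normc (cexp r - cexp (- r)) + expR (Re r).
  rewrite -cReN -!normc_cexp -[X in normc X <= _](subrK (cexp r)).
  by apply: le_trans (normc_triangle _ _) _; rewrite -opprB normcN.
have [a0|a0] := leP 0 (Re r).
  rewrite ger0_norm//; have := expR_ge1Dx (Re r).
  have : expR (- Re r) <= 1 by rewrite expR_le1 oppr_le0.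
  by lra.
rewrite ltr0_norm//; have := expR_ge1Dx (- Re r).
have : expR (Re r) <= 1 by rewrite expR_le1 ltW.
by lra.
Qed.

Context (c : R -> seq nat -> R).

Definition tcoef s ka : C := (c s (map half ka))%:C%C * amp ka / den s ka.

(* The real part of a multiple of [exp(zeta.x) sinh(rho t) / sinh rho]. *)
Definition term s ka p : R :=
  pwave (tcoef s ka) (zeta s ka) (rho s ka) p - pwave (tcoef s ka) (zeta s ka) (- rho s ka) p.

Lemma zc_gt0 s ka : 0 < s -> 0 < zc s ka.
Proof. by move=> s0; rewrite ltr_pwDl// sumr_ge0// => k _; rewrite ltW// freq_gt0. Qed.

Lemma den_gt0 s ka : 1 <= s -> size ka = n -> 0 < normc (den s ka).
Proof.
move=> s1 sk; have s0 : 0 < s by rewrite (lt_le_trans ltr01).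
apply: lt_le_trans (normc_den s ka).
have := Re_rho_ge s1 sk; have z0 := zc_gt0 ka s0.
rewrite -ler_pdivrMr// => H; apply: lt_le_trans H; rewrite !divr_gt0//; exact: pi_gt0.
Qed.

Lemma normc_amp ka : normc (amp ka : C) <= 1.
Proof.
rewrite /amp; elim: ka => [|k ka IH]; first by rewrite big_nil normc1.
rewrite big_cons normcM -[leRHS]mulr1 ler_pM ?normc_ge0//.
by rewrite normc_imag normrM normrN normr_sgk mul1r ger0_norm ?invr_ge0// invf_le1 ?ler1n.
Qed.

Lemma normc_tcoef s ka : 1 <= s -> size ka = n ->
  normc (tcoef s ka) <= `|c s (map half ka)| * (L / pi) * zc s ka.
Proof.
move=> s1 sk; have s0 : 0 < s by rewrite (lt_le_trans ltr01).
have z0 := zc_gt0 ka s0.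
have d0 := den_gt0 s1 sk.
rewrite /tcoef normcM normcV normcM normc_real -mulrA -[leRHS]mulrA ler_wpM2l//.
rewrite -[leRHS]mul1r ler_pM ?normc_ge0 ?normc_amp ?invr_ge0 ?(ltW d0)//.
have pL : 0 < pi / L by rewrite divr_gt0// pi_gt0.
have -> : L / pi * zc s ka = (pi / L / zc s ka)^-1 by rewrite invfM invrK invf_div.
rewrite lef_pV2 ?posrE ?(divr_gt0 pL)//.
by rewrite ler_pdivrMr//; apply: le_trans (Re_rho_ge s1 sk) _;
  rewrite ler_wpM2r ?normc_den ?(ltW z0).
Qed.

(** Only the tilted coordinate and time enter the real part, both with rate at most [s]; this is
    where the region [sg x_i + |t| <= const] comes from. *)
Lemma Re_phase_le s ka (r : C) p : `|Re r| <= s -> Re (phase (zeta s ka) r p) <=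
  s * (sg * p.1 ord0 i + `|p.2|).
Proof.
move=> rs; rewrite /phase cReD Re_sum.
have E l : Re (zeta s ka l * (p.1 ord0 l)%:C%C) = (l == i)%:R * (sg * s) * p.1 ord0 l.
  by rewrite cReM /= mulr0 subr0.
rewrite (eq_bigr _ (fun l _ => E l)) (bigD1 i)//= eqxx mul1r big1 ?addr0; last first.
  by move=> j ji; rewrite (negbTE ji) !mul0r.
rewrite cReM /= mulr0 subr0.
rewrite mulrDr; apply: lerD; first by rewrite mulrCA mulrA.
apply: le_trans (ler_norm _) _; by rewrite normrM ler_wpM2r.
Qed.

Lemma normc_symb s ka (r : C) w : 0 <= s -> size ka = n -> normc r <= zc s ka ->
  normc (\prod_(d <- w) symb (zeta s ka) r d) <= zc s ka ^+ size w.
Proof.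
move=> s0 sk rz; elim: w => [|d w IH]; first by rewrite big_nil normc1 expr0.
rewrite big_cons normcM exprS ler_pM ?normc_ge0//.
by case: d => [l|] //=; exact: normc_zeta_zc.
Qed.

Lemma smooth_term s ka : smooth e (term s ka : V -> R^o) /\ forall w,
  Dw e w (term s ka : V -> R^o) =
   (fun p => pwave (tcoef s ka * \prod_(d <- w) symb (zeta s ka) (rho s ka) d) (zeta s ka)
     (rho s ka) p +
        - pwave (tcoef s ka * \prod_(d <- w) symb (zeta s ka) (- rho s ka) d) (zeta s ka)
          (- rho s ka) p).
Proof.
have [s1 D1] := smooth_pwave (tcoef s ka) (zeta s ka) (rho s ka).
have [s2 D2] := smooth_pwave (tcoef s ka) (zeta s ka) (- rho s ka).
have [s3 D3] := smoothZ (-1) s2.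
have [s4 D4] := smoothD s1 s3.
have E : (term s ka : V -> R^o) =
  (fun x => (pwave (tcoef s ka) (zeta s ka) (rho s ka) : V -> R^o) x +
   (-1) *: (pwave (tcoef s ka) (zeta s ka) (- rho s ka) : V -> R^o) x).
  by apply/funext => x; rewrite scaleN1r.
rewrite E; split => // w; rewrite D4 D3 D1 D2; apply/funext => p.
by rewrite scaleN1r.
Qed.

(** Each letter of [w] costs one factor [zc]; the additional one comes from the division by [den],
    and the factor 2 from the two exponentials. *)
Lemma term_bound s ka w p : 1 <= s -> size ka = n ->
  `|Dw e w (term s ka : V -> R^o) p| <=
    `|c s (map half ka)| * (2 * (L / pi)) * zc s ka ^+ (size w).+1
      * expR (s * (sg * p.1 ord0 i + `|p.2|)).
Proof.
move=> s1 sk; have s0 : 0 < s by rewrite (lt_le_trans ltr01).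
have z0 := zc_gt0 ka s0.
rewrite (smooth_term s ka).2.
have B (r : C) : `|Re r| <= s -> normc r <= zc s ka ->
  `|pwave (tcoef s ka * \prod_(d <- w) symb (zeta s ka) r d) (zeta s ka) r p| <=
   `|c s (map half ka)| * (L / pi) * zc s ka ^+ (size w).+1 * expR (s * (sg * p.1 ord0 i + `|p.2|)).
  move=> r1 r2; apply: le_trans (pwave_bound _ _ _ _) _.
  rewrite ler_pM ?normc_ge0 ?expR_ge0//; last by rewrite ler_expR Re_phase_le.
  rewrite normcM exprS mulrA ler_pM ?normc_ge0//; first exact: normc_tcoef.
  by apply: normc_symb => //; exact: ltW.
apply: le_trans (ler_normD _ _) _; rewrite normrN.
have -> : `|c s (map half ka)| * (2 * (L / pi)) * zc s ka ^+ (size w).+1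
  * expR (s * (sg * p.1 ord0 i + `|p.2|)) =
  `|c s (map half ka)| * (L / pi) * zc s ka ^+ (size w).+1 * expR (s * (sg * p.1 ord0 i + `|p.2|)) +
  `|c s (map half ka)| * (L / pi) * zc s ka ^+ (size w).+1 * expR (s * (sg * p.1 ord0 i + `|p.2|))
    by ring.
by apply: lerD; apply: B; rewrite ?cReN ?normrN ?normcN ?Re_rho_le// normc_rho// ltW.
Qed.

Lemma term_wave s ka p :
  \sum_(j < n) Dw e [:: Some j; Some j] (term s ka : V -> R^o) p = Dw e [:: None;
    None] (term s ka : V -> R^o) p.
Proof.
have D w : Dw e w (term s ka : V -> R^o) p =
    pwave (tcoef s ka * \prod_(d <- w) symb (zeta s ka) (rho s ka) d) (zeta s ka) (rho s ka) p +
    - pwave (tcoef s ka * \prod_(d <- w) symb (zeta s ka) (- rho s ka) d) (zeta s ka) (- rho s ka)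
      p.
  by rewrite (smooth_term s ka).2.
rewrite D (eq_bigr _ (fun j _ => D [:: Some j; Some j])).
have H (r : C) : r ^+ 2 = zeta2 s ka -> \sum_(j < n)
    pwave (tcoef s ka * \prod_(d <- [:: Some j; Some j]) symb (zeta s ka) r d) (zeta s ka) r p =
    pwave (tcoef s ka * \prod_(d <- [:: None; None]) symb (zeta s ka) r d) (zeta s ka) r p.
  move=> r2; rewrite /pwave -Re_sum -mulr_suml -mulr_sumr; congr (Re (_ * _ * _)).
  rewrite !big_cons big_nil mulr1 /= -expr2 r2 /zeta2.
  by apply: eq_bigr => j _; rewrite !big_cons big_nil mulr1 /= expr2.
by rewrite big_split /= sumrN !H// ?sqrrN rho_sqr.
Qed.

Lemma term_t0 s ka x : term s ka (x, 0) = 0.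
Proof. by rewrite /term /pwave /phase /= !rmorph0 !mulr0 subrr. Qed.

Lemma term_t1 s ka x : 1 <= s -> size ka = n ->
  term s ka (x, 1) = expR (sg * s * x ord0 i) *
    Re ((c s (map half ka))%:C%C * amp ka * cexp (Complex 0 (esum L (enum 'I_n) ka x))).
Proof.
move=> s1 sk.
have d0 : den s ka != 0 by apply: contraTneq (den_gt0 s1 sk) => ->; rewrite normc0 ltxx.
set E := Complex 0 _.
have ph (r : C) : phase (zeta s ka) r (x, 1) = (sg * s * x ord0 i)%:C%C + E + r.
  rewrite /phase /= rmorph1 mulr1; congr (_ + _).
  have Er l : Re (zeta s ka l * (x ord0 l)%:C%C) = (l == i)%:R * (sg * s) * x ord0 l.
    by rewrite cReM /= mulr0 subr0.
  have Ei l : Im (zeta s ka l * (x ord0 l)%:C%C) = sgk (nth 0%N ka l) * freq L (nth 0%N ka l)./2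
    * x ord0 l.
    by rewrite cImM /= mulr0 add0r.
  apply: complex_eq; rewrite ?cReD ?cImD ?Re_sum ?Im_sum.
    rewrite (eq_bigr _ (fun l _ => Er l)) (bigD1 i)//= eqxx mul1r addr0 big1 ?addr0// => j ji.
    by rewrite (negbTE ji) !mul0r.
  rewrite (eq_bigr _ (fun l _ => Ei l)) /= add0r.
  by rewrite (esum_enum L i).
rewrite /term /pwave !ph -cReN -cReD -mulrBr !cexpD -mulrBr.
rewrite -[cexp (rho s ka) - _]/(den s ka).
have -> : tcoef s ka * (cexp (sg * s * x ord0 i)%:C%C * cexp E * den s ka) =
   (expR (sg * s * x ord0 i))%:C%C * ((c s (map half ka))%:C%C * amp ka * cexp E).
  have -> : cexp (sg * s * x ord0 i)%:C%C = (expR (sg * s * x ord0 i))%:C%C :> C.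
    by apply: complex_eq; rewrite /= ?cos0 ?sin0 ?mulr1 ?mulr0.
  by rewrite /tcoef; field.
by rewrite cReM /= mul0r subr0.
Qed.

Lemma boxsum_term_t1 s K x : 1 <= s ->
  boxsum K.*2 n (fun ka => term s ka (x, 1)) =
  expR (sg * s * x ord0 i) * boxsum K n (fun ks => c s ks * msin L (enum 'I_n) ks x).
Proof.
move=> s1.
rewrite (@eq_boxsum _ _ _ (fun ka => term s ka (x, 1)) (fun ka => expR (sg * s * x ord0 i) *
    Re ((c s (map half ka))%:C%C * amp ka * cexp (Complex 0 (esum L (enum 'I_n) ka x)))));
      last first.
  by move=> ka sk; rewrite term_t1.
rewrite -boxsumM; congr (_ * _).
have Rebox m N (F : seq nat -> C) : boxsum N m (fun ka => Re (F ka)) = Re (boxsum N m F).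
  elim: m F => [|m IH] F //=; rewrite Re_sum; apply: eq_bigr => k _; exact: IH.
rewrite Rebox.
have := msin_expand L K (enum 'I_n) (fun ks => (c s ks)%:C%C) x; rewrite size_enum_ord => <-.
by rewrite -Rebox; apply: eq_boxsum => ks _; rewrite cReM /= mul0r subr0.
Qed.

Lemma kprod_ge1 ka : 1 <= kprod ka.
Proof.
rewrite /kprod; elim: ka => [|k ka IH]; first by rewrite big_nil.
by rewrite big_cons -[leLHS]mulr1 ler_pM// ler1n.
Qed.

Lemma kprod_mem k ka : k \in ka -> k./2.+1%:R <= kprod ka.
Proof.
elim: ka => // k' ka IH; rewrite inE /kprod big_cons => /orP[/eqP <-|/IH H].
  by rewrite ler_peMr//; exact: kprod_ge1.
by apply: le_trans H _; rewrite ler_peMl ?ler1n// (le_trans ler01)//; exact: kprod_ge1.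
Qed.

Lemma zc_le s ka : 1 <= s -> size ka = n -> zc s ka <= s * (1 + n%:R * (pi / L)) * kprod ka.
Proof.
move=> s1 sk; have s0 : 0 <= s by rewrite (le_trans ler01).
have k1 := kprod_ge1 ka; have pL : 0 <= pi / L by rewrite divr_ge0 ?pi_ge0 ?ltW.
rewrite mulrDr mulr1 mulrDl; apply: lerD; first by rewrite ler_peMr.
apply: (@le_trans _ _ (n%:R * (pi / L) * kprod ka)); last first.
  by rewrite ler_wpM2r ?(le_trans ler01 k1)// ler_peMl// mulr_ge0.
rewrite -(@sum_nth_seq R n (fun k => freq L k./2))//.
have -> : n%:R * (pi / L) * kprod ka = \sum_(l < n) (pi / L) * kprod ka.
  by rewrite sumr_const card_ord -[RHS]mulr_natl -mulrA.
apply: ler_sum => l _; rewrite /freq mulrC ler_wpM2l//.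
by apply: kprod_mem; rewrite mem_nth// sk.
Qed.

(** At most [q.+1] powers of [zc] are lost, each at most [s * D * kprod ka]. The hypothesis provides
    [kprod ka] to the power [- 2 (q + 3)], which pays for them and leaves at least the summable
    power [- 2]. *)
Lemma term_decay (a : R) (q N : nat) (C0 : R) : 0 <= C0 ->
  (forall s, 1 <= s -> forall ks, size ks = n ->
    `|c s ks| <= C0 * s ^+ N * expR (- s * a) * (\prod_(k <- ks) ((k.+1%:R : R) ^- 2)) ^+ q.+3) ->
  exists2 C1, 0 <= C1 & forall s, 1 <= s -> forall ka, size ka = n -> forall w, (size w <= q)%N ->
    forall p,
   `|Dw e w (term s ka : V -> R^o) p| <=
     C1 * s ^+ (N + q.+1) * expR (s * (sg * p.1 ord0 i + `|p.2| - a))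
       * \prod_(k <- ka) ((k./2.+1%:R : R) ^- 2).
Proof.
move=> C00 Hc; set D := 1 + n%:R * (pi / L).
have pL : 0 <= pi / L by rewrite divr_ge0 ?pi_ge0 ?ltW.
have Lp : 0 <= L / pi by rewrite divr_ge0 ?pi_ge0 ?ltW.
have D1 : 1 <= D by rewrite lerDl mulr_ge0.
have D0 : 0 <= D by rewrite (le_trans ler01).
exists (C0 * (2 * (L / pi)) * D ^+ q.+1);
  first exact: mulr_ge0 (mulr_ge0 C00 (mulr_ge0 (ler0n _ 2) Lp)) (exprn_ge0 _ D0).
move=> s s1 ka sk w wq p; have s0 : 0 <= s by rewrite (le_trans ler01).
apply: le_trans (term_bound _ _ s1 sk) _.
have k1 := kprod_ge1 ka; have k0 : 0 < kprod ka by rewrite (lt_le_trans ltr01).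
have z1 : 1 <= s * D * kprod ka by rewrite -[1]mulr1 ler_pM// -[1]mulr1 ler_pM.
have Zle : zc s ka ^+ (size w).+1 <= (s * D * kprod ka) ^+ q.+1.
  apply: (@le_trans _ _ ((s * D * kprod ka) ^+ (size w).+1)).
    by rewrite lerXn2r ?nnegrE ?zc_ge0 ?zc_le// (le_trans ler01).
  by rewrite ler_weXn2l.
have Pe : \prod_(k <- map half ka) ((k.+1%:R : R) ^- 2) = kprod ka ^- 2.
  by rewrite big_map /kprod -prodrXl -prodfV.
have Pe' : \prod_(k <- ka) ((k./2.+1%:R : R) ^- 2) = kprod ka ^- 2.
  by rewrite /kprod -prodrXl -prodfV.
have := Hc s s1 (map half ka); rewrite size_map => /(_ sk); rewrite Pe Pe' => cb.
have -> : expR (s * (sg * p.1 ord0 i + `|p.2| - a)) =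
  expR (- s * a) * expR (s * (sg * p.1 ord0 i + `|p.2|)).
  by rewrite -expRD; congr expR; ring.
have -> : C0 * (2 * (L / pi)) * D ^+ q.+1 * s ^+ (N + q.+1)
  * (expR (- s * a) * expR (s * (sg * p.1 ord0 i + `|p.2|))) * kprod ka ^- 2 =
   (C0 * s ^+ N * expR (- s * a)) * (2 * (L / pi)) * (s ^+ q.+1 * D ^+ q.+1 * kprod ka ^- 2)
     * expR (s * (sg * p.1 ord0 i + `|p.2|)).
  by rewrite exprD; ring.
rewrite ler_wpM2r ?expR_ge0//.
apply: (@le_trans _ _ (C0 * s ^+ N * expR (- s * a) * kprod ka ^- 2 ^+ q.+3 * (2 * (L / pi))
  * (s * D * kprod ka) ^+ q.+1)).
  have L2 : 0 <= 2 * (L / pi) := mulr_ge0 (ler0n _ 2) Lp.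
  apply: ler_pM => //; first exact: mulr_ge0.
    by apply: exprn_ge0; exact: zc_ge0.
  by rewrite ler_wpM2r.
have -> : C0 * s ^+ N * expR (- s * a) * kprod ka ^- 2 ^+ q.+3 * (2 * (L / pi))
  * (s * D * kprod ka) ^+ q.+1 =
   C0 * s ^+ N * expR (- s * a) * (2 * (L / pi))
     * (s ^+ q.+1 * D ^+ q.+1 * (kprod ka ^- 2 ^+ q.+3 * kprod ka ^+ q.+1)).
  by rewrite !exprMn; ring.
have q1 : 0 <= C0 * s ^+ N * expR (- s * a) * (2 * (L / pi)).
  exact: mulr_ge0 (mulr_ge0 (mulr_ge0 C00 (exprn_ge0 _ s0)) (expR_ge0 _)) (mulr_ge0 (ler0n _ 2) Lp).
apply: (ler_wpM2l q1); apply: (ler_wpM2l (mulr_ge0 (exprn_ge0 _ s0) (exprn_ge0 _ D0))).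
rewrite -exprVn -exprM mulnC exprM.
have kq : (kprod ka)^-1 ^+ q.+3 * kprod ka ^+ q.+1 = (kprod ka)^-1 ^+ 2.
  have -> : q.+3 = (2 + q.+1)%N by [].
  by rewrite exprD -mulrA -exprMn mulVf ?gt_eqF// expr1n mulr1.
have -> : (kprod ka)^-1 ^+ q.+3 ^+ 2 * kprod ka ^+ q.+1 =
  (kprod ka)^-1 ^+ q.+3 * ((kprod ka)^-1 ^+ q.+3 * kprod ka ^+ q.+1).
  by rewrite expr2 mulrA.
rewrite kq ler_piMl ?exprn_ge0 ?invr_ge0 ?(ltW k0)//.
by rewrite exprn_ile1 ?invr_ge0 ?(ltW k0)// invf_le1.
Qed.

End Term.

(** * Affine changes of variables and finite sums *)

Section Shift.
Context {R : realType} {V : normedModType R} {I : Type} (e : I -> V).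

Lemma smooth_comp_affine (W : normedModType R) (T : V -> V) (k : I -> R) (f : V -> W) :
  continuous T -> (forall i (h : R) x, T (h *: e i + x) = (k i * h) *: e i + T x) -> smooth e f ->
  smooth e (fun x => f (T x)) /\
  forall w, Dw e w (fun x => f (T x)) = (fun x => (\prod_(i <- w) k i) *: Dw e w f (T x)).
Proof.
move=> cT TE sf.
have -> : (fun x => f (T x)) = (fun x => (\prod_(i <- [::]) k i) *: Dw e [::] f (T x)).
  by apply/funext => x; rewrite big_nil scale1r.
apply: (@smooth_family R V W I e (fun w x => (\prod_(i <- w) k i) *: Dw e w f (T x))) =>
  [w x|w i x].
  apply: (@continuous_comp _ _ _ (fun x => Dw e w f (T x)) ( *:%R _));
    last exact: scaler_continuous.
  apply: continuous_comp; first exact: cT.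
  exact: smooth_continuous (smooth_Dw w sf) _.
rewrite -cats1 big_cat big_seq1 -scalerA cats1.
suff d : is_derive x (e i) (fun x => Dw e w f (T x)) (k i *: Dw e (rcons w i) f (T x)).
  exact: is_deriveZ.
apply: is_derive_le => eps e0.
have k1 : 0 < `|k i| + 1 by rewrite ltr_wpDl.
have [r r0 Hr] := is_derive_ex_le (smooth_is_derive_Dw w i (T x) sf) (divr_gt0 e0 k1).
exists (r / (`|k i| + 1)); first exact: divr_gt0.
move=> h h0; rewrite ltr_pdivlMr// => hr; rewrite TE.
(* The rescaled quotient divides by [k i * h]. If [k i = 0], the map is constant along [e i] and the
   derivative is 0. *)
have [->|ki] := eqVneq (k i) 0.
  by rewrite mul0r !scale0r add0r subrr scaler0 subr0 normr0 ltW.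
have -> : h^-1 *: (Dw e w f ((k i * h) *: e i + T x) - Dw e w f (T x))
  - k i *: Dw e (rcons w i) f (T x) =
   k i *: ((k i * h)^-1 *: (Dw e w f ((k i * h) *: e i + T x) - Dw e w f (T x))
     - Dw e (rcons w i) f (T x)).
  by rewrite [RHS]scalerBr scalerA invfM mulrA divff// mul1r.
rewrite normrZ; apply: (@le_trans _ _ (`|k i| * (eps / (`|k i| + 1)))).
  rewrite ler_wpM2l//; apply: Hr; first by rewrite mulf_neq0.
  rewrite normrM mulrC; apply: le_lt_trans hr.
  by rewrite ler_wpM2l// lerDl.
by rewrite mulrA ler_pdivrMr// mulrC ler_wpM2l ?(ltW e0)// lerDl.
Qed.

Lemma smooth_boxsum (W : normedModType R) K m (F : seq nat -> V -> W) :
  (forall s, smooth e (F s)) ->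
  smooth e (fun x => boxsum K m (F^~ x)) /\
  forall w, Dw e w (fun x => boxsum K m (F^~ x)) = (fun x => boxsum K m (fun s => Dw e w (F s) x)).
Proof.
elim: m F => [|m IH] F sF /=; first by split.
have H k := IH (fun s => F (k :: s)) (fun s => sF (k :: s)).
have [s1 D1] := @smooth_sum _ _ _ _ e _ (index_enum 'I_K) xpredT
   (fun k : 'I_K => fun x => boxsum K m (fun s => F (nat_of_ord k :: s) x)) (fun k => (H k).1).
split => // w; rewrite D1; apply/funext => x; apply: eq_bigr => k _.
by rewrite (H k).2.
Qed.

End Shift.

(** * Waves that are small on a half-space *)

Section Piece.
Context {R : realType} {n : nat}.
Local Notation V := ('rV[R]_n * R)%type.
Local Notation e := (@spacetime_dir R n).
Local Notation es := (@space_dir R n).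

Definition rwave (u : V -> R) := smooth e (u : V -> R^o) /\
  forall p, \sum_(j < n) Dw e [:: Some j; Some j] (u : V -> R^o) p = Dw e [:: None;
    None] (u : V -> R^o) p.

Lemma poly_exp_small (C eps : R) (N : nat) : 0 < eps -> exists2 s, 1 <=
  s & C * s ^+ N * expR (- s) <= eps.
Proof.
move=> e0; pose s := `|C| * N.+1`!%:R / eps + 1.
have f0 : 0 < N.+1`!%:R :> R by rewrite ltr0n fact_gt0.
have s1 : 1 <= s by rewrite lerDr (divr_ge0 (mulr_ge0 (normr_ge0 C) (ltW f0)) (ltW e0)).
have s0 : 0 < s by rewrite (lt_le_trans ltr01).
exists s => //; rewrite expRN ler_pdivrMr ?expR_gt0//.
apply: (@le_trans _ _ (eps * (s ^+ N.+1 / N.+1`!%:R))); last first.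
  rewrite ler_wpM2l ?(ltW e0)//; apply: le_trans (expR_ge1Dxn N (ltW s0)).
  by rewrite lerDr.
have -> : eps * (s ^+ N.+1 / N.+1`!%:R) = (eps * s / N.+1`!%:R) * s ^+ N by rewrite exprS; ring.
rewrite ler_wpM2r ?exprn_ge0 ?(ltW s0)// ler_pdivlMr//.
apply: (@le_trans _ _ (`|C| * N.+1`!%:R)); first by rewrite ler_wpM2r ?ler_norm// ltW.
by rewrite [leRHS]mulrC -ler_pdivrMr// lerDl.
Qed.

(** The argument is a packed index, so each frequency occurs once per sign; this doubles the bound 2
    to 4 in [sum_bk_le]. *)
Definition bk (k : nat) : R := k./2.+1%:R ^- 2.

Lemma bk_ge0 k : 0 <= bk k. Proof. by rewrite invr_ge0 sqr_ge0. Qed.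

Lemma sum_bk_le K : \sum_(k < K) bk k <= 4.
Proof.
have -> : (4 : R) = 2 * 2 by rewrite -natrM.
apply: (@le_trans _ _ (\sum_(k < K.*2) bk k)).
  rewrite -!(big_mkord xpredT bk) (@big_cat_nat _ _ _ K 0 K.*2)//=; last by rewrite -addnn leq_addr.
  by rewrite lerDl sumr_ge0// => k _; exact: bk_ge0.
rewrite (big_double K bk) (eq_bigr (fun k : 'I_K => 2 * (k.+1%:R : R) ^- 2)).
  by rewrite -mulr_sumr ler_wpM2l// sum_invsq_le2.
by move=> k _; rewrite /bk /= doubleK uphalf_double mulr2n mulrDl mul1r.
Qed.

Lemma sum_bk_cauchy (eps : R) : 0 < eps -> exists N : nat, forall K K', (N <= K)%N -> (N <= K')%N ->
  `|(\sum_(k < K') bk k) ^+ n - (\sum_(k < K) bk k) ^+ n| <= eps.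
Proof.
move=> e0; pose u K : R := (\sum_(k < K) bk k) ^+ n.
have b0 K : 0 <= \sum_(k < K) bk k by apply: sumr_ge0 => k _; exact: bk_ge0.
have nu : nondecreasing_seq u.
  move=> K K' KK; rewrite /u lerXn2r ?nnegrE//.
  rewrite -!(big_mkord xpredT bk) (@big_cat_nat _ _ _ K 0 K')//=.
  by rewrite lerDl sumr_ge0// => k _; exact: bk_ge0.
have : cvg (u @ \oo).
  apply: nondecreasing_is_cvgn => //; exists (4 ^+ n) => _ [K _ <-].
  by rewrite /u lerXn2r ?nnegrE ?sum_bk_le.
move=> /cvg_ex[l] /cvgrPdist_le/(_ (eps / 2)) []; first by rewrite divr_gt0.
move=> N _ HN; exists N => K K' NK NK'.
rewrite -/(u K') -/(u K).
have -> : u K' - u K = - (l - u K') + (l - u K) by ring.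
apply: le_trans (ler_normD _ _) _; rewrite normrN.
have -> : eps = eps / 2 + eps / 2 by field.
by apply: lerD; apply: HN.
Qed.

Lemma rwaveD u v : rwave u -> rwave v -> rwave (fun p => u p + v p).
Proof.
move=> [su wu] [sv wv]; have [s D] := smoothD su sv; split; [exact: s|move=> p].
have D2 d : Dw e [:: d; d] ((fun p => u p + v p) : V -> R^o) p =
    Dw e [:: d; d] (u : V -> R^o) p + Dw e [:: d; d] (v : V -> R^o) p.
  by rewrite (D [:: d; d]).
by rewrite (D2 None) -wu -wv -big_split; apply: eq_bigr => j _; exact: D2.
Qed.

Lemma rwave_limit (F : nat -> V -> R) (f : V -> R) : (forall K, rwave (F K)) ->
  smooth e (f : V -> R^o) ->
  (forall w p, Dw e w (F K : V -> R^o) p @[K --> \oo] --> Dw e w (f : V -> R^o) p) ->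
  rwave f.
Proof.
move=> FW sf cv; split => // p.
have c1 : \sum_(j < n) Dw e [:: Some j; Some j] (F K : V -> R^o) p @[K --> \oo] -->
    \sum_(j < n) Dw e [:: Some j; Some j] (f : V -> R^o) p.
  elim: (index_enum _) => [|l s IH].
    by under eq_fun do rewrite big_nil; rewrite big_nil; exact: cvg_cst.
  under eq_fun do rewrite big_cons; rewrite big_cons; apply: cvgD; last exact: IH.
  exact: cv.
have c2 := cv [:: None; None] p.
rewrite -(cvg_lim _ c1)// -(cvg_lim _ c2)//.
by congr (lim (_ @ \oo)); apply/funext => K; rewrite (FW K).2.
Qed.

(** The coefficients carry [exp (- s a)] and the exponentials are at most [exp (s (sg y_i + |t|))].
    The unit of margin in [a - 1] leaves [exp (- s)], which beats all polynomial losses in [s]. *)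
Lemma piece_box (L a sg : R) (i : 'I_n) (Z : set 'rV[R]_n) (p : 'rV[R]_n -> R) (q : nat) (eps : R) :
  0 < L -> closed Z -> (forall x, Z x -> forall i, 0 < x ord0 i < L) ->
  `|sg| = 1 -> (forall x, Z x -> a <= sg * x ord0 i) ->
  csupp Z p -> smooth es (p : _ -> R^o) -> 0 < eps ->
  exists v : V -> R, [/\ rwave v, forall x, v (x, 0) = 0,
    forall x, inbox L x -> v (x, 1) = p x &
    forall w, (size w <= q)%N -> forall y : V, sg * y.1 ord0 i + `|y.2| <= a - 1 ->
      `|Dw e w (v : V -> R^o) y| <= eps].
Proof.
move=> L0 cZ ZL sg1 Za pZ sp e0.
have gp : good Z p by [].
pose c (s : R) ks := mcoef L (enum 'I_n) ks (fun x => p x * expR (- (sg * s) * x ord0 i)) 0.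
(* [m.+3] integrations by parts are what [term_decay] requires for derivatives up to order [m]; the
   coefficients [c] are the same for every [m]. *)
have decay (m : nat) : exists2 C1, 0 <= C1 & exists N, forall s, 1 <= s -> forall ka, size ka = n ->
    forall w, (size w <= m)%N -> forall y,
   `|Dw e w (term L i sg c s ka : V -> R^o) y| <=
     C1 * s ^+ N * expR (s * (sg * y.1 ord0 i + `|y.2| - a)) * \prod_(k <- ka) bk k.
  have [C0 C00 [N HN]] := mcoef_decay L0 cZ ZL sg1 Za m.+3 gp.
  have [C1 C10 H1] := term_decay L0 i sg1 C00 HN.
  by exists C1 => //; exists (N + m.+1)%N.
have [C1 C10 [N HN]] := decay q.
(* [C1] and [N] are known before [s], so [s] may depend on them; [4 ^+ n] bounds the sum of the
   majorants over all multi-indices. *)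
have [s s1 sE] := poly_exp_small (C1 * 4 ^+ n) N e0.
have s0 : 0 <= s by rewrite (le_trans ler01).
pose F K y := boxsum K n (fun ka => term L i sg c s ka y).
have FS K := @smooth_boxsum _ _ _ e R^o K n (fun ka => term L i sg c s ka : V -> R^o)
   (fun ka => (smooth_term L i sg c s ka).1).
have FW K : rwave (F K).
  split; first exact: (FS K).1.
  move=> y; rewrite (FS K).2.
  rewrite (eq_bigr (fun j => boxsum K n (fun ka => Dw e [:: Some j;
    Some j] (term L i sg c s ka : V -> R^o) y))); last first.
    by move=> j _; rewrite (FS K).2.
  have sumbox (m : nat) (G : 'I_n -> seq nat -> R) : \sum_(j < n) boxsum K m (G j) =
    boxsum K m (fun ka => \sum_(j < n) G j ka).
    elim: m G => [|m IH] G //=; rewrite exchange_big /=; apply: eq_bigr => k _; exact: IH.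
  rewrite sumbox; apply: eq_boxsum => ka sk; exact: term_wave.
have [v [sv cv]] : exists f : V -> R, smooth e (f : V -> R^o) /\
    forall w y, Dw e w (F K : V -> R^o) y @[K --> \oo] --> Dw e w (f : V -> R^o) y.
  apply: smooth_limit => [K|w r d d0]; first exact: (FW K).1.
  (* For the fixed [s], the order [size w] gets its own constants: only convergence is wanted here,
     not smallness. *)
  have [C2 C20 [N2 HN2]] := decay (size w).
  pose cc := C2 * s ^+ N2 * expR (s * (r + r - a)).
  have cc0 : 0 <= cc by rewrite mulr_ge0 ?expR_ge0// mulr_ge0// exprn_ge0.
  have cc1 : 0 < cc + 1 by rewrite ltr_wpDl.
  have [N3 HN3] := sum_bk_cauchy (divr_gt0 d0 cc1).
  exists N3 => K K' NK NK' y yr.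
  have Hb ka : size ka = n -> `|Dw e w (term L i sg c s ka : V -> R^o) y| <=
    cc * \prod_(k <- ka) bk k.
    move=> sk; apply: le_trans (HN2 s s1 ka sk w (leqnn _) y) _.
    rewrite ler_wpM2r//; first by apply: prodr_ge0 => k _; exact: bk_ge0.
    rewrite ler_wpM2l ?mulr_ge0 ?exprn_ge0// ler_expR ler_wpM2l// lerD2r.
    apply: lerD.
      apply: le_trans (ler_norm _) _; rewrite normrM sg1 mul1r.
      apply: le_trans (norm_coord_le _ _) _; apply: le_trans yr.
      by rewrite ProdNormedZmodule.prod_normE /= le_max lexx.
    by apply: le_trans yr; rewrite ProdNormedZmodule.prod_normE /= le_max lexx orbT.
  rewrite !(FS _).2.
  have D (K1 K2 : nat) : (K1 <= K2)%N -> (N3 <= K1)%N ->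
    `|boxsum K2 n (fun ka => Dw e w (term L i sg c s ka : V -> R^o) y) -
      boxsum K1 n (fun ka => Dw e w (term L i sg c s ka : V -> R^o) y)| <= d.
    move=> K12 K1N; apply: le_trans (boxsum_dist K12 cc0 bk_ge0 Hb) _.
    apply: (@le_trans _ _ (cc * (d / (cc + 1)))).
      by rewrite ler_wpM2l//; apply: le_trans (ler_norm _) _; apply: HN3 => //;
        exact: leq_trans K12.
    by rewrite mulrA ler_pdivrMr// mulrC ler_wpM2l ?(ltW d0)// lerDl.
  by have [KK|/ltnW KK] := leqP K K'; [rewrite distrC|]; exact: D.
exists v; split.
- exact: rwave_limit FW sv cv.
- move=> x; have := cv [::] (x, 0) => /= /cvg_lim <-//.
  have -> : (fun K => F K (x, 0)) = (fun=> 0).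
    apply/funext => K; rewrite /F.
    rewrite (@eq_boxsum _ _ _ _ (fun=> 0 * 0)); last by move=> ka _; rewrite term_t0 mul0r.
    by rewrite -boxsumM mul0r.
  exact: lim_cst.
- move=> x xb.
  (* [K] sine frequencies correspond to [K.*2] packed indices, so the datum is read off along even
     cut-offs. *)
  have c1 : F K.*2 (x, 1) @[K --> \oo] --> v (x, 1).
    apply: (@cvg_comp _ _ _ (fun K => K.*2) (fun K => F K (x, 1)) \oo \oo); last exact: (cv [::]).
    move=> A [M _ HM]; exists M => // K /= MK; apply: HM => /=.
    by apply: leq_trans MK _; rewrite -addnn leq_addr.
  have gh : good Z (fun x => p x * expR (- (sg * s) * x ord0 i)).
    split; first by move=> z nZ; rewrite pZ// mul0r.
    exact: (smoothM sp (smooth_expc i (- (sg * s)))).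
  have c2 := sine_expansion L0 cZ ZL gh xb.
  have c3 : F K.*2 (x, 1) @[K --> \oo] -->
    expR (sg * s * x ord0 i) * (p x * expR (- (sg * s) * x ord0 i)).
    under eq_fun do rewrite /F boxsum_term_t1//.
    by apply: cvgM; [exact: cvg_cst|exact: c2].
  rewrite -(cvg_lim _ c1)// (cvg_lim _ c3)//.
  by rewrite mulrCA -expRD -mulrDl subrr mul0r expR0 mulr1.
- move=> w wq y ya.
  apply: (@cvg_norm_le _ _ _ _ 0%N (cv w y)) => K _.
  rewrite (FS K).2.
  have := @boxsum_le R K n (fun ka => Dw e w (term L i sg c s ka : V -> R^o) y) bk
    (C1 * s ^+ N * expR (s * (sg * y.1 ord0 i + `|y.2| - a))) _ bk_ge0.
  move/(_ _ (fun ka sk => HN s s1 ka sk w wq y)) => H.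
  apply: le_trans (H _) _; first by rewrite mulr_ge0 ?expR_ge0// mulr_ge0// exprn_ge0.
  apply: le_trans sE.
  have -> : C1 * 4 ^+ n * s ^+ N * expR (- s) = C1 * s ^+ N * expR (- s) * 4 ^+ n by ring.
  have Cs : 0 <= C1 * s ^+ N := mulr_ge0 C10 (exprn_ge0 _ s0).
  have b0 : 0 <= \sum_(k < K) bk k by apply: sumr_ge0 => k _; exact: bk_ge0.
  apply: ler_pM.
  + by rewrite mulr_ge0 ?expR_ge0.
  + exact: exprn_ge0.
  + by rewrite ler_wpM2l// ler_expR -[leRHS]mulrN1 ler_wpM2l//; lra.
  + by rewrite lerXn2r ?nnegrE ?sum_bk_le.
Qed.

End Piece.

(** * A smooth step function *)

Section Bump.
Context {R : realType}.

(* For [m = 0] the flat function [exp(- 1 / x)]; the powers of [1 / x] make the family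
   stable under differentiation. *)
Definition flatexp (m : nat) (x : R) : R := if 0 < x then x ^- m * expR (- x^-1) else 0.

Lemma is_derive_near (f g : R -> R) (x d r : R) : 0 < r -> (forall y, `|y - x| < r -> f y = g y) ->
  is_derive x 1 g d -> is_derive x 1 f d.
Proof.
move=> r0 fg dg; apply: is_derive_le => eps e0.
have [r' r'0 Hr] := is_derive_ex_le dg e0.
exists (Num.min r r'); first by rewrite lt_min r0.
move=> h h0; rewrite lt_min => /andP[h1 h2].
rewrite fg; last by rewrite [h *: 1]mulr1 addrK.
by rewrite (fg x) ?subrr ?normr0//; exact: Hr.
Qed.

(** The only delicate point is 0: there [exp (1 / h) >= h^-(m+2) / (m+2)!] for [h > 0] bounds the
    difference quotient by [(m+2)! h]. *)
Lemma is_derive_flatexp (m : nat) (x : R) :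
  is_derive x 1 (flatexp m) (- m%:R * flatexp m.+1 x + flatexp m.+2 x).
Proof.
have [x0|x0|->] := ltgtP x 0.
- have -> : - m%:R * flatexp m.+1 x + flatexp m.+2 x =
  0 by rewrite /flatexp ltNge (ltW x0) mulr0 addr0.
  apply: (is_derive_near (r := - x) _ _ (dv_cst 0 x)); first by rewrite oppr_gt0.
  move=> y; rewrite ltr_norml => /andP[_ yx]; rewrite /flatexp ltNge (_ : y <= 0)//; lra.
- have xn : x != 0 by rewrite gt_eqF.
  have di := dv_inv (f := fun y : R => y) xn (dv_id x).
  have dX : is_derive x 1 (fun y : R => (y^-1) ^+ m) (- m%:R * x ^- m.+1).
    elim: m => [|m IH]; first by rewrite mulr0n oppr0 mul0r; under eq_fun do rewrite expr0;
      exact: dv_cst.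
    under eq_fun do rewrite exprS.
    apply: (is_derive_eq (dv_mul di IH)); rewrite -!exprVn -natr1 !exprS expr0.
    by field.
  have dd := dv_mul dX (dv_comp (dv_opp di) (is_derive_expR (- x^-1))).
  apply: (is_derive_near x0 _ (is_derive_eq dd _)).
    move=> y; rewrite ltr_norml => /andP[yx _]; rewrite /flatexp (_ : 0 < y) ?exprVn//; lra.
  rewrite /flatexp x0 -!exprVn !exprS; field; exact: xn.
- have -> : - m%:R * flatexp m.+1 0 + flatexp m.+2 0 = 0 :> R by rewrite /flatexp ltxx mulr0 addr0.
  apply: is_derive_le => eps e0.
  have f0 : 0 < m.+2`!%:R :> R by rewrite ltr0n fact_gt0.
  exists (eps / m.+2`!%:R); first exact: divr_gt0.
  move=> h h0; rewrite ltr_pdivlMr// => hr.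
  rewrite [h *: 1]mulr1 addr0 subr0 [flatexp m 0]/flatexp ltxx subr0 /flatexp.
  case: ltP => h1; last by rewrite scaler0 normr0 ltW.
  rewrite ger0_norm; last by rewrite mulr_ge0 ?invr_ge0 ?(ltW h1)// mulr_ge0 ?expR_ge0// invr_ge0
    exprn_ge0// ltW.
  apply: le_trans (ltW hr); rewrite gtr0_norm//.
  have := expR_ge1Dxn m.+1 (ltW (_ : 0 < h^-1)); rewrite invr_gt0 => /(_ h1) E.
  have {}E : h^-1 ^+ m.+2 / m.+2`!%:R <= expR h^-1 by apply: le_trans E; rewrite lerDr.
  rewrite expRN /GRing.scale /= mulrA ler_pdivrMr ?expR_gt0//.
  apply: (@le_trans _ _ (h * m.+2`!%:R * (h^-1 ^+ m.+2 / m.+2`!%:R))); last first.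
    by rewrite ler_wpM2l// mulr_ge0 ?ltW.
  rewrite -exprVn -!exprS [h^-1 ^+ m.+2]exprS.
  have -> : h * m.+2`!%:R * (h^-1 * h^-1 ^+ m.+1 / m.+2`!%:R) = h^-1 ^+ m.+1.
    by field; rewrite h0 gt_eqF.
  by [].
Qed.

Local Notation e1 := (fun _ : unit => 1 : R).

Lemma smooth_flatexp m : smooth e1 (flatexp m : R -> R^o).
Proof.
move=> k; elim: k m => [|k IH] m.
  by split => //; exact: (is_derive_continuous (is_derive_flatexp m)).
split; first exact: (is_derive_continuous (is_derive_flatexp m)).
move=> i; split=> [x|]; first exact: (@ex_derive _ _ _ _ _ _ _ (is_derive_flatexp m x)).
have -> : 'D_1 (flatexp m : R -> R^o) = ((fun=> - m%:R) * flatexp m.+1 + flatexp m.+2 : R -> R^o).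
  by apply/funext => x; rewrite (@derive_val _ _ _ _ _ _ _ (is_derive_flatexp m x)).
apply: CkD; last exact: IH.
apply: CkM; last exact: IH.
by have [+ _] := smooth_cst e1 (- m%:R : R^o); exact.
Qed.

(** With φ = [flatexp 0], the step is φ(x) / (φ(x) + φ(1 - x)); the denominator is positive since
    [x] and [1 - x] are not both nonpositive. [eta] lists all its derivatives, the form that
    [smooth_coord] expects. *)
Lemma smooth_step_ex : exists eta : nat -> R -> R,
  [/\ forall (m : nat) (s : R), is_derive s 1 (eta m) (eta m.+1 s),
      forall s, s <= 0 -> eta 0%N s = 0 & forall s, 1 <= s -> eta 0%N s = 1].
Proof.
have sf := smooth_flatexp 0.
have cT : continuous (fun x : R => 1 - x) by move=> x; apply: cvgB; [exact: cvg_cst|exact: cvg_id].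
have TE (i : unit) (h x : R) : 1 - (h *: 1 + x) = (-1 * h) *: 1 + (1 - x) :> R.
  by rewrite /GRing.scale /=; ring.
have [sg _] := smooth_comp_affine cT TE sf.
have fge (x : R) : 0 <= flatexp 0 x by rewrite /flatexp; case: ifP => // _;
  rewrite expr0 invr1 mul1r expR_ge0.
have fgt (x : R) : 0 < x -> 0 < flatexp 0 x by move=> x0;
  rewrite /flatexp x0 expr0 invr1 mul1r expR_gt0.
have f0 (x : R) : x <= 0 -> flatexp 0 x = 0 by move=> x0; rewrite /flatexp ltNge x0.
have den0 (x : R) : flatexp 0 x + flatexp 0 (1 - x) != 0.
  rewrite gt_eqF//; have [x0|x0] := ltP 0 x; first by rewrite ltr_pwDl// fgt.
  by rewrite ltr_wpDl// fgt; lra.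
have sden := (smoothD sf sg).1.
have st := smoothM sf (smoothV sden den0).
pose eta (m : nat) : R -> R :=
  Dw e1 (nseq m tt) ((fun x => flatexp 0 x * (flatexp 0 x + flatexp 0 (1 - x))^-1) : R -> R^o).
exists eta; split.
- move=> m s; have := smooth_is_derive_Dw (nseq m tt) tt s st.
  by rewrite /eta (_ : nseq m.+1 tt = rcons (nseq m tt) tt)//; elim: (m) => //= k <-.
- by move=> s s0; rewrite /eta /= f0 ?mul0r.
- move=> s s1; rewrite /eta /= (f0 (1 - s)) ?subr_le0// addr0 divff// gt_eqF// fgt//.
  exact: lt_le_trans s1.
Qed.

End Bump.

Section AffineMaps.
Context {R : realType}.

Lemma nonexpansive_continuous (X Y : normedModType R) (f : X -> Y) :
  (forall x y, `|f x - f y| <= `|x - y|) -> continuous f.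
Proof.
move=> H x; apply/cvgrPdist_le => eps e0; apply/nbhs_ballP; exists eps => // y.
by rewrite -ball_normE /= => /ltW; apply: le_trans; exact: H.
Qed.

Context {X : normedModType R}.

Lemma continuous_subr (c : X) : continuous (fun x : X => x - c).
Proof. by apply: nonexpansive_continuous => x y; rewrite opprB addrA subrK. Qed.

Lemma continuous_add_fst (c : X) : continuous (fun y : X * R => (y.1 + c, y.2)).
Proof.
apply: nonexpansive_continuous => -[x t] [y s].
by rewrite !ProdNormedZmodule.prod_normE /= opprD addrACA subrr addr0.
Qed.

Lemma continuous_slice (t : R) : continuous (fun x : X => (x, t)).
Proof.
apply: nonexpansive_continuous => x y.
by rewrite ProdNormedZmodule.prod_normE /= subrr normr0 max_l.
Qed.

Lemma continuous_reflect : continuous (fun y : X * R => (y.1, 1 - y.2)).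
Proof.
apply: nonexpansive_continuous => -[x t] [y s].
rewrite !ProdNormedZmodule.prod_normE /= -[X in Num.max _ X]normrN.
by rewrite (_ : - (1 - t - (1 - s)) = t - s)//; ring.
Qed.

End AffineMaps.

(** * Cutting a shell into half-space pieces *)

Section Cutoff.
Context {R : realType} {n : nat}.
Local Notation V := ('rV[R]_n * R)%type.
Local Notation e := (@spacetime_dir R n).
Local Notation es := (@space_dir R n).

Lemma closed_norm_le (r : R) : closed [set x : 'rV[R]_n | `|x| <= r].
Proof.
have -> : [set x : 'rV[R]_n | `|x| <= r] = (fun x => `|x|) @^-1` [set t | t <= r] by [].
by apply: closed_comp => [x _|]; [exact: norm_continuous|exact: closed_le].
Qed.

Lemma closed_coord_ge (a sg : R) (i : 'I_n) : closed [set x : 'rV[R]_n | a <= sg * x ord0 i].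
Proof.
have -> : [set x : 'rV[R]_n | a <= sg * x ord0 i] =
  (fun x : 'rV[R]_n => sg * x ord0 i) @^-1` [set t | a <= t] by [].
have c : continuous (fun x : 'rV[R]_n => sg * x ord0 i).
  move=> x; apply: (@continuous_comp _ _ _ (fun x : 'rV[R]_n => x ord0 i) ( *%R sg)).
    exact: coord_continuous.
  exact: mulrl_continuous.
by apply: closed_comp => [x _|]; [exact: c|exact: closed_ge].
Qed.

Lemma piece (r a sg : R) (i : 'I_n) (p : 'rV[R]_n -> R) (q : nat) (eps : R) : 0 <= r ->
  `|sg| = 1 -> (forall x, p x != 0 -> `|x| <= r /\ a <= sg * x ord0 i) ->
  smooth es (p : _ -> R^o) -> 0 < eps ->
  exists v : V -> R, [/\ rwave v, forall x, v (x, 0) = 0,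
    forall x, `|x| <= r -> v (x, 1) = p x &
    forall w, (size w <= q)%N -> forall y : V, sg * y.1 ord0 i + `|y.2| <= a - 1 ->
      `|Dw e w (v : V -> R^o) y| <= eps].
Proof.
move=> r0 sg1 pS sp e0.
(* The translation puts the ball of radius [r] into the box of side [2 r + 2]; the extra unit keeps
   the support off the faces. The level [a] of the half-space moves by [sg * (r + 1)]. *)
pose c : 'rV[R]_n := const_mx (r + 1).
have cE j : c ord0 j = r + 1 by rewrite mxE.
have nx (x : 'rV[R]_n) j : `|x| <= r -> - r <= x ord0 j <= r.
  by move=> xr; rewrite -ler_norml; apply: le_trans (norm_coord_le _ _) xr.
pose Z := (fun x : 'rV[R]_n => x - c) @^-1` ([set x : 'rV[R]_n | `|x| <= r] `&` [set x :
  'rV[R]_n | a <= sg * x ord0 i]).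
have cZ : closed Z.
  have cB : continuous (fun x : 'rV[R]_n => x - c) := @continuous_subr R 'rV[R]_n c.
  apply: closed_comp => [x _|]; first exact: cB.
  by apply: closedI; [exact: closed_norm_le|exact: closed_coord_ge].
have L0 : 0 < r + r + 2 by lra.
have ZL x : Z x -> forall j, 0 < x ord0 j < r + r + 2.
  move=> [/nx H _] j; have := H j; rewrite rVB cE => /andP[h1 h2]; apply/andP; split; lra.
have Za x : Z x -> a + sg * (r + 1) <= sg * x ord0 i.
  by move=> [_ /=]; rewrite rVB cE mulrBr; lra.
pose p' x := p (x - c).
have pZ : csupp Z p'.
  move=> x nZ; apply/eqP; apply/negP => /negP /pS H; exact: nZ.
have sp' : smooth es (p' : _ -> R^o).
  have [] // := @smooth_comp_affine _ _ _ es R^o (fun x => x - c) (fun=> 1) (p : _ -> R^o).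
  - exact: continuous_subr.
  - by move=> j h x; rewrite mul1r addrA.
have [v [[sv wv] v0 v1 vb]] := piece_box q L0 cZ ZL sg1 Za pZ sp' e0.
pose T (y : V) : V := (y.1 + c, y.2).
have cT : continuous T := @continuous_add_fst R 'rV[R]_n c.
have TE d (h : R) (y : V) : T (h *: e d + y) = (1 * h) *: e d + T y.
  by rewrite mul1r /T /= -addrA.
have [sT DT] := smooth_comp_affine cT TE sv.
have {}DT w y : Dw e w ((fun y => v (T y)) : V -> R^o) y = Dw e w (v : V -> R^o) (T y).
  by rewrite DT big1 ?scale1r.
exists (fun y => v (T y)); split.
- split; [exact: sT|move=> y].
  by rewrite (DT [:: None; None]) -wv; apply: eq_bigr => j _; exact: (DT [:: Some j; Some j]).
- by move=> x; rewrite /T v0.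
- move=> x xr; rewrite /T /= v1 /p' ?addrK// => j.
  by rewrite rVD cE; have /andP[h1 h2] := nx x j xr; apply/andP; split; lra.
- move=> w wq y yb; rewrite DT; apply: vb => //=.
  by rewrite rVD cE mulrDr; lra.
Qed.

Lemma smooth_coord_affine (i : 'I_n) (al b : R) (eta : nat -> R -> R) :
  (forall (m : nat) (s : R), is_derive s 1 (eta m) (eta m.+1 s)) ->
  smooth es (fun x => eta 0%N (al * x ord0 i + b) : R^o).
Proof.
move=> de.
have := @smooth_coord R n i (fun m s => al ^+ m * eta m (al * s + b)).
under eq_fun do rewrite expr0 mul1r.
apply=> m s.
apply: (is_derive_eq (dv_scale (al ^+ m) (dv_comp (dv_add (dv_scale al (dv_id s)) (dv_cst b s))
  (de m _)))).
by rewrite addr0 mulr1 exprSr; ring.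
Qed.

Definition sgb (b : bool) : R := if b then 1 else -1.

(** With [h_m] the step of the [m]-th half-space, [g] splits into [h_1 g], [h_2 (1 - h_1) g] and so
    on, with the product of all [1 - h_m] times [g] left over. Half of [eps] goes to the current
    piece and half to the others. The set [2 |y| <= a - 1] lies in the region of smallness of every
    piece, whatever its coordinate and sign. *)
Lemma pieces (eta : nat -> R -> R) (r a : R) (q : nat) (ms : seq ('I_n * bool)) :
  (forall (m : nat) (s : R), is_derive s 1 (eta m) (eta m.+1 s)) ->
  (forall s, s <= 0 -> eta 0%N s = 0) -> 0 <= r ->
  forall (g : 'rV[R]_n -> R) (eps : R), smooth es (g : _ -> R^o) ->
  (forall x, g x != 0 -> `|x| <= r) -> 0 < eps ->
  exists v : V -> R, [/\ rwave v, forall x, v (x, 0) = 0,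
    forall x, `|x| <= r -> v (x, 1) =
      g x - \prod_(m <- ms) (1 - eta 0%N (sgb m.2 * x ord0 m.1 - a)) * g x &
    forall w, (size w <= q)%N -> forall y : V, `|y| *+ 2 <= a - 1 ->
      `|Dw e w (v : V -> R^o) y| <= eps].
Proof.
move=> de eta0 r0; elim: ms => [|[i b] ms IH] g eps sg gr e0.
  exists (fun=> 0); have [s0 D0] := smooth_cst e (0 : R^o); split => //.
  - split => // p; rewrite big1 => [|j _]; last by rewrite D0.
    by rewrite D0.
  - by move=> x _; rewrite big_nil mul1r subrr.
  - by move=> w _ y _; rewrite D0; case: w => [|? ?]; rewrite normr0 ltW.
pose h (x : 'rV[R]_n) := eta 0%N (sgb b * x ord0 i - a).
have sh : smooth es (h : _ -> R^o) := smooth_coord_affine i (sgb b) (- a) de.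
have e2 : 0 < eps / 2 by rewrite divr_gt0.
have sb1 : `|sgb b| = 1 by case: b {h sh}; rewrite /sgb ?normrN normr1.
have [|v1 [wv1 v10 v11 v1b]] :=
  @piece r a (sgb b) i (fun x => h x * g x) q _ r0 sb1 _ (smoothM sh sg) e2.
  move=> x; rewrite mulf_eq0 negb_or => /andP[hx gx]; split; first exact: gr.
  rewrite leNgt; apply/negP => xa; move: hx; rewrite /h eta0 ?eqxx//.
  by rewrite subr_le0 ltW.
have s1h : smooth es ((fun x => 1 - h x) : _ -> R^o).
  have [sN _] := smoothZ (-1) sh; have [s1 _] := smooth_cst es (1 : R^o).
  have [+ _] := smoothD s1 sN; congr (smooth es _); apply/funext => x; by rewrite scaleN1r.
have [|v2 [wv2 v20 v21 v2b]] := IH (fun x => (1 - h x) * g x) _ (smoothM s1h sg) _ e2.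
  by move=> x; rewrite mulf_eq0 negb_or => /andP[_]; exact: gr.
have [sv Dv] := smoothD wv1.1 wv2.1.
exists (fun y => v1 y + v2 y); split.
- exact: rwaveD.
- by move=> x; rewrite v10 v20 addr0.
- by move=> x xr; rewrite v11// v21// big_cons /= -/(h x); ring.
- move=> w wq y ya; rewrite Dv.
  have ysg : sgb b * y.1 ord0 i + `|y.2| <= a - 1.
    apply: le_trans ya; rewrite mulr2n; apply: lerD.
      apply: le_trans (ler_norm _) _; rewrite normrM sb1 mul1r.
      apply: le_trans (norm_coord_le _ _) _.
      by rewrite ProdNormedZmodule.prod_normE /= le_max lexx.
    by rewrite ProdNormedZmodule.prod_normE /= le_max lexx orbT.
  apply: le_trans (ler_normD _ _) _.
  have -> : eps = eps / 2 + eps / 2 by field.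
  by apply: lerD; [exact: v1b|exact: v2b].
Qed.

Lemma smooth_prod (J : Type) (s : seq J) (F : J -> 'rV[R]_n -> R) :
  (forall j, smooth es (F j : _ -> R^o)) -> smooth es ((fun x => \prod_(j <- s) F j x) : _ -> R^o).
Proof.
move=> sF; elim: s => [|j s IH].
  by under eq_fun do rewrite big_nil; have [+ _] := smooth_cst es (1 : R^o).
by under eq_fun do rewrite big_cons; exact: smoothM.
Qed.

Lemma norm_attained (x : 'rV[R]_n) : (0 < n)%N -> exists i, `|x| = `|x ord0 i|.
Proof.
move=> n0; have [x0|x0] := eqVneq (mx_norm x) 0; last first.
  by have [[a i] /= E] := mx_norm_neq0 x0; exists i; rewrite -[LHS]/(mx_norm x) E ord1.
exists (Ordinal n0); apply/eqP; rewrite eq_le norm_coord_le andbT.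
by rewrite -[leLHS]/(mx_norm x) x0.
Qed.

Lemma smooth_slice (u : V -> R) (t : R) : smooth e (u : V -> R^o) ->
  smooth es ((fun x => u (x, t)) : _ -> R^o).
Proof.
move=> su.
suff [] : smooth es ((fun w x => Dw e (map Some w) (u : V -> R^o) (x, t) : R^o) [::]) /\
  forall w, Dw es w ((fun w x => Dw e (map Some w) (u : V -> R^o) (x, t) : R^o) [::]) =
   (fun w x => Dw e (map Some w) (u : V -> R^o) (x, t) : R^o) w by [].
apply: smooth_family => [w x|w i x].
  apply: (@continuous_comp _ _ _ (fun x : 'rV[R]_n => (x, t)));
    first exact: (@continuous_slice R 'rV[R]_n t).
  exact: smooth_continuous (smooth_Dw _ su) _.
apply: is_derive_le => eps e0.
have [r r0 Hr] := is_derive_ex_le (smooth_is_derive_Dw (map Some w) (Some i) (x, t) su) e0.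
exists r => // h h0 hr; have := Hr h h0 hr; rewrite map_rcons.
suff -> : h *: e (Some i) + (x, t) = (h *: es i + x, t) by [].
by congr (_, _); rewrite /= scaler0 add0r.
Qed.

Lemma shell_step (j : nat) (r : 'rV[R]_n -> R) (eps : R) : (0 < n)%N -> smooth es (r : _ -> R^o) ->
  (forall x, `|x| < j%:R -> r x = 0) -> 0 < eps ->
  exists v : V -> R, [/\ rwave v, forall x, v (x, 0) = 0,
    forall x, `|x| < j.+1%:R -> r x - v (x, 1) = 0 &
    forall w, (size w <= j)%N -> forall y : V, `|y| *+ 2 <= j%:R - 2 ->
      `|Dw e w (v : V -> R^o) y| <= eps].
Proof.
move=> n0 sr rj e0.
have [eta [de eta0 eta1]] := @smooth_step_ex R.
(* The cutoff [chi] is 1 where [|x| < j + 1] and vanishes where [|x| > j + 2], the unit between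
   being the width of the step. *)
pose rho : R := j.+2%:R.
pose chi (x : 'rV[R]_n) := \prod_(i <- enum 'I_n) (eta 0%N (-1 * x ord0 i + rho)
  * eta 0%N (1 * x ord0 i + rho)).
have schi : smooth es (chi : _ -> R^o).
  apply: (@smooth_prod _ _ (fun i x => eta 0%N (-1 * x ord0 i + rho) * eta 0%N (1 * x ord0 i
    + rho))) => i.
  by apply: smoothM; exact: smooth_coord_affine.
have chi1 x : `|x| < j.+1%:R -> chi x = 1.
  move=> xj; rewrite /chi big1// => i _.
  have : `|x ord0 i| < j.+1%:R by apply: le_lt_trans xj; exact: norm_coord_le.
  rewrite ltr_norml => /andP[h1 h2].
  by rewrite !eta1 ?mulr1// /rho -natr1; lra.
have chi0 x : chi x != 0 -> `|x| <= rho.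
  move=> cx; apply: norm_rV_le => [|i]; first by rewrite ler0n.
  rewrite ler_norml; apply/andP; split; rewrite leNgt; apply/negP => h; move/negP: cx; apply;
    apply/eqP.
    by rewrite /chi (big_rem i) ?mem_enum//= (eta0 (1 * _ + _)) ?mulr0 ?mul0r//; lra.
  by rewrite /chi (big_rem i) ?mem_enum//= (eta0 (-1 * _ + _)) ?mul0r//; lra.
pose ms := [seq (i, b) | i <- enum 'I_n, b <- [:: true; false]].
(* The half-spaces start at [j - 1], one unit before the shell, so that the step has reached 1 as
   soon as [|x_i| >= j]. *)
have [||v [wv v0 v1 vb]] := @pieces eta rho (j%:R - 1) j ms de eta0 _ (fun x => chi x
  * r x) eps (smoothM schi sr) _ e0.
- by rewrite ler0n.
- by move=> x; rewrite mulf_eq0 negb_or => /andP[/chi0].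
exists v; split => //; last first.
  by move=> w wj y yj; apply: vb => //; apply: le_trans yj _; lra.
move=> x xj; rewrite v1 ?(chi1 x xj) ?mul1r; last first.
  by apply: ltW; apply: lt_le_trans xj _; rewrite ler_nat.
rewrite opprB addrC subrK.
have [xj'|xj'] := ltP `|x| j%:R; first by rewrite rj// mulr0.
(* The coordinate attaining the norm, with its sign, selects a factor [1 - eta] equal to 0, so
   nothing is left over at [x]. *)
have [i xi] := norm_attained x n0; rewrite xi in xj'.
pose b := 0 <= x ord0 i.
have bm : (i, b) \in ms by apply/allpairsP; exists (i, b); rewrite mem_enum; case: b.
rewrite (big_rem (i, b) bm) /= eta1 ?subrr ?mul0r//.
have -> : sgb b * x ord0 i = `|x ord0 i|.
  rewrite /b /sgb; case: leP => h; first by rewrite mul1r ger0_norm.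
  by rewrite mulN1r ltr0_norm.
lra.
Qed.

End Cutoff.

(** * Existence of waves with given snapshots *)

Section RealSolve.
Context {R : realType} {n : nat} (n0 : (0 < n)%N).
Local Notation V := ('rV[R]_n * R)%type.
Local Notation e := (@spacetime_dir R n).
Local Notation es := (@space_dir R n).

Lemma rwave0 : rwave (fun _ : V => 0 : R).
Proof.
have [s0 D0] := smooth_cst e (0 : R^o); split => // p.
by rewrite big1 => [|j _]; rewrite D0.
Qed.

Lemma sum_half (K K' : nat) : (K <= K')%N -> \sum_(K <= j < K') (2^-1 : R) ^+ j <= 2 * 2^-1 ^+ K.
Proof.
move=> KK; rewrite -(subnKC KK).
suff -> : \sum_(K <= j < K + (K' - K)) (2^-1 : R) ^+ j = 2 * 2^-1 ^+ K - 2 * 2^-1 ^+ (K + (K' - K)).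
  by rewrite gerBl mulr_ge0// exprn_ge0// invr_ge0.
elim: (K' - K)%N => [|m IH]; first by rewrite addn0 big_geq// subrr.
by rewrite addnS big_nat_recr ?leq_addr//= IH exprS; field.
Qed.

Lemma half_small (eps : R) : 0 < eps -> exists N : nat, 2 * (2^-1 : R) ^+ N <= eps.
Proof.
move=> e0; have e2 : 0 < eps / 2 by rewrite divr_gt0.
have h : `|2^-1 : R| < 1 by rewrite ger0_norm ?invr_ge0// invf_lt1 ?ltr1n.
have /cvgrPdist_le/(_ _ e2)[N _ HN] := cvg_expr h.
exists N; have := HN N (leqnn N); rewrite /= sub0r normrN ger0_norm ?exprn_ge0 ?invr_ge0//.
by rewrite ler_pdivlMr// mulrC.
Qed.

Lemma real_solve (f : 'rV[R]_n -> R) : smooth es (f : _ -> R^o) ->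
  exists u : V -> R, [/\ rwave u, forall x, u (x, 0) = 0 & forall x, u (x, 1) = f x].
Proof.
move=> sf.
have h0 j : 0 < (2^-1 : R) ^+ j by rewrite exprn_gt0// invr_gt0.
(* The requirements are conditional on the hypotheses on [r], so that [choice] applies to all pairs
   [(j, r)] and the remainders can be defined by plain recursion. *)
pose P (j : nat) (r : 'rV[R]_n -> R) (v : V -> R) := smooth es (r : _ -> R^o) ->
  (forall x, `|x| < j%:R -> r x = 0) -> [/\ rwave v, forall x, v (x, 0) = 0,
    forall x, `|x| < j.+1%:R -> r x - v (x, 1) = 0 &
    forall w, (size w <= j)%N -> forall y : V, `|y| *+ 2 <= j%:R - 2 ->
      `|Dw e w (v : V -> R^o) y| <= 2^-1 ^+ j].
have ex (jr : nat * ('rV[R]_n -> R)) : exists v, P jr.1 jr.2 v.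
  have [[s0 z0]|H] := pselect (smooth es (jr.2 : _ -> R^o) /\ forall x, `|x| < jr.1%:R -> jr.2 x =
    0).
    by have [v Hv] := shell_step n0 s0 z0 (h0 jr.1); exists v.
  by exists (fun=> 0) => s0 z0; exfalso; apply: H.
have [st Hst] := choice ex.
pose fix r (j : nat) : 'rV[R]_n -> R :=
  if j is k.+1 then (fun x => r k x - st (k, r k) (x, 1)) else f.
pose v j := st (j, r j).
have inv j : smooth es (r j : _ -> R^o) /\ forall x, `|x| < j%:R -> r j x = 0.
  elim: j => [|j [IHs IHz]]; first by split => // x; rewrite ltNge normr_ge0.
  have [[sv _] _ vz _] := Hst (j, r j) IHs IHz; split; last exact: vz.
  have [sN _] := smoothZ (-1) (smooth_slice 1 sv).
  have [+ _] := smoothD IHs sN; congr (smooth es _); apply/funext => x /=; by rewrite scaleN1r.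
have Hv j := Hst (j, r j) (inv j).1 (inv j).2.
have vW j : rwave (v j) by have [] := Hv j.
pose F K (y : V) := \sum_(j < K) v j y.
have FD K := @smooth_sum _ _ _ _ e _ (index_enum 'I_K) xpredT (fun j : 'I_K => v j : V ->
  R^o) (fun j => (vW j).1).
have FW K : rwave (F K).
  elim: K => [|K IH]; first by rewrite /F; under eq_fun do rewrite big_ord0; exact: rwave0.
  have -> : F K.+1 = fun y => F K y + v K y by apply/funext => y; rewrite /F big_ord_recr.
  exact: (rwaveD IH (vW K)).
have [u [su cu]] : exists u : V -> R, smooth e (u : V -> R^o) /\
    forall w y, Dw e w (F K : V -> R^o) y @[K --> \oo] --> Dw e w (u : V -> R^o) y.
  apply: smooth_limit => [K|w rho eps e0]; first exact: (FW K).1.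
  have [N1 HN1] := half_small e0.
  (* From [j = N2.+1] on, the ball of radius [rho] lies in [2 |y| <= j - 2], where the derivatives
     of [v j] up to order [j] are at most [2^-j]. *)
  pose N2 := Num.truncn (`|rho| *+ 2 + 2).
  exists (maxn N1 (maxn (size w) N2.+1)).
  have D (K K' : nat) : (maxn N1 (maxn (size w) N2.+1) <= K)%N -> (K <= K')%N -> forall x, `|x| <=
    rho ->
     `|Dw e w (F K' : V -> R^o) x - Dw e w (F K : V -> R^o) x| <= eps.
    rewrite !geq_max => /and3P[K1 K2 K3] KK x xr.
    rewrite (FD K).2 (FD K').2 -(big_mkord xpredT (fun j => Dw e w (v j : V -> R^o) x)).
    rewrite -(big_mkord xpredT (fun j => Dw e w (v j : V -> R^o) x)) (@big_cat_nat _ _ _ K)//=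
      addrAC subrr add0r.
    apply: le_trans (ler_norm_sum _ _ _) _.
    apply: (@le_trans _ _ (\sum_(K <= j < K') 2^-1 ^+ j)).
      rewrite big_nat [leRHS]big_nat; apply: ler_sum => j /andP[Kj _].
      have [_ _ _ vb] := Hv j; apply: vb; first exact: leq_trans Kj.
      rewrite lerBrDr; apply: (@le_trans _ _ (`|rho| *+ 2 + 2)).
        by rewrite lerD2r lerMn2r (le_trans xr)// ler_norm.
      apply: le_trans (ltW (truncnS_gt _)) _; rewrite ler_nat.
      exact: leq_trans K3 Kj.
    apply: le_trans (sum_half KK) _; apply: le_trans HN1.
    by rewrite ler_wpM2l// ler_wiXn2l// ?invr_ge0// invf_le1 ?ler1n.
  move=> K K' NK NK' x xr.
  by have [KK|/ltnW KK] := leqP K K'; [rewrite distrC|]; exact: D.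
exists u; split.
- exact: rwave_limit FW su cu.
- move=> x; have := cu [::] (x, 0) => /= /cvg_lim <-//.
  have -> : (fun K => F K (x, 0)) = (fun=> 0).
    by apply/funext => K; apply: big1 => j _; have [_ vj0 _ _] := Hv j; exact: vj0.
  exact: lim_cst.
- move=> x.
  (* A telescoping sum. Once [K > |x|] the remainder vanishes at [x], so the values at time 1 are
     eventually constant. *)
  have E K : F K (x, 1) = f x - r K x.
    elim: K => [|K IH]; first by rewrite /F big_ord0 subrr.
    by rewrite /F big_ord_recr /= -/(F K (x, 1)) IH /v; ring.
  have c1 : F K (x, 1) @[K --> \oo] --> u (x, 1) := cu [::] (x, 1).
  rewrite -(cvg_lim _ c1)//.
  apply: lim_near_cst => //; exists (Num.truncn `|x|).+1 => // K /= NK.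
  rewrite E (inv K).2 ?subr0//; apply: lt_le_trans (truncnS_gt _) _.
  by rewrite ler_nat.
Qed.

Lemma rwave_reflect (u : V -> R) : rwave u -> rwave (fun y => u (y.1, 1 - y.2)).
Proof.
move=> [su wu].
pose k (d : option 'I_n) : R := if d is Some _ then 1 else -1.
have TE d (h : R) (y : V) : ((h *: e d + y).1, 1 - (h *: e d + y).2) = (k d * h) *: e d
  + (y.1, 1 - y.2).
  case: d => [l|]; rewrite /k /=; congr (_, _).
  - by rewrite mul1r.
  - by rewrite /= !scaler0 !add0r.
  - by rewrite /= !scaler0 !add0r.
  - by rewrite /= [h *: 1]mulr1 [(-1 * h) *: 1]mulr1; ring.
have [s D] := smooth_comp_affine (@continuous_reflect R 'rV[R]_n) TE su.
split; [exact: s|move=> p].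
have D2 d : Dw e [:: d; d] ((fun y => u (y.1, 1 - y.2)) : V -> R^o) p =
    Dw e [:: d; d] (u : V -> R^o) (p.1, 1 - p.2).
  by rewrite (D [:: d; d]) !big_cons big_nil mulr1 -expr2 /k; case: d => [l|];
    rewrite ?sqrrN expr1n scale1r.
by rewrite (D2 None) -wu; apply: eq_bigr => j _; exact: D2.
Qed.

Lemma real_solve2 (f0 f1 : 'rV[R]_n -> R) : smooth es (f0 : _ -> R^o) ->
  smooth es (f1 : _ -> R^o) ->
  exists u : V -> R, [/\ rwave u, forall x, u (x, 0) = f0 x & forall x, u (x, 1) = f1 x].
Proof.
move=> s0 s1; have [u0 [w0 u00 u01]] := real_solve s0; have [u1 [w1 u10 u11]] := real_solve s1.
exists (fun y => u0 (y.1, 1 - y.2) + u1 y); split.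
- exact: (rwaveD (rwave_reflect w0) w1).
- by move=> x; rewrite /= subr0 u01 u10 addr0.
- by move=> x; rewrite /= subrr u00 u11 add0r.
Qed.

Lemma rwaveZ (c : R) (u : V -> R) : rwave u -> rwave (fun p => c * u p).
Proof.
move=> [su wu]; have [s D] := smoothZ c su; split; [exact: s|move=> p].
have D2 d : Dw e [:: d; d] ((fun p => c * u p) : V -> R^o) p =
    c * Dw e [:: d; d] (u : V -> R^o) p by rewrite (D [:: d; d]).
by rewrite (D2 None) -wu mulr_sumr; apply: eq_bigr => j _; exact: D2.
Qed.

(** [cos (pi (x_1 - t)) - cos (pi (x_1 + t))], which is [2 sin (pi x_1) sin (pi t)], is a difference
    of two plane waves, so smoothness and the wave equation come from [smooth_pwave]. *)
Lemma null_wave : exists u : V -> R, [/\ rwave u, forall x, u (x, 0) = 0, forall x, u (x, 1) = 0 &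
  exists y, u y != 0].
Proof.
pose i := Ordinal n0.
pose zeta (l : 'I_n) : R[i] := Complex 0 ((l == i)%:R * pi).
pose w (s : R) : V -> R := pwave 1 zeta (Complex 0 (s * pi)).
have E s (y : V) : w s y = cos (pi * y.1 ord0 i + s * pi * y.2).
  rewrite /w /pwave mul1r /phase.
  have -> : \sum_l zeta l * (y.1 ord0 l)%:C%C = Complex 0 (pi * y.1 ord0 i).
    rewrite (bigD1 i)//= big1 ?addr0 => [|l li]; last first.
      by rewrite /zeta (negbTE li) mul0r -[Complex 0 0]/(0 : R[i]) mul0r.
    by apply: complex_eq; rewrite ?cReM ?cImM /= ?mul0r ?eqxx ?mul1r ?mulr0 ?subrr ?add0r.
  have -> : Complex 0 (pi * y.1 ord0 i) + Complex 0 (s * pi) * (y.2)%:C%C =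
    Complex 0 (pi * y.1 ord0 i + s * pi * y.2).
    by apply: complex_eq; rewrite ?cReD ?cImD ?cReM ?cImM /= ?mul0r ?mulr0 ?subrr ?add0r.
  by rewrite /= expR0 mul1r.
have ww s : s ^+ 2 = 1 -> rwave (w s).
  move=> s2; have [sw D] := smooth_pwave 1 zeta (Complex 0 (s * pi)); split; [exact: sw|move=> p].
  have D' (d : option 'I_n) : Dw e [:: d; d] (w s : V -> R^o) p =
      pwave (symb zeta (Complex 0 (s * pi)) d ^+ 2) zeta (Complex 0 (s * pi)) p.
    by rewrite D !big_cons big_nil mul1r mulr1 expr2.
  rewrite D' (eq_bigr _ (fun j _ => D' (Some j))) /pwave -Re_sum -mulr_suml;
    congr (complex.Re (_ * _)).
  rewrite (bigD1 i)//= big1 ?addr0 => [|l li]; last first.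
    by rewrite /zeta (negbTE li) mul0r -[Complex 0 0]/(0 : R[i]) expr0n.
  rewrite /zeta eqxx mul1r; apply: complex_eq; rewrite !expr2 ?cReM ?cImM /= ?mul0r ?mulr0 ?addr0//.
  by rewrite !sub0r -!expr2 exprMn s2 mul1r.
exists (fun y => w (-1) y + -1 * w 1 y); split.
- have w1 : rwave (w 1) by apply: ww; rewrite expr1n.
  have w2 : rwave (w (-1)) by apply: ww; rewrite sqrrN expr1n.
  exact: (rwaveD w2 (rwaveZ (-1) w1)).
- by move=> x; rewrite !E /= !mulr0 !addr0 mulN1r subrr.
- move=> x; rewrite !E /= !mulr1 mulN1r !mul1r mulN1r.
  by rewrite (cosD _ (- pi)) (cosD _ pi) cosN sinN sinpi oppr0 subrr.
(* At [x_1 = t = 1/2] the value is [cos 0 - cos pi = 2]. *)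
- exists (const_mx 2^-1, 2^-1); rewrite !E /= mxE !mulN1r mul1r mulNr subrr cos0.
  have -> : pi / 2 + pi / 2 = pi :> R by rewrite -mulrDl -mulr2n -[pi *+ 2]mulr_natr mulfK.
  by rewrite cospi opprK -[1 + 1]mulr2n pnatr_eq0.
Qed.

End RealSolve.

(** * Passing between real and complex functions *)

Section Complexify.
Context {R : realType} {V : normedModType R} {I : Type} (e : I -> V).
Local Notation C := (Rcomplex R).

Lemma Rcomplex_normE (z : C) : `|z| = Num.sqrt (complex.Re z ^+ 2 + complex.Im z ^+ 2).
Proof. by case: z. Qed.

Lemma Re_le_Rnorm (z : C) : `|complex.Re z| <= `|z|.
Proof. by rewrite Rcomplex_normE -sqrtr_sqr ler_wsqrtr// lerDl sqr_ge0. Qed.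

Lemma Im_le_Rnorm (z : C) : `|complex.Im z| <= `|z|.
Proof. by rewrite Rcomplex_normE -sqrtr_sqr ler_wsqrtr// lerDr sqr_ge0. Qed.

Lemma Rnorm_le (z : C) : `|z| <= `|complex.Re z| + `|complex.Im z|.
Proof.
rewrite Rcomplex_normE -(ler_sqr (x := Num.sqrt _)) ?nnegrE ?addr_ge0 ?sqrtr_ge0//.
rewrite sqr_sqrtr ?addr_ge0 ?sqr_ge0// sqrrD !real_normK ?num_real//.
by rewrite addrAC lerDl mulrn_wge0// mulr_ge0.
Qed.

(** A real-linear map that does not increase the norm commutes with difference quotients and shrinks
    their errors; this treats real and imaginary parts at once. *)
Lemma smooth_linear_real (phi : C -> R) (f : V -> C) :
  (forall z z', phi (z - z') = phi z - phi z') -> (forall (h : R) z, phi (h *: z) = h * phi z) ->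
  (forall z, `|phi z| <= `|z|) -> smooth e f -> smooth e ((fun x => phi (f x)) : V -> R^o).
Proof.
move=> phiB phiZ phi_le sf.
suff [] : smooth e ((fun w x => phi (Dw e w f x) : R^o) [::]) /\
  forall w, Dw e w ((fun w x => phi (Dw e w f x) : R^o) [::]) =
    (fun w x => phi (Dw e w f x) : R^o) w by [].
apply: smooth_family => [w x|w i x].
  have cf : continuous (Dw e w f) by apply: (smooth_continuous (e := e)); exact: smooth_Dw.
  apply/cvgrPdist_le => eps e0; have /cvgrPdist_le/(_ _ e0) := cf x.
  apply: filterS => y; apply: le_trans; rewrite -phiB; exact: phi_le.
apply: is_derive_le => eps e0.
have [r r0 Hr] := is_derive_ex_le (smooth_is_derive_Dw w i x sf) e0.
exists r => // h h0 hr; apply: le_trans (Hr h h0 hr).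
by rewrite /GRing.scale /= -phiB -phiZ -phiB; exact: phi_le.
Qed.

Lemma smooth_complex (a b : V -> R) : smooth e (a : V -> R^o) -> smooth e (b : V -> R^o) ->
  smooth e ((fun x => Complex (a x) (b x)) : V -> C) /\
  forall w, Dw e w ((fun x => Complex (a x) (b x)) : V -> C) =
    (fun x => Complex (Dw e w (a : V -> R^o) x) (Dw e w (b : V -> R^o) x)).
Proof.
move=> sa sb.
apply: (@smooth_family _ _ C _ e (fun w x => Complex (Dw e w (a : V -> R^o) x) (Dw e w (b : V ->
  R^o) x))) => [w x|w i x].
  have ca : continuous (Dw e w (a : V -> R^o)) by apply: (smooth_continuous (e := e));
    exact: smooth_Dw.
  have cb : continuous (Dw e w (b : V -> R^o)) by apply: (smooth_continuous (e := e));
    exact: smooth_Dw.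
  apply/cvgrPdist_le => eps e0; have e2 : 0 < eps / 2 by rewrite divr_gt0.
  have /cvgrPdist_le/(_ _ e2) Ha := ca x; have /cvgrPdist_le/(_ _ e2) Hb := cb x.
  near=> y; apply: le_trans (Rnorm_le _) _.
  have -> : eps = eps / 2 + eps / 2 by field.
  by apply: lerD; near: y.
apply: is_derive_le => eps e0; have e2 : 0 < eps / 2 by rewrite divr_gt0.
have [r1 r10 H1] := is_derive_ex_le (smooth_is_derive_Dw w i x sa) e2.
have [r2 r20 H2] := is_derive_ex_le (smooth_is_derive_Dw w i x sb) e2.
exists (Num.min r1 r2) => [|h h0]; first by rewrite lt_min r10.
rewrite lt_min => /andP[hr1 hr2]; apply: le_trans (Rnorm_le _) _.
have -> : eps = eps / 2 + eps / 2 by field.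
by apply: lerD; [exact: H1|exact: H2].
Unshelve. all: by end_near. Qed.

End Complexify.

Lemma complex_wave {R : realType} {n : nat} (a b : 'rV[R]_n * R -> R) : rwave a -> rwave b ->
  is_wave ((fun p => Complex (a p) (b p)) : 'rV[R]_n * R -> Rcomplex R).
Proof.
move=> [sa wa] [sb wb]; have [s D] := smooth_complex sa sb; split; [exact: s|move=> p].
rewrite /laplacian.
have D2 (d : option 'I_n) := congr1 (fun g => g p) (D [:: d; d]).
rewrite (eq_bigr _ (fun j _ => D2 (Some j))) [RHS](D2 None).
rewrite -wa -wb; apply: complex_eq.
  by apply: (big_morph (fun z : Rcomplex R => complex.Re z)) => // -[? ?] [? ?].
by apply: (big_morph (fun z : Rcomplex R => complex.Im z)) => // -[? ?] [? ?].
Qed.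

Theorem proposition2p3 (R : realType) (n : nat) (n_ge1 : (1 <= n)%N)
    (f0 f1 : 'rV[R]_n -> Rcomplex R)
    (smooth_f0 : smooth space_dir f0) (smooth_f1 : smooth space_dir f1) :
  infinite_set [set u : 'rV[R]_n * R -> Rcomplex R |
    [/\ is_wave u, snapshot u 0 = f0 & snapshot u 1 = f1]].
Proof.
have sRe (f : 'rV[R]_n -> Rcomplex R) : smooth space_dir f ->
  smooth space_dir ((fun x => complex.Re (f x)) : _ -> R^o).
  by apply: (@smooth_linear_real _ _ _ _ (@complex.Re R)) => [[? ?] [? ?]|h [? ?]|z] //;
    exact: Re_le_Rnorm.
have sIm (f : 'rV[R]_n -> Rcomplex R) : smooth space_dir f ->
  smooth space_dir ((fun x => complex.Im (f x)) : _ -> R^o).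
  by apply: (@smooth_linear_real _ _ _ _ (@complex.Im R)) => [[? ?] [? ?]|h [? ?]|z] //;
    exact: Im_le_Rnorm.
have [a [wa a0 a1]] := real_solve2 n_ge1 (sRe _ smooth_f0) (sRe _ smooth_f1).
have [b [wb b0 b1]] := real_solve2 n_ge1 (sIm _ smooth_f0) (sIm _ smooth_f1).
have [v [wv v0 v1 [y vy]]] := @null_wave R n n_ge1.
(* Perturbing the real part alone suffices: its value at [y], where [v] is nonzero, determines
   [k]. *)
pose U (k : nat) : 'rV[R]_n * R -> Rcomplex R := fun p => Complex (a p + k%:R * v p) (b p).
have UA k : [/\ is_wave (U k), snapshot (U k) 0 = f0 & snapshot (U k) 1 = f1].
  split; first exact: (complex_wave (rwaveD wa (rwaveZ k%:R wv)) wb).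
    by apply/funext => x; apply: complex_eq; rewrite /= ?v0 ?mulr0 ?addr0 ?a0 ?b0.
  by apply/funext => x; apply: complex_eq; rewrite /= ?v1 ?mulr0 ?addr0 ?a1 ?b1.
have Uinj : injective U.
  move=> k l /(congr1 (fun g => complex.Re (g y))) /= /addrI /(mulIf vy) /eqP.
  by rewrite eqr_nat => /eqP.
move=> fin; have : finite_set (U @` [set: nat]).
  by apply: sub_finite_set fin => _ [k _ <-]; exact: UA.
by rewrite (eq_finite_set (inj_card_eq (in2W Uinj))); exact: infinite_nat.
Qed.
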